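(* Let $\varphi:\mathbb{D}\to\mathbb{C}$ be an inner function with $\varphi(0)=0$, and denote again by $\varphi:\mathbb{T}\to\mathbb{T}$ its boundary value (defined a.e.). Then for every interpolation family $\{E_\gamma:\gamma\in\mathbb{T}\}$ of norms on $\mathbb{C}^N$, the identity map $$Id:\{E_\gamma:\gamma\in\mathbb{T}\}[0]\to\{E_{\varphi(\gamma)}:\gamma\in\mathbb{T}\}[0]$$ is isometric.
   Context: $\mathbb{D}$ is the open unit disc, $\mathbb{T}=\partial\mathbb{D}$, and $m$ is normalized Lebesgue measure on $\mathbb{T}$. An interpolation family is a family $E_\gamma=(\mathbb{C}^N,\|\cdot\|_\gamma)$, $\gamma\in\mathbb{T}$, of complex $N$-dimensional normed spaces such that for each $x\in\mathbb{C}^N$ the function $\gamma\mapsto\|x\|_\gamma$ is measurable and $\int_{\mathbb{T}}\log^+\|x\|_\gamma\,dm(\gamma)<\infty$. The interpolated space at $0$, written $E[0]$ or $\{E_\gamma:\gamma\in\mathbb{T}\}[0]$, is $\mathbb{C}^N$ equipped with $$\|x\|_{E[0]}=\inf\Big\{\operatorname*{ess\,sup}_{\gamma\in\mathbb{T}}\|f(\gamma)\|_{E_\gamma}\ :\ f \text{ analytic},\ f(0)=x\Big\},$$ where $f:\mathbb{D}\to\mathbb{C}^N$ ranges over analytic functions whose coordinates belong to the Smirnov class $N^+(\mathbb{D})$, and $f(\gamma)$ denotes the a.e. nontangential boundary value. *)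

(* Defs.v *)
From HB Require Import structures.
From mathcomp Require Import all_boot all_order all_algebra complex.
From mathcomp Require Import all_classical all_reals all_analysis ess_sup_inf.

Set Implicit Arguments.
Unset Strict Implicit.
Unset Printing Implicit Defensive.

Import Order.TTheory GRing.Theory Num.Theory numFieldNormedType.Exports.

Local Open Scope classical_set_scope.
Local Open Scope ring_scope.
Local Open Scope complex_scope.

Section Circle.
Variable R : realType.

Definition disc : set R[i] := [set z | `|z| < 1].

Definition circle := {z : R[i] | `|z| == 1}.

Definition circle1 : circle := exist (fun z : R[i] => `|z| == 1) 1 (introT eqP (normr1 _)).

HB.instance Definition _ := Choice.on circle.
HB.instance Definition _ := isPointed.Build circle circle1.

Lemma circle_param_subproof (t : R) :
  `|cos (2 * pi * t) +i* sin (2 * pi * t)| == 1.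
Proof. by rewrite normc_def /= cos2Dsin2 sqrtr1. Qed.

(* t |-> exp(2 i pi t) *)
Definition circle_param (t : R) : circle :=
  exist (fun z : R[i] => `|z| == 1) _ (circle_param_subproof t).

(* The real line with the sigma-algebra of Lebesgue (not only Borel)
   measurable sets. *)
Local Notation lebesgueR := (caratheodory_type (@wlength R idfun)^*%mu).

Definition circle_measurable : set (set circle) :=
  image_set_system setT (circle_param : lebesgueR -> circle) measurable.

Let circle_sigma_algebra : sigma_algebra setT circle_measurable.
Proof. exact/sigma_algebra_image/sigma_algebra_measurable. Qed.

Let circle_measurable0 : circle_measurable set0.
Proof. by have [] := circle_sigma_algebra. Qed.

Let circle_measurableC A : circle_measurable A -> circle_measurable (~` A).
Proof. by rewrite -setTD; have [_ + _] := circle_sigma_algebra; apply. Qed.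

Let circle_measurable_bigcup (F : (set circle)^nat) :
  (forall i, circle_measurable (F i)) -> circle_measurable (\bigcup_i F i).
Proof. by have [_ _] := circle_sigma_algebra; apply. Qed.

Definition circle_display : measure_display.
Proof. exact. Qed.

HB.instance Definition _ := @isMeasurable.Build circle_display circle
  circle_measurable circle_measurable0 circle_measurableC
  circle_measurable_bigcup.

Lemma measurable_circle_param :
  measurable_fun setT (circle_param : lebesgueR -> circle).
Proof. by move=> _ A mA; exact: mA. Qed.

HB.instance Definition _ :=
  isMeasurableFun.Build _ _ lebesgueR circle circle_param
    measurable_circle_param.

Lemma measurable_fundamental_arc :
  measurable (`[0%R, 1%R[%classic : set lebesgueR).
Proof. apply: sub_caratheodory; exact: measurable_itv. Qed.

(* Normalized Lebesgue measure: the image of (completed) Lebesgue measure on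
   [0, 1[ by circle_param. *)
Definition circle_measure : set circle -> \bar R :=
  pushforward (mrestr completed_lebesgue_measure measurable_fundamental_arc)
    circle_param.

Let circle_measure0 : circle_measure set0 = 0%E.
Proof. exact: measure0. Qed.

Let circle_measure_ge0 A : (0 <= circle_measure A)%E.
Proof. exact: measure_ge0. Qed.

Let circle_measure_semi_sigma_additive : semi_sigma_additive circle_measure.
Proof. exact: measure_semi_sigma_additive. Qed.

HB.instance Definition _ :=
  @isMeasure.Build circle_display circle R circle_measure
    circle_measure0 circle_measure_ge0 circle_measure_semi_sigma_additive.

Lemma circle_measure_setT : circle_measure setT = 1%E.
Proof.
rewrite /circle_measure /pushforward /mrestr preimage_setT setTI.
transitivity (@lebesgue_measure R `[0, 1[%classic) => //.
by rewrite lebesgue_measure_itv /= lte_fin ltr01 sube0.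
Qed.

End Circle.

Arguments circle_measure {R}.

Section HardyClasses.
Variable R : realType.
Implicit Types (f g h phi : R[i] -> R[i]) (gamma : circle R).

(* R[i]^o is R[i] with its topology of a normed space over itself, so that
   derivable f z 1 is complex differentiability. *)
Definition analytic f : Prop :=
  forall z, disc z -> derivable (f : R[i]^o -> R[i]^o) z 1.

(* Stolz region with vertex gamma and aperture a > 1. *)
Definition stolz gamma (a : R) : set R[i]^o :=
  [set z | `|z| < 1 /\ `|z - val gamma| < a%:C * (1 - `|z|)].

Definition nontangential_limit f gamma (w : R[i]) : Prop :=
  forall a : R, 1 < a ->
    (f : R[i]^o -> R[i]^o) z
      @[z --> within (stolz gamma a) (nbhs (val gamma : R[i]^o))]
      --> (w : R[i]^o).

(* Set to 0 where f has no nontangential limit. *)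
Definition boundary_value f gamma : R[i] :=
  xget 0 [set w | nontangential_limit f gamma w].

Definition bounded_analytic f : Prop :=
  analytic f /\ exists M : R, forall z, disc z -> `|f z| <= M%:C.

Definition inner phi : Prop :=
  [/\ analytic phi,
      forall z, disc z -> `|phi z| <= 1 &
      {ae circle_measure, forall gamma, `|boundary_value phi gamma| = 1}].

(* The self-map of the circle induced by an inner function; the default value
   1 is taken on a null set only. *)
Definition boundary_map phi gamma : circle R :=
  insubd (circle1 R) (boundary_value phi gamma).

Definition cexp (z : R[i]) : R[i] :=
  (expR (complex.Re z))%:C *
  (cos (complex.Im z) +i* sin (complex.Im z)).

Definition cintegral (u : circle R -> R[i]) : R[i] :=
  (\int[circle_measure]_(gamma in setT) complex.Re (u gamma)) +i*
  (\int[circle_measure]_(gamma in setT) complex.Im (u gamma)).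

Definition outer h : Prop :=
  exists (c : R[i]) (k : circle R -> R),
    [/\ `|c| = 1, forall gamma, 0 < k gamma,
        circle_measure.-integrable setT (fun gamma => (ln (k gamma))%:E) &
        forall z, disc z ->
          h z = c * cexp (cintegral (fun gamma =>
            (val gamma + z) / (val gamma - z) * (ln (k gamma))%:C))].

(* N^+(D) is taken to be the set of quotients of bounded analytic functions
   with outer denominator. *)
Definition smirnov f : Prop :=
  analytic f /\ exists g h,
    [/\ bounded_analytic g, bounded_analytic h, outer h &
        forall z, disc z -> f z = g z / h z].

End HardyClasses.

Section Interpolation.
Variables (R : realType) (N : nat).
Local Notation CN := 'rV[R[i]]_N.
Implicit Types E : circle R -> CN -> R.

Definition is_norm (p : CN -> R) : Prop :=
  [/\ forall x y, p (x + y) <= p x + p y,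
      forall a x, (p (a *: x))%:C = `|a| * (p x)%:C &
      forall x, p x = 0 -> x = 0].

Definition interpolation_family E : Prop :=
  (forall gamma, is_norm (E gamma)) /\
  forall x,
    measurable_fun setT (fun gamma => E gamma x) /\
    (\int[circle_measure]_(gamma in setT)
       (Num.max 0 (ln (E gamma x)))%:E < +oo)%E.

Definition interpolated_norm E (x : CN) : \bar R :=
  ereal_inf [set r | exists f : R[i] -> CN,
    [/\ forall j, smirnov (fun z => f z 0 j),
        f 0 = x &
        r = ess_sup circle_measure (fun gamma =>
          (E gamma (\row_j boundary_value (fun z => f z 0 j) gamma))%:E)]].

End Interpolation.

(* Main.v *)
(* Let [psi] be the boundary map of the inner function [phi]. As [phi 0 = 0],
   [psi] and the identity of the circle have the same moments, so [psi]
   preserves the measure (Loewner). Multiplying a Smirnov competitor by bounded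
   outer functions which tend to 1 at the origin shows that bounded analytic
   competitors suffice for the infimum. If [f] competes for [E], then [f \o phi]
   has boundary value [f \o psi] and competes for [E \o psi] with the same
   constant. Conversely, if [g] competes for [E \o psi], its conditional
   expectation [F] given [psi] is the boundary value of the bounded analytic
   function [w |-> \int g(gamma) / (1 - w * conj (psi gamma))], which takes the
   same value at 0; since norms are convex, [E (F)] is a.e. bounded by the same
   constant. Fatou's theorem for bounded analytic functions: the
   traces on circles [|z| = r] are Cauchy in L^2, the limit has the function as
   Poisson integral, and Poisson integrals converge nontangentially at Lebesgue
   points. *)

From HB Require Import structures.
Require Import Defs.
From mathcomp Require Import all_boot all_order all_algebra complex.
From mathcomp Require Import all_classical all_reals all_analysis.
From mathcomp Require Import measurable_realfun ess_sup_inf ring lra.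

Set Implicit Arguments.
Unset Strict Implicit.
Unset Printing Implicit Defensive.

Import Order.TTheory GRing.Theory Num.Theory numFieldNormedType.Exports.
Import ComplexField.Normc.

Local Open Scope classical_set_scope.
Local Open Scope ring_scope.
Local Open Scope complex_scope.
Local Notation Re := complex.Re.
Local Notation Im := complex.Im.
Local Notation "z ^*" := (conjc z) : ring_scope.

(** * Complex limits and derivatives *)

(** Measurability of the family is given vector by vector, so the averaged competitor is not
    estimated through norming functionals chosen measurably in [gamma]: the circle is cut into cells
    on which finitely many vectors have almost constant norm, and the triangle inequality of one
    norm at a time is applied. Averaging asks for bounded competitors; the reduction from the
    Smirnov class costs a factor tending to 1, which an infimum does not see. The Cauchy kernel is
    complex-valued, so a bound on [g] does not pass through it directly; but as [phi 0 = 0], the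
    conjugate half of the Poisson kernel along [psi] integrates against [g] to [g 0], and the Cauchy
    integral is a Poisson integral. In the direct inequality the difficulty is that [phi z] may
    approach the circle tangentially, so limits of [f \o phi] are not compositions of limits.
    Finally, moments see only trigonometric polynomials; explicit step polynomials lead from these
    to arcs, arcs generate the Borel sets, and completeness of the measure gives all measurable
    sets. *)

Section ComplexNorm.
Variable R : realType.
Implicit Types (z w : R[i]) (r : R).

(** The norm of [R[i]] takes its values in [R[i]]. Estimates are made with [normc], its real-valued
    form, and return to the norm through this identity. *)
Lemma normr_normc z : `|z| = (normc z)%:C.
Proof. by case: z => a b; rewrite normc_def. Qed.

Lemma normc_ge0 z : 0 <= normc z.
Proof. by case: z => a b; exact: sqrtr_ge0. Qed.

Lemma ler_normcD z w : normc (z + w) <= normc z + normc w.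
Proof. by rewrite -lecR rmorphD/= -!normr_normc ler_normD. Qed.

Lemma normcN z : normc (- z) = normc z.
Proof. by apply: complexI; rewrite -!normr_normc normrN. Qed.

Lemma normcBC z w : normc (z - w) = normc (w - z).
Proof. by rewrite -normcN opprB. Qed.

Lemma ler_normcB z w : normc (z - w) <= normc z + normc w.
Proof. by rewrite -(normcN w) ler_normcD. Qed.

Lemma lerB_normc z w : normc z - normc w <= normc (z - w).
Proof. by rewrite lerBlDr -{1}(subrK w z) ler_normcD. Qed.

Lemma normc_eq0 z : (normc z == 0) = (z == 0).
Proof. by apply/eqP/eqP => [/eq0_normc//|->]; rewrite normc0. Qed.

Lemma normc_gt0 z : (0 < normc z) = (z != 0).
Proof. by rewrite lt_def normc_ge0 andbT normc_eq0. Qed.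

Lemma normc_real r : normc r%:C = `|r|.
Proof. by rewrite /= expr0n/= addr0 sqrtr_sqr. Qed.

Lemma normcX z n : normc (z ^+ n) = normc z ^+ n.
Proof. by elim: n => [|n ih]; rewrite ?expr0 ?normc1// !exprS normcM ih. Qed.

Lemma normc_conj z : normc z^* = normc z.
Proof. by case: z => a b /=; rewrite sqrrN. Qed.

Lemma normc_sqr z : normc z ^+ 2 = Re z ^+ 2 + Im z ^+ 2.
Proof. by case: z => a b /=; rewrite sqr_sqrtr ?addr_ge0 ?sqr_ge0. Qed.

Lemma normc_Re z : `|Re z| <= normc z.
Proof.
by rewrite -(ler_pXn2r (n := 2))// ?nnegrE ?normc_ge0// normc_sqr real_normK ?num_real// lerDl sqr_ge0.
Qed.

Lemma normc_Im z : `|Im z| <= normc z.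
Proof.
by rewrite -(ler_pXn2r (n := 2))// ?nnegrE ?normc_ge0// normc_sqr real_normK ?num_real// lerDr sqr_ge0.
Qed.

Lemma normc_le_ReIm z : normc z <= `|Re z| + `|Im z|.
Proof.
rewrite -(ler_pXn2r (n := 2))// ?nnegrE ?normc_ge0 ?addr_ge0// normc_sqr sqrrD.
by rewrite !real_normK ?num_real// addrAC lerDl mulrn_wge0// mulr_ge0.
Qed.

Lemma mulc_conj z : z * z^* = (normc z ^+ 2)%:C.
Proof. by rewrite normc_sqr; case: z => a b; simpc; congr (_ +i* _); ring. Qed.

Lemma cReD z w : Re (z + w) = Re z + Re w. Proof. by case: z; case: w. Qed.
Lemma cImD z w : Im (z + w) = Im z + Im w. Proof. by case: z; case: w. Qed.
Lemma cReN z : Re (- z) = - Re z. Proof. by case: z. Qed.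
Lemma cImN z : Im (- z) = - Im z. Proof. by case: z. Qed.
Lemma cReM z w : Re (z * w) = Re z * Re w - Im z * Im w.
Proof. by case: z; case: w. Qed.
Lemma cImM z w : Im (z * w) = Re z * Im w + Im z * Re w.
Proof. by case: z => a b; case: w. Qed.

Lemma conjcD z w : (z + w)^* = z^* + w^*.
Proof. by case: z => a b; case: w => c d; simpc; congr (_ +i* _); ring. Qed.
Lemma conjcM z w : (z * w)^* = z^* * w^*.
Proof. by case: z => a b; case: w => c d; simpc; congr (_ +i* _); ring. Qed.
Lemma conjcB z w : (z - w)^* = z^* - w^*.
Proof. by case: z => a b; case: w => c d; simpc; congr (_ +i* _); ring. Qed.
Lemma conjcK' z : z^*^* = z.
Proof. by case: z => a b; simpc. Qed.
Lemma conjc1 : (1 : R[i])^* = 1.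
Proof. by rewrite /= oppr0. Qed.
Lemma conjcV' z : (z^-1)^* = (z^*)^-1.
Proof.
by case: z => a b; rewrite /GRing.inv/= sqrrN mulNr.
Qed.

End ComplexNorm.

Section ComplexLimits.
Variable R : realType.
Local Notation C := (R[i]).
Local Notation Co := (R[i]^o).

(** Fixes [R[i]^o] as the target space once and for all. The rules for sums, products and inverses
    below are drawn from real limits, through real and imaginary parts. *)
Definition ccvg (T : Type) (F : set_system T) (f : T -> C) (l : C) :=
  (f : T -> Co) @ F --> (l : Co).

Lemma ccvgP (T : Type) (F : set_system T) {FF : Filter F} (f : T -> C) (l : C) :
  ccvg F f l <->
  forall e : R, 0 < e -> \forall x \near F, normc (f x - l) < e.
Proof.
split=> [/cvgrPdist_lt fl e e0|fl].
  have := fl e%:C; rewrite ltcR => /(_ e0); apply: filterS => x.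
  by rewrite distrC normr_normc ltcR.
apply/cvgrPdist_lt => e; rewrite ltcE => /andP[/eqP/= ei e0].
have := fl _ e0; apply: filterS => x xe.
by rewrite distrC normr_normc ltcE/= ei eqxx.
Qed.

Lemma cvg_Re (T : Type) (F : set_system T) {FF : Filter F} (f : T -> C) (l : C) :
  ccvg F f l -> Re (f x) @[x --> F] --> Re l.
Proof.
move=> /ccvgP fl; apply/cvgrPdist_lt => e e0; have := fl e e0.
apply: filterS => x; apply: le_lt_trans; rewrite distrC -cReN -cReD; exact: normc_Re.
Qed.

Lemma cvg_Im (T : Type) (F : set_system T) {FF : Filter F} (f : T -> C) (l : C) :
  ccvg F f l -> Im (f x) @[x --> F] --> Im l.
Proof.
move=> /ccvgP fl; apply/cvgrPdist_lt => e e0; have := fl e e0.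
apply: filterS => x; apply: le_lt_trans; rewrite distrC -cImN -cImD; exact: normc_Im.
Qed.

Lemma cvg_Complex (T : Type) (F : set_system T) {FF : Filter F} (f : T -> C) (l : C) :
  Re (f x) @[x --> F] --> Re l -> Im (f x) @[x --> F] --> Im l ->
  ccvg F f l.
Proof.
move=> /cvgrPdist_lt fr /cvgrPdist_lt fi; apply/ccvgP => e e0.
have e2 : 0 < e / 2 by rewrite divr_gt0.
have := fr _ e2; have := fi _ e2; apply: filterS2 => x h1 h2.
rewrite (le_lt_trans (normc_le_ReIm _))// (splitr e) ltrD//.
  by rewrite cReD cReN distrC.
by rewrite cImD cImN distrC.
Qed.

Lemma cvg_normc (T : Type) (F : set_system T) {FF : Filter F} (f : T -> C) (l : C) :
  ccvg F f l -> normc (f x) @[x --> F] --> normc l.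
Proof.
move=> /ccvgP fl; apply/cvgrPdist_lt => e e0; have := fl e e0; apply: filterS => x.
apply: le_lt_trans; rewrite ler_norml lerNl opprB -(normcBC l) lerB_normc andbT.
by rewrite normcBC lerB_normc.
Qed.

Lemma cvg_realC (T : Type) (F : set_system T) {FF : Filter F} (f : T -> R) (l : R) :
  f x @[x --> F] --> l -> ccvg F (fun x => (f x)%:C) (l%:C).
Proof. by move=> fl; apply: cvg_Complex => //=; exact: cvg_cst. Qed.

Lemma ccvg_cst (T : Type) (F : set_system T) {FF : Filter F} (c : C) : ccvg F (fun=> c) c.
Proof. exact: (@cvg_cst Co). Qed.

Lemma eq_ccvg (T : Type) (F : set_system T) (f g : T -> C) (l : C) :
  f =1 g -> ccvg F f l -> ccvg F g l.
Proof. by move=> /funext ->. Qed.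

Lemma near_eq_ccvg (T : Type) (F : set_system T) {FF : Filter F} (f g : T -> C) (l : C) :
  (\forall x \near F, f x = g x) -> ccvg F f l -> ccvg F g l.
Proof.
move=> fg /ccvgP fl; apply/ccvgP => e /fl; apply: filterS2 fg => x ->; exact.
Qed.

Lemma ccvgD (T : Type) (F : set_system T) {FF : Filter F} (f g : T -> C) (l k : C) :
  ccvg F f l -> ccvg F g k ->
  ccvg F (fun x => f x + g x) (l + k).
Proof.
move=> fl gk; apply: cvg_Complex; rewrite ?cReD ?cImD.
  by under eq_cvg do rewrite cReD; apply: cvgD; exact: cvg_Re.
by under eq_cvg do rewrite cImD; apply: cvgD; exact: cvg_Im.
Qed.

Lemma ccvgN (T : Type) (F : set_system T) {FF : Filter F} (f : T -> C) (l : C) :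
  ccvg F f l -> ccvg F (fun x => - f x) (- l).
Proof.
move=> fl; apply: cvg_Complex; rewrite ?cReN ?cImN.
  by under eq_cvg do rewrite cReN; apply: cvgN; exact: cvg_Re.
by under eq_cvg do rewrite cImN; apply: cvgN; exact: cvg_Im.
Qed.

Lemma ccvgB (T : Type) (F : set_system T) {FF : Filter F} (f g : T -> C) (l k : C) :
  ccvg F f l -> ccvg F g k ->
  ccvg F (fun x => f x - g x) (l - k).
Proof. by move=> fl gk; exact: ccvgD fl (ccvgN gk). Qed.

Lemma ccvgM (T : Type) (F : set_system T) {FF : Filter F} (f g : T -> C) (l k : C) :
  ccvg F f l -> ccvg F g k ->
  ccvg F (fun x => f x * g x) (l * k).
Proof.
move=> fl gk; apply: cvg_Complex; rewrite ?cReM ?cImM.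
  under eq_cvg do rewrite cReM.
  by apply: cvgB; apply: cvgM; first [exact: cvg_Re|exact: cvg_Im].
under eq_cvg do rewrite cImM.
by apply: cvgD; apply: cvgM; first [exact: cvg_Re|exact: cvg_Im].
Qed.

Lemma cReV (z : C) : Re z^-1 = Re z / (Re z ^+ 2 + Im z ^+ 2).
Proof. by case: z. Qed.

Lemma cImV (z : C) : Im z^-1 = - (Im z / (Re z ^+ 2 + Im z ^+ 2)).
Proof. by case: z. Qed.

Lemma ccvgV (T : Type) (F : set_system T) {FF : Filter F} (f : T -> C) (l : C) :
  l != 0 -> ccvg F f l -> ccvg F (fun x => (f x)^-1) (l^-1).
Proof.
move=> l0 fl; have n0 : Re l ^+ 2 + Im l ^+ 2 != 0.
  by rewrite -normc_sqr expf_eq0/= normc_eq0.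
have nl : Re (f x) ^+ 2 + Im (f x) ^+ 2 @[x --> F] --> Re l ^+ 2 + Im l ^+ 2.
  by apply: cvgD; rewrite expr2; under eq_cvg do rewrite expr2;
    apply: cvgM; first [exact: cvg_Re|exact: cvg_Im].
apply: cvg_Complex; rewrite ?cReV ?cImV.
  by under eq_cvg do rewrite cReV; apply: cvgM; [exact: cvg_Re|exact: cvgV].
under eq_cvg do rewrite cImV.
by apply: cvgN; apply: cvgM; [exact: cvg_Im|exact: cvgV].
Qed.

Lemma ccvg_id (z : C) : ccvg (nbhs (z : Co)) id z.
Proof. exact: (@cvg_id Co). Qed.

Lemma ccvgE (T : Type) (F : set_system T) (f : T -> C) (l : C) :
  ccvg F f l = ((f : T -> Co) @ F --> (l : Co)).
Proof. by []. Qed.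

Arguments ccvg_cst {T F FF} c.
Arguments ccvg_id z : clear implicits.

Opaque ccvg.

Lemma ccvg_unique (T : Type) (F : set_system T) {FF : ProperFilter F} (f : T -> C) (l k : C) :
  ccvg F f l -> ccvg F f k -> l = k.
Proof.
move=> fl fk; have : Re l = Re k /\ Im l = Im k.
  split; first exact: (cvg_unique _ (cvg_Re fl) (cvg_Re fk)).
  exact: (cvg_unique _ (cvg_Im fl) (cvg_Im fk)).
by case: (l) => a b; case: (k) => c d /= [-> ->].
Qed.

Definition ccontinuous_at (f : C -> C) (z : C) := ccvg (nbhs (z : Co)) f (f z).

Lemma nbhs_normc (z : C) (P : C -> Prop) :
  (\forall w \near (z : Co), P w) <-> exists2 d : R, 0 < d & forall w, normc (w - z) < d -> P w.
Proof.
split=> [|[d d0 dP]].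
  move=> /nbhs_ballP[e /=]; rewrite ltcE => /andP[/eqP/= ei e0] eP.
  exists (Re e) => // w we; apply: eP; rewrite /ball/= distrC normr_normc ltcE/=.
  by rewrite we ei eqxx.
apply/nbhs_ballP; exists d%:C => /=; first by rewrite ltcR.
by move=> w; rewrite /ball/= distrC normr_normc ltcR; exact: dP.
Qed.

Lemma ccontinuous_atP (f : C -> C) z : ccontinuous_at f z <->
  forall e : R, 0 < e -> exists2 d : R, 0 < d & forall w, normc (w - z) < d -> normc (f w - f z) < e.
Proof.
split=> [/ccvgP h e /h /nbhs_normc//|h].
by apply/ccvgP => e /h /nbhs_normc.
Qed.

Lemma ccontinuous_comp (f g : C -> C) z : ccontinuous_at f z -> ccontinuous_at g (f z) ->
  ccontinuous_at (g \o f) z.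
Proof. by move=> fz gz; apply: (cvg_comp _ _ fz gz). Qed.

(** Caratheodory's form of complex differentiability: the slope [q] is a function continuous at [z],
    so the rules for sums, products and compositions involve neither division nor punctured
    neighbourhoods. *)
Definition cdiff (f : C -> C) (z : C) := exists q : C -> C,
  ccontinuous_at q z /\ forall w, f w = f z + q w * (w - z).

Lemma cdiff_continuous f z : cdiff f z -> ccontinuous_at f z.
Proof.
move=> [q [qc fq]].
have h : ccvg (nbhs (z : Co)) (fun w => w - z) (z - z).
  by apply: ccvgB; [exact: ccvg_id|exact: ccvg_cst].
have : ccvg (nbhs (z : Co)) (fun w => f z + q w * (w - z)) (f z + q z * (z - z)).
  by apply: ccvgD; [exact: ccvg_cst|exact: ccvgM qc h].
rewrite subrr mulr0 addr0; apply: eq_ccvg => w; exact/esym/fq.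
Qed.

Lemma cdiff_cst c z : cdiff (cst c) z.
Proof. by exists (cst 0); split => [|w]; [exact: ccvg_cst|rewrite /= mul0r addr0]. Qed.

Lemma cdiff_id z : cdiff id z.
Proof. by exists (cst 1); split => [|w]; [exact: ccvg_cst|rewrite /= mul1r addrC subrK]. Qed.

Lemma cdiffD f g z : cdiff f z -> cdiff g z -> cdiff (fun w => f w + g w) z.
Proof.
move=> [p [pc fp]] [q [qc gq]]; exists (fun w => p w + q w); split; first exact: ccvgD pc qc.
by move=> w; rewrite {1}fp {1}gq; ring.
Qed.

Lemma cdiffM f g z : cdiff f z -> cdiff g z -> cdiff (fun w => f w * g w) z.
Proof.
move=> df dg; have cf := cdiff_continuous df; have cg := cdiff_continuous dg.
move: df dg => [p [pc fp]] [q [qc gq]].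
exists (fun w => p w * g w + f z * q w); split.
  apply: ccvgD; first exact: ccvgM pc cg.
  apply: ccvgM qc; exact: ccvg_cst.
by move=> w; rewrite {1}fp {2}gq {1}gq; ring.
Qed.

Lemma cdiffN f z : cdiff f z -> cdiff (fun w => - f w) z.
Proof.
move=> [p [pc fp]]; exists (fun w => - p w); split; first exact: ccvgN pc.
by move=> w; rewrite {1}fp; ring.
Qed.

Lemma cdiffB f g z : cdiff f z -> cdiff g z -> cdiff (fun w => f w - g w) z.
Proof. by move=> df dg; apply: cdiffD => //; exact: cdiffN. Qed.

Lemma cdiffX f n z : cdiff f z -> cdiff (fun w => f w ^+ n) z.
Proof.
move=> df; elim: n => [|n ih]; first by under eq_fun do rewrite expr0; exact: cdiff_cst.
by under eq_fun do rewrite exprS; exact: cdiffM.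
Qed.

Lemma cdiff_comp f g z : cdiff f z -> cdiff g (f z) -> cdiff (g \o f) z.
Proof.
move=> df; have cf := cdiff_continuous df; move: df => [p [pc fp]] [q [qc gq]].
exists (fun w => q (f w) * p w); split.
  exact: ccvgM (ccontinuous_comp cf qc) pc.
by move=> w /=; rewrite gq [in X in _ * X]fp; ring.
Qed.

(** The slope identity must hold for every [w], not only near [z]; away from [z] the slope of [f] is
    therefore replaced by the difference quotient of [g]. *)
Lemma near_cdiff f g z : (\forall w \near (z : Co), f w = g w) -> cdiff f z -> cdiff g z.
Proof.
move=> fg [q [qc fq]]; have fgz : f z = g z by apply: nbhs_singleton fg.
exists (fun w => if w == z then q z else (g w - g z) / (w - z)); split.
  rewrite /ccontinuous_at eqxx; apply: near_eq_ccvg qc.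
  near=> w; case: eqP => [->//|/eqP wz].
  have fgw : f w = g w by near: w.
  by rewrite -fgw -fgz fq addrC addKr mulfK// subr_eq0.
move=> w; case: eqP => [->|/eqP wz]; first by rewrite subrr mulr0 addr0.
by rewrite mulfVK ?subr_eq0// addrC subrK.
Unshelve. all: by end_near. Qed.

Lemma cdiff_inv z : z != 0 -> cdiff (fun w => w^-1) z.
Proof.
move=> z0; pose q w : C := if w == 0 then z^-1 / z else - (w^-1 / z).
exists q; split.
  rewrite /ccontinuous_at /q (negbTE z0).
  have : ccvg (nbhs (z : Co)) (fun w => - (w^-1 / z)) (- (z^-1 / z)).
    by apply: ccvgN; apply: ccvgM; [exact: ccvgV z0 (ccvg_id z)|exact: ccvg_cst].
  apply: near_eq_ccvg; apply/nbhs_normc; exists (normc z).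
    by rewrite normc_gt0.
  by move=> w; case: eqP => // ->; rewrite sub0r normcN ltxx.
move=> w; rewrite /q; case: eqVneq => [->|w0].
  by rewrite invr0 sub0r mulrN mulfVK// subrr.
by field; rewrite z0 w0.
Qed.

Lemma cdiffV f z : f z != 0 -> cdiff f z -> cdiff (fun w => (f w)^-1) z.
Proof. by move=> fz df; exact: (cdiff_comp df (cdiff_inv fz)). Qed.

Lemma derivable_cdiff (f : C -> C) z : derivable (f : Co -> Co) z 1 <-> cdiff f z.
Proof.
split.
  move=> /cvg_ex[/= l fl].
  exists (fun w => if w == z then l else (f w - f z) / (w - z)); split.
    rewrite /ccontinuous_at eqxx; apply/ccvgP => e e0.
    have /ccvgP/(_ e e0) := fl.
    move=> /(nbhs_normc 0)[d d0 dP]; apply/nbhs_normc; exists d => // w wd.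
    case: eqP => [_|/eqP wz]; first by rewrite subrr normc0.
    have := dP (w - z); rewrite subr0 subr_eq0 => /(_ wd wz).
    suff -> : ((w - z)^-1 *: ((f (((w - z) *: (1 : Co)) + z) : Co) - f z) : Co)
      = (f w - f z) / (w - z) :> C by [].
    rewrite /GRing.scale/= mulr1 subrK mulrC; reflexivity.
  move=> w; case: eqP => [->|/eqP wz]; first by rewrite subrr mulr0 addr0.
  by rewrite mulfVK ?subr_eq0// addrC subrK.
move=> [q [/ccontinuous_atP qc fq]]; apply/cvg_ex; exists (q z : Co).
apply/ccvgP => e /qc[d d0 dP].
apply/(nbhs_normc 0); exists d => // w; rewrite subr0 => wd w0.
suff -> : (w^-1 *: ((f ((w *: (1 : Co)) + z) : Co) - f z) : Co) = q (w + z) :> C.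
  by apply: dP; rewrite addrK.
rewrite /GRing.scale/= mulr1 fq addrK.
transitivity (w^-1 * (q (w + z) * w)); last by rewrite mulrCA mulVf// mulr1.
congr (_ * _).
rewrite [X in X = _]addrC. exact: addKr.
Qed.

End ComplexLimits.

Arguments ccvg_cst {R T F FF} c.
Arguments ccvg_id {R} z.

(** * Complex-valued integrals *)

Section ComplexMeasurable.
Context d (T : measurableType d) (R : realType).
Local Notation C := (R[i]).
Implicit Types (h k : T -> C) (D : set T).

Definition cmeas D h :=
  measurable_fun D (fun x => Re (h x)) /\ measurable_fun D (fun x => Im (h x)).

Lemma cmeas_cst D (c : C) : cmeas D (fun=> c).
Proof. by split; exact: measurable_cst. Qed.

Lemma cmeas_real D (u : T -> R) : measurable_fun D u -> cmeas D (fun x => (u x)%:C).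
Proof. by move=> mu; split => //=; exact: measurable_cst. Qed.

Lemma cmeasD D h k : cmeas D h -> cmeas D k -> cmeas D (fun x => h x + k x).
Proof.
move=> [h1 h2] [k1 k2]; split.
  by under eq_fun do rewrite cReD; exact: measurable_funD.
by under eq_fun do rewrite cImD; exact: measurable_funD.
Qed.

Lemma cmeasN D h : cmeas D h -> cmeas D (fun x => - h x).
Proof.
move=> [h1 h2]; split.
  by under eq_fun do rewrite cReN; exact: measurableT_comp.
by under eq_fun do rewrite cImN; exact: measurableT_comp.
Qed.

Lemma cmeasB D h k : cmeas D h -> cmeas D k -> cmeas D (fun x => h x - k x).
Proof. by move=> mh mk; exact: cmeasD mh (cmeasN mk). Qed.

Lemma cmeasM D h k : cmeas D h -> cmeas D k -> cmeas D (fun x => h x * k x).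
Proof.
move=> [h1 h2] [k1 k2]; split.
  by under eq_fun do rewrite cReM; apply: measurable_funB; exact: measurable_funM.
by under eq_fun do rewrite cImM; apply: measurable_funD; exact: measurable_funM.
Qed.

Lemma cmeasX D h n : cmeas D h -> cmeas D (fun x => h x ^+ n).
Proof.
move=> mh; elim: n => [|n ih]; first by under eq_fun do rewrite expr0; exact: cmeas_cst.
by under eq_fun do rewrite exprS; exact: cmeasM.
Qed.

Lemma cmeas_conj D h : cmeas D h -> cmeas D (fun x => (h x)^*).
Proof.
move=> [h1 h2]; split; first by apply: eq_measurable_fun h1 => x _; case: (h x).
suff -> : (fun x => Im (h x)^*) = \- (fun x => Im (h x)) by exact: measurableT_comp.
by apply/funext => x /=; case: (h x).
Qed.

Lemma measurable_inv (u : T -> R) D : measurable D -> measurable_fun D u ->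
  measurable_fun D (fun x => (u x)^-1).
Proof.
move=> mD mu; have minv : measurable_fun [set: R] (@GRing.inv R).
  have m0 : measurable ([set~ 0] : set R) by exact: measurableC.
  rewrite -(setUv [set 0 : R]); apply/measurable_funU => //; split.
    exact: measurable_fun_set1.
  apply: open_continuous_measurable_fun; first by apply: closed_openC; exact: closed_eq.
  by move=> x /= /set_mem /eqP x0; exact: inv_continuous.
exact: (measurableT_comp minv).
Qed.

Lemma cmeasV D h : measurable D -> cmeas D h -> cmeas D (fun x => (h x)^-1).
Proof.
move=> mD [h1 h2].
have m2 : measurable_fun D (fun x => (Re (h x) ^+ 2 + Im (h x) ^+ 2)^-1).
  by apply: measurable_inv => //; apply: measurable_funD; exact: measurable_funX.
split.
  by under eq_fun do rewrite cReV; exact: measurable_funM.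
under eq_fun do rewrite cImV.
by apply: measurableT_comp => //; exact: measurable_funM.
Qed.

Lemma measurable_normc D h : cmeas D h -> measurable_fun D (fun x => normc (h x)).
Proof.
move=> [h1 h2]; have -> : (fun x => normc (h x)) =
    (fun x => Num.sqrt (Re (h x) ^+ 2 + Im (h x) ^+ 2)).
  by apply/funext => x; case: (h x).
apply: (measurableT_comp (f := @Num.sqrt R)).
  by apply: continuous_measurable_fun; exact: sqrt_continuous.
by apply: measurable_funD; exact: measurable_funX.
Qed.

End ComplexMeasurable.

Section ComplexIntegral.
Context d (T : measurableType d) (R : realType) (mu : {measure set T -> \bar R}).
Local Notation C := (R[i]).
Implicit Types (h k : T -> C) (D : set T).

Definition Cint D h : C :=
  (\int[mu]_(x in D) Re (h x)) +i* (\int[mu]_(x in D) Im (h x)).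

Definition Cintegrable D h :=
  mu.-integrable D (EFin \o (fun x => Re (h x))) /\
  mu.-integrable D (EFin \o (fun x => Im (h x))).

Lemma Cintegrable_cmeas D h : Cintegrable D h -> cmeas D h.
Proof.
by move=> [/integrableP[h1 _] /integrableP[h2 _]]; split; exact/measurable_EFinP.
Qed.

Lemma CintegrableD D h k : measurable D ->
  Cintegrable D h -> Cintegrable D k -> Cintegrable D (fun x => h x + k x).
Proof.
move=> mD [h1 h2] [k1 k2]; split.
  rewrite (_ : _ \o _ = (EFin \o (fun x => Re (h x))) \+ (EFin \o (fun x => Re (k x))))%E.
    exact: integrableD.
  by apply/funext => x /=; rewrite cReD.
rewrite (_ : _ \o _ = (EFin \o (fun x => Im (h x))) \+ (EFin \o (fun x => Im (k x))))%E.
  exact: integrableD.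
by apply/funext => x /=; rewrite cImD.
Qed.

Lemma CintegrableZl D (c : C) h : measurable D -> Cintegrable D h -> Cintegrable D (fun x => c * h x).
Proof.
move=> mD [h1 h2]; split.
  rewrite (_ : _ \o _ = (fun x => (Re c)%:E * (EFin \o (fun x => Re (h x))) x) \-
     (fun x => (Im c)%:E * (EFin \o (fun x => Im (h x))) x))%E.
    by apply: integrableB => //; exact: integrableZl.
  by apply/funext => x /=; rewrite cReM.
rewrite (_ : _ \o _ = (fun x => (Re c)%:E * (EFin \o (fun x => Im (h x))) x) \+
     (fun x => (Im c)%:E * (EFin \o (fun x => Re (h x))) x))%E.
  by apply: integrableD => //; exact: integrableZl.
by apply/funext => x /=; rewrite cImM.
Qed.

Lemma eq_Cint D h k : (forall x, D x -> h x = k x) -> Cint D h = Cint D k.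
Proof.
by move=> hk; congr Complex; apply: eq_Rintegral => x /set_mem xD; rewrite hk.
Qed.

Lemma CintD D h k : measurable D -> Cintegrable D h -> Cintegrable D k ->
  Cint D (fun x => h x + k x) = Cint D h + Cint D k.
Proof.
move=> mD [h1 h2] [k1 k2]; rewrite /Cint.
transitivity ((\int[mu]_(x in D) (Re (h x) + Re (k x))) +i*
  (\int[mu]_(x in D) (Im (h x) + Im (k x)))).
  by congr Complex; apply: eq_Rintegral => x _; rewrite ?cReD ?cImD.
by rewrite !RintegralD.
Qed.

Lemma CintZl D (c : C) h : measurable D -> Cintegrable D h ->
  Cint D (fun x => c * h x) = c * Cint D h.
Proof.
move=> mD [h1 h2]; rewrite /Cint.
have i1 (r : R) : mu.-integrable D (EFin \o (fun x => r * Re (h x))).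
  rewrite (_ : _ \o _ = (fun x => r%:E * (EFin \o (fun x => Re (h x))) x))%E//.
  exact: integrableZl.
have i2 (r : R) : mu.-integrable D (EFin \o (fun x => r * Im (h x))).
  rewrite (_ : _ \o _ = (fun x => r%:E * (EFin \o (fun x => Im (h x))) x))%E//.
  exact: integrableZl.
transitivity ((\int[mu]_(x in D) (Re c * Re (h x) - Im c * Im (h x))) +i*
  (\int[mu]_(x in D) (Re c * Im (h x) + Im c * Re (h x)))).
  by congr Complex; apply: eq_Rintegral => x _; rewrite ?cReM ?cImM.
rewrite RintegralB// RintegralD// !RintegralZl//.
by case: (c).
Qed.

Lemma CintegrableN D h : measurable D -> Cintegrable D h -> Cintegrable D (fun x => - h x).
Proof.
by move=> mD ih; have := CintegrableZl (-1) mD ih; under eq_fun do rewrite mulN1r.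
Qed.

Lemma CintegrableB D h k : measurable D ->
  Cintegrable D h -> Cintegrable D k -> Cintegrable D (fun x => h x - k x).
Proof. by move=> mD ih ik; apply: CintegrableD => //; exact: CintegrableN. Qed.

Lemma CintN D h : measurable D -> Cintegrable D h -> Cint D (fun x => - h x) = - Cint D h.
Proof. by move=> mD ih; rewrite -mulN1r -CintZl//; under eq_fun do rewrite -mulN1r. Qed.

Lemma CintB D h k : measurable D -> Cintegrable D h -> Cintegrable D k ->
  Cint D (fun x => h x - k x) = Cint D h - Cint D k.
Proof. by move=> mD ih ik; rewrite CintD// ?CintN//; exact: CintegrableN. Qed.

Lemma Cintegrable_bound D h (g : T -> R) : measurable D -> cmeas D h ->
  mu.-integrable D (EFin \o g) -> (forall x, D x -> normc (h x) <= g x) -> Cintegrable D h.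
Proof.
move=> mD [m1 m2] ig hg; split; apply: le_integrable ig => //.
- exact/measurable_EFinP.
- move=> x Dx /=; rewrite lee_fin (le_trans (normc_Re _))// (le_trans (hg _ Dx))//.
  exact: ler_norm.
- exact/measurable_EFinP.
- move=> x Dx /=; rewrite lee_fin (le_trans (normc_Im _))// (le_trans (hg _ Dx))//.
  exact: ler_norm.
Qed.

(** A unimodular factor [c] turns the integral into its modulus, which is then the integral of a
    real part dominated by [g]. *)
Lemma normc_Cint_le D h (g : T -> R) : measurable D -> Cintegrable D h ->
  mu.-integrable D (EFin \o g) -> (forall x, D x -> normc (h x) <= g x) ->
  normc (Cint D h) <= \int[mu]_(x in D) g x.
Proof.
move=> mD ih ig hg; set I := Cint D h.
have [I0|I0] := eqVneq I 0.
  rewrite I0 normc0; apply: Rintegral_ge0 => x Dx.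
  exact: le_trans (normc_ge0 _) (hg _ Dx).
pose c := I^* / (normc I)%:C.
have nI : normc I != 0 by rewrite normc_eq0.
have nc : normc c = 1.
  by rewrite normcM normcV normc_conj normc_real ger0_norm ?normc_ge0// divff.
have cI : c * I = (normc I)%:C.
  rewrite /c mulrAC mulrC [_^* * _]mulrC mulc_conj expr2 rmorphM mulKf//.
  by rewrite -normc_eq0 normc_real normr_eq0.
have -> : normc I = Re (Cint D (fun x => c * h x)) by rewrite CintZl// cI.
have [i1 _] := CintegrableZl c mD ih.
apply: le_Rintegral => // x Dx.
rewrite (le_trans (ler_norm _))// (le_trans (normc_Re _))// normcM nc mul1r.
exact: hg.
Qed.

Lemma Cint_ae_eq D h k : measurable D -> cmeas D h -> cmeas D k ->
  {ae mu, forall x, D x -> h x = k x} -> Cint D h = Cint D k.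
Proof.
move=> mD [h1 h2] [k1 k2] hk; congr Complex; congr fine; apply: ae_eq_integral => //.
- exact/measurable_EFinP.
- exact/measurable_EFinP.
- by apply: filterS hk => x + Dx => ->.
- exact/measurable_EFinP.
- exact/measurable_EFinP.
- by apply: filterS hk => x + Dx => ->.
Qed.

Lemma Cint_cvg D (hn : nat -> T -> C) h (g : T -> R) : measurable D ->
  (forall n, cmeas D (hn n)) -> cmeas D h -> mu.-integrable D (EFin \o g) ->
  {ae mu, forall x, D x -> ccvg \oo (hn ^~ x) (h x)} ->
  (forall n x, D x -> normc (hn n x) <= g x) ->
  Cintegrable D h /\ ccvg \oo (fun n => Cint D (hn n)) (Cint D h).
Proof.
move=> mD mhn [h1 h2] ig hcv hg.
have [] := @dominated_convergence _ _ _ mu _ mD (fun n x => (Re (hn n x))%:E)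
  (fun x => (Re (h x))%:E) (EFin \o g).
- by move=> n; apply/measurable_EFinP; case: (mhn n).
- exact/measurable_EFinP.
- apply: filterS hcv => x + Dx => /(_ Dx) /cvg_Re.
  by move=> hc; apply: cvg_EFin => //; near=> n.
- exact: ig.
- apply: aeW => x n Dx /=; rewrite lee_fin (le_trans (normc_Re _))//; exact: hg.
move=> i1 _ c1.
have [] := @dominated_convergence _ _ _ mu _ mD (fun n x => (Im (hn n x))%:E)
  (fun x => (Im (h x))%:E) (EFin \o g).
- by move=> n; apply/measurable_EFinP; case: (mhn n).
- exact/measurable_EFinP.
- apply: filterS hcv => x + Dx => /(_ Dx) /cvg_Im.
  by move=> hc; apply: cvg_EFin => //; near=> n.
- exact: ig.
- apply: aeW => x n Dx /=; rewrite lee_fin (le_trans (normc_Im _))//; exact: hg.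
move=> i2 _ c2.
split; first by split.
have fi (u : T -> R) : mu.-integrable D (EFin \o u) -> (\int[mu]_(x in D) (u x)%:E)%E \is a fin_num.
  by move=> iu; exact: integrable_fin_num.
by apply: cvg_Complex; apply: fine_cvg; rewrite fineK//; [exact: fi|exact: fi].
Unshelve. all: by end_near. Qed.

Lemma Cint_conj D h : measurable D -> Cintegrable D h ->
  Cint D (fun x => (h x)^*) = (Cint D h)^*.
Proof.
move=> mD [h1 h2]; rewrite /Cint/=; congr Complex.
  by apply: eq_Rintegral => x _; case: (h x).
rewrite -mulN1r -RintegralZl//; apply: eq_Rintegral => x _.
by rewrite mulN1r; case: (h x).
Qed.

End ComplexIntegral.

(** * Integrals on the circle as integrals over the unit interval *)

Lemma ge0_integral_mrestr d (T : measurableType d) (R : realType)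
    (mu : {measure set T -> \bar R}) (D : set T) (mD : measurable D) (f : T -> \bar R) :
  measurable_fun setT f -> (forall x, 0 <= f x)%E ->
  (\int[mrestr mu mD]_x f x = \int[mu]_(x in D) f x)%E.
Proof.
move=> mf f0; have mDC := measurableC mD.
rewrite -(setUv D) ge0_integral_setU//=; last 2 first.
- by rewrite setUv.
- exact/disj_setPCl.
rewrite [X in (_ + X)%E](_ : _ = 0)%E ?adde0.
  by apply: eq_measure_integral => A mA AD; rewrite /= /mrestr setIidl.
apply: null_set_integral => //; first exact: measurable_funTS.
by rewrite /= /mrestr setICl measure0.
Qed.

Section CircleIntegral.
Variable R : realType.
Local Notation C := (R[i]).
Local Notation mu := (@circle_measure R).
Local Notation lebesgueR := (caratheodory_type (@wlength R idfun)^*%mu).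
Local Notation param := (@circle_param R).
Local Notation lambda := (@lebesgue_measure R).

Lemma measurable_id_lebesgueR :
  measurable_fun setT (id : lebesgueR -> measurableTypeR R).
Proof. by move=> _ A mA; rewrite setTI; exact: sub_caratheodory. Qed.

Lemma measurable_lebesgueR d (T : measurableType d) (u : measurableTypeR R -> T) :
  measurable_fun setT u -> measurable_fun setT (u : lebesgueR -> T).
Proof.
by move=> mu_; exact: (measurableT_comp mu_ measurable_id_lebesgueR).
Qed.

Lemma circle_measurableP d (T : measurableType d) (u : circle R -> T) :
  measurable_fun setT (u \o param : lebesgueR -> T) -> measurable_fun setT u.
Proof.
by move=> mu_ _ A mA; rewrite setTI; exact: (mu_ measurableT A mA).
Qed.

Lemma measurable_circle_comp d (T : measurableType d) (u : circle R -> T) :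
  measurable_fun setT u -> measurable_fun setT (u \o param : lebesgueR -> T).
Proof. by move=> mu_; exact: (measurableT_comp mu_ (@measurable_circle_param R)). Qed.

Lemma ge0_circle_integral (u : circle R -> \bar R) :
  measurable_fun setT u -> (forall g, 0 <= u g)%E ->
  (\int[mu]_g u g = \int[@completed_lebesgue_measure R]_(t in (`[0%R, 1%R[%classic : set lebesgueR)) u (param t))%E.
Proof.
move=> mu_ u0; rewrite /circle_measure.
transitivity (\int[mrestr (@completed_lebesgue_measure R) (@measurable_fundamental_arc R)]_x u (param x))%E.
  have := @ge0_integral_pushforward _ _ _ _ _ _ (@measurable_circle_param R) (mrestr (@completed_lebesgue_measure R) (@measurable_fundamental_arc R)) setT u measurableT mu_ (fun y _ => u0 y).
  by rewrite preimage_setT.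
rewrite ge0_integral_mrestr.
- reflexivity.
- exact: (measurable_circle_comp mu_).
- by move=> x; exact: u0.
Qed.

Lemma ge0_completed_integral (D : set R) (u : R -> \bar R) :
  measurable (D : set (measurableTypeR R)) ->
  measurable_fun (D : set (measurableTypeR R)) u -> (forall t, 0 <= u t)%E ->
  (\int[@completed_lebesgue_measure R]_(t in (D : set lebesgueR)) u t =
   \int[lambda]_(t in D) u t)%E.
Proof.
move=> mD mu_ u0.
(* Lebesgue measure on the Borel sets is the image of its completion under the identity map. *)
have h := @ge0_integral_pushforward _ _ _ _ R _ measurable_id_lebesgueR
   (@completed_lebesgue_measure R) D u mD mu_ (fun y _ => u0 y).
apply: (etrans (esym h)).
apply: (eq_measure_integral lambda); first exact: measurable_id_lebesgueR.
by move=> mf A mA AD.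
Qed.

Lemma ge0_circle_lebesgue_integral (u : circle R -> \bar R) :
  measurable_fun setT (fun t : measurableTypeR R => u (param t)) -> (forall g, 0 <= u g)%E ->
  (\int[mu]_g u g = \int[lambda]_(t in `[0%R, 1%R[) u (param t))%E.
Proof.
move=> mu_ u0; rewrite ge0_circle_integral//; last first.
  by apply: circle_measurableP; exact: measurable_lebesgueR.
by rewrite ge0_completed_integral//; exact: measurable_funTS.
Qed.

Lemma circle_Rintegral (u : circle R -> R) :
  measurable_fun setT (fun t : measurableTypeR R => u (param t)) ->
  \int[mu]_g u g = \int[lambda]_(t in `[0%R, 1%R[) u (param t).
Proof.
move=> mu_; congr fine; rewrite integralE [RHS]integralE.
congr (_ - _)%E.
- rewrite ge0_circle_lebesgue_integral//.
    by apply: eq_integral => t _; rewrite !funeposE.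
  under eq_fun do rewrite funeposE.
  by apply: measurable_maxe; [exact/measurable_EFinP|exact: measurable_cst].
- rewrite ge0_circle_lebesgue_integral//.
    by apply: eq_integral => t _; rewrite !funenegE.
  under eq_fun do rewrite funenegE.
  apply: measurable_maxe; last exact: measurable_cst.
  by apply/measurable_EFinP; exact: measurableT_comp.
Qed.

End CircleIntegral.

(** * Goursat's theorem *)

Section Bisection.
Variable R : realType.
Implicit Types (a b c d : R) (J : R -> R -> R -> R -> R).

Definition rect := (R * R * (R * R))%type.

(** No test guards the fourth quarter: when the other three fall short of a fourth of [J],
    subadditivity forces the last one to reach it. *)
Definition quarter J (q : rect) : rect :=
  let: ((a, b), (c, d)) := q in
  let m := (a + b) / 2 in let n := (c + d) / 2 in
  if J a b c d / 4 <= J a m c n then ((a, m), (c, n)) else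
  if J a b c d / 4 <= J m b c n then ((m, b), (c, n)) else
  if J a b c d / 4 <= J a m n d then ((a, m), (n, d)) else ((m, b), (n, d)).

Lemma nested_segments (a b : nat -> R) :
  (forall n, a n <= a n.+1) -> (forall n, b n.+1 <= b n) -> (forall n, a n <= b n) ->
  exists x, forall n, a n <= x <= b n.
Proof.
move=> aS bS ab.
have /nondecreasing_seqP am := aS.
have /nonincreasing_seqP bm := bS.
have amb m n : a m <= b n.
  by rewrite (le_trans (am m (maxn m n) _))// ?leq_maxl// (le_trans (ab _))// bm//= leq_maxr.
have hs : has_sup (range a).
  by split; [exists (a 0%N), 0%N|exists (b 0%N) => _ [n _ <-]].
exists (sup (range a)) => n; apply/andP; split.
  by apply: sup_upper_bound => //; exists n.
by apply: ge_sup; [exists (a 0%N), 0%N|move=> _ [m _ <-]].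
Qed.

Lemma quarter_spec J (a b c d : R) : a <= b -> c <= d ->
  J a b c d <= J a ((a + b) / 2) c ((c + d) / 2) + J ((a + b) / 2) b c ((c + d) / 2)
    + J a ((a + b) / 2) ((c + d) / 2) d + J ((a + b) / 2) b ((c + d) / 2) d ->
  let r := quarter J ((a, b), (c, d)) in
  [/\ a <= r.1.1, r.1.1 <= r.1.2, r.1.2 <= b, [/\ c <= r.2.1, r.2.1 <= r.2.2 & r.2.2 <= d] &
   [/\ J a b c d / 4 <= J r.1.1 r.1.2 r.2.1 r.2.2, r.1.2 - r.1.1 = (b - a) / 2 &
    r.2.2 - r.2.1 = (d - c) / 2]].
Proof.
have mid (x y : R) : x <= y -> [/\ x <= (x + y) / 2, (x + y) / 2 <= y,
    (x + y) / 2 - x = (y - x) / 2 & y - (x + y) / 2 = (y - x) / 2].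
  by move=> xy; split; lra.
move=> /mid[m1 m2 m3 m4] /mid[n1 n2 n3 n4]; rewrite /quarter.
case: ifPn => [k1 _|]; first by do ![split].
rewrite -ltNge => k1; case: ifPn => [k2 _|]; first by do ![split].
rewrite -ltNge => k2; case: ifPn => [k3 _|]; first by do ![split].
rewrite -ltNge => k3 hJ; do ![split] => //=; move: hJ k1 k2 k3.
move: (J a b c d) (J _ _ _ _) (J _ _ _ _) (J _ _ _ _) (J _ _ _ _) => *; lra.
Qed.

Lemma ltr_double1 (y : R) : 0 <= y -> y < (y + 1) + (y + 1).
Proof. lra. Qed.

(** Goursat's bisection for any function of rectangles that is subadditive under division into four.
    Passing to a quarter that keeps at least a fourth of [J] divides the square of the side lengths
    by exactly 4, so a positive [J] contradicts the local estimate at the common point of the nested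
    rectangles. *)
Lemma bisection_vanish J (a b c d : R) : a <= b -> c <= d ->
  (forall a' b' c' d', a <= a' -> a' <= b' -> b' <= b -> c <= c' -> c' <= d' -> d' <= d ->
    J a' b' c' d' <= J a' ((a' + b') / 2) c' ((c' + d') / 2) + J ((a' + b') / 2) b' c' ((c' + d') / 2)
      + J a' ((a' + b') / 2) ((c' + d') / 2) d' + J ((a' + b') / 2) b' ((c' + d') / 2) d') ->
  (forall x y, a <= x <= b -> c <= y <= d -> forall e, 0 < e -> exists2 k, 0 < k &
    forall a' b' c' d', a <= a' -> b' <= b -> c <= c' -> d' <= d ->
      a' <= x <= b' -> c' <= y <= d' -> b' - a' < k -> d' - c' < k ->
      J a' b' c' d' <= e * ((b' - a') + (d' - c')) ^+ 2) ->
  J a b c d <= 0.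
Proof.
move=> ab cd Jsub Jloc; rewrite leNgt; apply/negP => J0.
pose q n := iter n (quarter J) ((a, b), (c, d)).
pose qa n := (q n).1.1; pose qb n := (q n).1.2; pose qc n := (q n).2.1; pose qd n := (q n).2.2.
pose V (r : rect) := [/\ a <= r.1.1, r.1.1 <= r.1.2, r.1.2 <= b & [/\ c <= r.2.1, r.2.1 <= r.2.2 & r.2.2 <= d]].
have step r : V r -> let r' := quarter J r in
  [/\ V r', J r.1.1 r.1.2 r.2.1 r.2.2 / 4 <= J r'.1.1 r'.1.2 r'.2.1 r'.2.2,
   [/\ r.1.1 <= r'.1.1, r'.1.2 <= r.1.2, r.2.1 <= r'.2.1 & r'.2.2 <= r.2.2] &
   r'.1.2 - r'.1.1 = (r.1.2 - r.1.1) / 2 /\ r'.2.2 - r'.2.1 = (r.2.2 - r.2.1) / 2].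
  case: r => -[a' b'] [c' d'] [/= h1 h2 h3 [h4 h5 h6]].
  have [q1 q2 q3 [q4 q5 q6] [q7 q8 q9]] := quarter_spec h2 h5 (Jsub _ _ _ _ h1 h2 h3 h4 h5 h6).
  split; [split; [exact: le_trans h1 q1|exact: q2|exact: le_trans q3 h3|split]|exact: q7|by []|by []].
  - exact: le_trans h4 q4.
  - exact: q5.
  - exact: le_trans q6 h6.
have Vq n : V (q n).
  by elim: n => [|n ih]; [rewrite /V/=; do ![split]|have [] := step _ ih].
have nest n : [/\ qa n <= qa n.+1, qb n.+1 <= qb n, qc n <= qc n.+1 & qd n.+1 <= qd n].
  by have [_ _ []] := step _ (Vq n).
have len n : qb n - qa n = (b - a) / 2 ^+ n /\ qd n - qc n = (d - c) / 2 ^+ n.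
  elim: n => [|n [ih1 ih2]]; first by rewrite /qb /qa /qc /qd /= expr0 !divr1.
  have [_ _ _ [e1 e2]] := step _ (Vq n).
  by rewrite exprSr invfM !mulrA -ih1 -ih2.
have Jn n : J a b c d / 4 ^+ n <= J (qa n) (qb n) (qc n) (qd n).
  elim: n => [|n ih]; first by rewrite expr0 divr1.
  have [_ h _ _] := step _ (Vq n).
  by apply: le_trans h; rewrite exprSr invfM mulrA ler_pM2r.
have [x xP] := @nested_segments qa qb (fun n => let: And4 h _ _ _ := nest n in h)
  (fun n => let: And4 _ h _ _ := nest n in h) (fun n => let: And4 _ h _ _ := Vq n in h).
have [y yP] := @nested_segments qc qd (fun n => let: And4 _ _ h _ := nest n in h)
  (fun n => let: And4 _ _ _ h := nest n in h)
  (fun n => let: And4 _ _ _ (And3 _ h _) := Vq n in h).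
set L := (b - a) + (d - c).
have L0 : 0 <= L by rewrite addr_ge0 ?subr_ge0.
(* With this [e] the local bound [e * L ^+ 2] stays below [J a b c d]; the added 1 keeps the
   denominator positive when the rectangle is a point. *)
pose e := J a b c d / (2 * (L ^+ 2 + 1)).
have L1 : 0 < L ^+ 2 + 1 by rewrite ltr_wpDl// sqr_ge0.
have e0 : 0 < e by rewrite divr_gt0// mulr_gt0.
have [k k0 kP] := Jloc x y (xP 0%N) (yP 0%N) e e0.
have [n nk] : exists n : nat, L / 2 ^+ n < k.
  have [n nP] : exists n : nat, L / k < 2 ^+ n.
    exists (Num.truncn (L / k)).+1; apply: (@lt_trans _ _ (Num.truncn (L / k)).+1%:R).
      by rewrite truncnS_gt.
    by rewrite -natrX ltr_nat ltn_expl.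
  by exists n; rewrite ltr_pdivrMr ?exprn_gt0// mulrC -ltr_pdivrMr.
have [lab lcd] := len n.
have p2 : 0 < (2 ^+ n : R)^-1 by rewrite invr_gt0 exprn_gt0.
have [h1 h2 h3 [h4 h5 h6]] := Vq n.
have hJ : J (qa n) (qb n) (qc n) (qd n) <= e * (qb n - qa n + (qd n - qc n)) ^+ 2.
  apply: kP => //.
    by rewrite lab; apply: le_lt_trans nk; rewrite ler_pM2r// /L lerDl subr_ge0.
  by rewrite lcd; apply: le_lt_trans nk; rewrite ler_pM2r// /L lerDr subr_ge0.
have := le_trans (Jn n) hJ; rewrite lab lcd -mulrDl -/L exprMn exprVn -exprM mulnC exprM.
rewrite (_ : 2 ^+ 2 = 4 :> R); last by rewrite -natrX.
rewrite mulrA ler_pM2r ?invr_gt0 ?exprn_gt0// /e mulrAC ler_pdivlMr ?mulr_gt0//.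
rewrite ler_pM2l// leNgt => /negP; apply; rewrite mulr_natl mulr2n; exact: ltr_double1 (sqr_ge0 L).
Qed.

End Bisection.

Section SegmentIntegral.
Variable R : realType.
Local Notation C := (R[i]).
Local Notation lambda := (@lebesgue_measure R).
Implicit Types (a b c d s t : R) (h : R -> C).

Definition Sint a b h : C := Cint lambda `[a, b]%classic h.

Lemma seg_integrable a b h : (forall t, a <= t <= b -> ccvg (nbhs t) h (h t)) ->
  Cintegrable lambda `[a, b]%classic h.
Proof.
move=> hc; split; apply: continuous_compact_integrable; try exact: segment_compact;
  apply: continuous_in_subspaceT => t /set_mem/=; rewrite in_itv/= => /hc.
- exact: cvg_Re.
- exact: cvg_Im.
Qed.

Lemma lebesgue_seg a b : a <= b -> fine (lambda `[a, b]%classic) = b - a.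
Proof.
move=> ab; rewrite lebesgue_measure_itv/= lte_fin; case: ltP => // ba.
have -> : a = b by apply/eqP; rewrite eq_le ab ba.
by rewrite subrr.
Qed.

Lemma seg_cst_integrable a b (r : R) : lambda.-integrable `[a, b]%classic (EFin \o (fun=> r)).
Proof.
apply: continuous_compact_integrable; first exact: segment_compact.
by apply: continuous_in_subspaceT => t _; exact: cvg_cst.
Qed.

Lemma Sint_cst a b (k : C) : a <= b -> Sint a b (fun=> k) = k * (b - a)%:C.
Proof.
move=> ab; rewrite /Sint /Cint !Rintegral_cst//= lebesgue_seg//.
by case: k => x y; simpc.
Qed.

Lemma normc_Sint a b h (M : R) : a <= b -> Cintegrable lambda `[a, b]%classic h ->
  (forall t, a <= t <= b -> normc (h t) <= M) -> normc (Sint a b h) <= M * (b - a).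
Proof.
move=> ab ih hM; rewrite -(lebesgue_seg ab) -Rintegral_cst//.
apply: normc_Cint_le => //; first exact: seg_cst_integrable.
Qed.

Lemma Sint_split a m b h : a <= m -> m <= b -> Cintegrable lambda `[a, b]%classic h ->
  Sint a b h = Sint a m h + Sint m b h.
Proof.
move=> am mb [i1 i2].
have key (u : R -> R) : lambda.-integrable `[a, b]%classic (EFin \o u) ->
   \int[lambda]_(t in `[a, b]) u t = \int[lambda]_(t in `[a, m]) u t + \int[lambda]_(t in `[m, b]) u t.
  move=> iu; have := @Rintegral_itvB R u (BLeft a) (BRight b) m iu.
  rewrite !bnd_simp => /(_ am mb) /eqP; rewrite subr_eq => /eqP ->.
  rewrite addrC; congr (_ + _); apply: Rintegral_itv_obnd_cbnd.
  by apply: integrableS iu => //; apply: subset_itvr; rewrite bnd_simp.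
by rewrite /Sint /Cint !key.
Qed.

End SegmentIntegral.

Section Goursat.
Variable R : realType.
Local Notation C := (R[i]).
Local Notation lambda := (@lebesgue_measure R).
Variables (u : R -> R -> C) (kappa : C).
Implicit Types (a b c d s t : R).

(* Complex differentiability of [u] at [s + kappa t], in real coordinates. *)
Definition plane_diff s0 t0 := exists D : C, forall e, 0 < e -> exists2 k, 0 < k &
  forall s t, `|s - s0| < k -> `|t - t0| < k ->
  normc (u s t - u s0 t0 - D * ((s - s0)%:C + kappa * (t - t0)%:C)) <= e * (`|s - s0| + `|t - t0|).

Lemma plane_diff_cvg (f : R -> R * R) (s0 t0 : R) x : plane_diff s0 t0 ->
  f x = (s0, t0) -> {for x, continuous (fst \o f)} -> {for x, continuous (snd \o f)} ->
  ccvg (nbhs x) (fun y => u (f y).1 (f y).2) (u s0 t0).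
Proof.
move=> [D uD] fx f1 f2; apply/ccvgP => e e0.
have [k k0 kP] := uD 1 ltr01.
pose M := normc D * (1 + normc kappa) + 1.
have nD := normc_ge0 D; have nk := normc_ge0 kappa.
have M0 : 0 < M by rewrite ltr_wpDl// mulr_ge0// addr_ge0.
pose k' := Num.min k (e / (2 * M)).
have k'0 : 0 < k' by rewrite lt_min k0 divr_gt0// mulr_gt0.
move/cvgrPdist_lt : f1 => /(_ k' k'0); move/cvgrPdist_lt : f2 => /(_ k' k'0).
apply: filterS2 => y; rewrite /= fx/=; move: (f y) => [s t]/=; rewrite (distrC t0) (distrC s0) => ht hs.
have {kP}:= kP s t (lt_le_trans hs _) (lt_le_trans ht _).
rewrite ge_min lexx => /(_ isT isT).
set w := (s - s0)%:C + kappa * (t - t0)%:C; rewrite mul1r => h.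
have nw : normc w <= (1 + normc kappa) * (`|s - s0| + `|t - t0|).
  rewrite (le_trans (ler_normcD _ _))// normcM !normc_real mulrDl mul1r lerD//.
    by rewrite lerDl.
  by rewrite ler_wpM2l// lerDr.
have -> : u s t - u s0 t0 = (u s t - u s0 t0 - D * w) + D * w by rewrite subrK.
apply: le_lt_trans (ler_normcD _ _) _; rewrite normcM.
apply: (@le_lt_trans _ _ (M * (`|s - s0| + `|t - t0|))).
  rewrite /M mulrDl mul1r addrC lerD// -mulrA; exact: ler_wpM2l.
rewrite mulrC -ltr_pdivlMr//.
have -> : e / M = e / (2 * M) + e / (2 * M) by field; rewrite gt_eqF.
by rewrite ltrD// (lt_le_trans hs, lt_le_trans ht)// /k' ge_min lexx orbT.
Qed.

(** The integral of [u] against [d(s + kappa t)] along the counterclockwise boundary of the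
    rectangle. Leaving [kappa] free, instead of taking the imaginary unit, allows [2 pi i] later,
    when [t] in [[0, 1]] runs through a full turn. *)
Definition bdry a b c d : C :=
  kappa * (Sint c d (u b) - Sint c d (u a)) - (Sint a b (u ^~ d) - Sint a b (u ^~ c)).

Variables (a0 b0 c0 d0 : R).
Hypotheses (ab0 : a0 <= b0) (cd0 : c0 <= d0).
Hypothesis udiff : forall s t, a0 <= s <= b0 -> c0 <= t <= d0 -> plane_diff s t.

Lemma horizontal_integrable a b t : a0 <= a -> b <= b0 -> c0 <= t <= d0 ->
  Cintegrable lambda `[a, b]%classic (u ^~ t).
Proof.
move=> aa bb ct; apply: seg_integrable => s /andP[s1 s2].
have h : plane_diff s t by apply: udiff => //; rewrite (le_trans aa s1) (le_trans s2 bb).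
apply: (@plane_diff_cvg (fun s => (s, t)) s t s h erefl); [exact: cvg_id|exact: cvg_cst].
Qed.

Lemma vertical_integrable c d s : c0 <= c -> d <= d0 -> a0 <= s <= b0 ->
  Cintegrable lambda `[c, d]%classic (u s).
Proof.
move=> cc dd sa; apply: seg_integrable => t /andP[t1 t2].
have h : plane_diff s t by apply: udiff => //; rewrite (le_trans cc t1) (le_trans t2 dd).
apply: (@plane_diff_cvg (fun t => (s, t)) s t t h erefl); [exact: cvg_cst|exact: cvg_id].
Qed.

Lemma bdry_split a m b c n d : a0 <= a -> a <= m -> m <= b -> b <= b0 ->
  c0 <= c -> c <= n -> n <= d -> d <= d0 ->
  bdry a b c d = bdry a m c n + bdry m b c n + bdry a m n d + bdry m b n d.
Proof.
move=> h1 h2 h3 h4 k1 k2 k3 k4; rewrite /bdry.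
have sH t : c0 <= t <= d0 -> Sint a b (u ^~ t) = Sint a m (u ^~ t) + Sint m b (u ^~ t).
  by move=> ht; apply: Sint_split => //; exact: horizontal_integrable.
have sV s : a0 <= s <= b0 -> Sint c d (u s) = Sint c n (u s) + Sint n d (u s).
  by move=> hs; apply: Sint_split => //; exact: vertical_integrable.
rewrite !sH ?sV; first ring; lra.
Qed.

(** Opposite sides are paired, so only differences of [u] enter and the constant part drops out; the
    linear terms with [D] cancel between the vertical and the horizontal pair. What remains is the
    error of the linear approximation. *)
Lemma bdry_local x y : a0 <= x <= b0 -> c0 <= y <= d0 -> forall e, 0 < e -> exists2 k, 0 < k &
    forall a b c d, a0 <= a -> b <= b0 -> c0 <= c -> d <= d0 ->
      a <= x <= b -> c <= y <= d -> b - a < k -> d - c < k ->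
      normc (bdry a b c d) <= e * ((b - a) + (d - c)) ^+ 2.
Proof.
move=> hx hy e e0; have [D uD] := udiff hx hy.
(* The 2 comes from comparing two boundary points through [(x, y)], the factor [normc kappa + 1]
   from the vertical and the horizontal pair of sides. *)
pose M := 2 * (normc kappa + 1).
have M0 : 0 < M by rewrite mulr_gt0// ltr_wpDl// normc_ge0.
have [k k0 kP] := uD (e / M) (divr_gt0 e0 M0).
exists k => // a b c d ha hb hc hd /andP[ax xb] /andP[cy yd] bak dck.
set L := (b - a) + (d - c).
have est s t : a <= s <= b -> c <= t <= d ->
    normc (u s t - u x y - D * ((s - x)%:C + kappa * (t - y)%:C)) <= e / M * L.
  move=> /andP[s1 s2] /andP[t1 t2].
  have n1 : `|s - x| <= b - a by rewrite ler_norml; lra.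
  have n2 : `|t - y| <= d - c by rewrite ler_norml; lra.
  apply: le_trans (kP s t (le_lt_trans n1 bak) (le_lt_trans n2 dck)) _.
  apply: ler_wpM2l; first by rewrite divr_ge0// ltW.
  exact: lerD.
have ab : a <= b by exact: le_trans ax xb.
have cd : c <= d by exact: le_trans cy yd.
have est2 s t s' t' : a <= s <= b -> c <= t <= d -> a <= s' <= b -> c <= t' <= d ->
   normc (u s t - u s' t' - D * ((s - s')%:C + kappa * (t - t')%:C)) <= 2 * (e / M * L).
  move=> p1 p2 p3 p4.
  have -> : u s t - u s' t' - D * ((s - s')%:C + kappa * (t - t')%:C) =
     (u s t - u x y - D * ((s - x)%:C + kappa * (t - y)%:C)) -
     (u s' t' - u x y - D * ((s' - x)%:C + kappa * (t' - y)%:C)).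
    by rewrite !rmorphB; ring.
  by rewrite (le_trans (ler_normcB _ _))// mulr_natl mulr2n lerD// est.
have iV s : a <= s <= b -> Cintegrable lambda `[c, d]%classic (u s).
  move=> /andP[s1 s2]; apply: vertical_integrable => //.
  by rewrite (le_trans ha s1) (le_trans s2 hb).
have iH t : c <= t <= d -> Cintegrable lambda `[a, b]%classic (u ^~ t).
  move=> /andP[s1 s2]; apply: horizontal_integrable => //.
  by rewrite (le_trans hc s1) (le_trans s2 hd).
have icst p q (z : C) : Cintegrable lambda `[p, q]%classic (fun=> z).
  by apply: seg_integrable => t _; exact: ccvg_cst.
have aI : a <= a <= b by rewrite lexx. have bI : a <= b <= b by rewrite ab lexx.
have cI : c <= c <= d by rewrite lexx. have dI : c <= d <= d by rewrite cd lexx.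
pose V := Sint c d (fun t => u b t - u a t - D * (b - a)%:C).
pose H := Sint a b (fun s => u s d - u s c - D * (kappa * (d - c)%:C)).
have -> : bdry a b c d = kappa * V - H.
  have mI (p q : R) : measurable (`[p, q]%classic : set (measurableTypeR R)) by exact: measurable_itv.
  rewrite /V /H /Sint !CintB//; try by apply: CintegrableB => //; auto.
  - rewrite -!/(Sint _ _ _) !Sint_cst// /bdry; ring.
  - exact: iH.
  - exact: iH.
  - exact: iV.
  - exact: iV.
have nV : normc V <= 2 * (e / M * L) * (d - c).
  apply: normc_Sint => //.
    by apply: CintegrableB => //; apply: CintegrableB => //; exact: iV.
  by move=> t ht; have := est2 b t a t bI ht aI ht; rewrite subrr mulr0 addr0.
have nH : normc H <= 2 * (e / M * L) * (b - a).
  apply: normc_Sint => //.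
    by apply: CintegrableB => //; apply: CintegrableB => //; exact: iH.
  by move=> s hs; have := est2 s d s c hs dI hs cI; rewrite subrr add0r.
have L0 : 0 <= L by rewrite addr_ge0 ?subr_ge0.
rewrite (le_trans (ler_normcB _ _))// normcM.
have eM : 0 <= 2 * (e / M * L) by rewrite mulr_ge0// mulr_ge0// divr_ge0// ltW.
apply: (@le_trans _ _ (normc kappa * (2 * (e / M * L) * L) + 2 * (e / M * L) * L)).
  rewrite lerD//.
    rewrite ler_wpM2l ?normc_ge0//; apply: (le_trans nV).
    by apply: (ler_wpM2l eM); rewrite /L lerDr subr_ge0.
  by apply: (le_trans nH); apply: (ler_wpM2l eM); rewrite /L lerDl subr_ge0.
rewrite le_eqVlt; apply/orP; left; apply/eqP; rewrite /M; field.
by rewrite gt_eqF// ltr_wpDl// normc_ge0.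
Qed.

Lemma goursat : bdry a0 b0 c0 d0 = 0.
Proof.
apply/eqP; rewrite -normc_eq0 eq_le normc_ge0 andbT.
apply: (bisection_vanish (J := fun a b c d => normc (bdry a b c d))) => //.
- move=> a b c d h1 h2 h3 h4 h5 h6; rewrite (@bdry_split a ((a + b) / 2) b c ((c + d) / 2) d)//; try lra.
  rewrite (le_trans (ler_normcD _ _))// lerD2r (le_trans (ler_normcD _ _))// lerD2r.
  exact: ler_normcD.
- exact: bdry_local.
Qed.

End Goursat.

(** * The mean value property *)

Section ComplexExponential.
Variable R : realType.
Local Notation C := (R[i]).
Local Notation Co := (R[i]^o).

Lemma is_derive_caratheodory (f : R -> R) (x df : R) : is_derive x 1 f df ->
  exists p : R -> R, [/\ p y @[y --> x] --> df, p x = df & forall y, f y = f x + p y * (y - x)].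
Proof.
move=> [/derivableP fx fdf]; have {fx}[fx _] := fx.
have : (fun h => h^-1 *: ((f \o shift x) (h *: 1) - f x)) @ 0^' --> df.
  by rewrite -fdf; exact: fx.
move=> /cvgrPdist_lt fl.
exists (fun y => if y == x then df else (f y - f x) / (y - x)); split.
- apply/cvgrPdist_lt => e e0; have := fl e e0.
  move=> /nbhs_ballP[d /= d0 dP]; apply/nbhs_ballP; exists d => //= y; rewrite /ball/= => yx.
  case: eqVneq => [_|yx0]; first by rewrite subrr normr0.
  have := dP (y - x); rewrite /ball/= sub0r normrN distrC => /(_ yx).
  by rewrite subr_eq0 => /(_ yx0); rewrite /= [_ *: 1]mulr1 subrK mulrC.
- by rewrite eqxx.
- move=> y; case: eqVneq => [->|yx]; first by rewrite subrr mulr0 addr0.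
  by rewrite divfK ?subr_eq0// addrC subrK.
Qed.

Lemma cexpD (z w : C) : cexp (z + w) = cexp z * cexp w.
Proof.
case: z => a b; case: w => c d; rewrite /cexp /= expRD cosD sinD.
by simpc; congr (_ +i* _); ring.
Qed.

Lemma cexp0 : cexp 0 = 1 :> C.
Proof. by rewrite /cexp /= expR0 cos0 sin0 mul1r. Qed.

Lemma normc_cexp (z : C) : normc (cexp z) = expR (Re z).
Proof.
rewrite normcM normc_real ger0_norm ?expR_ge0//= cos2Dsin2 sqrtr1 mulr1//.
Qed.

Lemma cexp_neq0 (z : C) : cexp z != 0.
Proof. by rewrite -normc_eq0 normc_cexp gt_eqF// expR_gt0. Qed.

(** Differentiability of [cexp] at 0, assembled from the slopes at 0 of the real exponential, cosine
    and sine; [cexpD] then carries it to every point. *)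
Lemma cexp_local (e : R) : 0 < e -> exists2 d, 0 < d &
  forall h : C, normc h < d -> normc (cexp h - 1 - h) <= e * normc h.
Proof.
move=> e0.
have [p [pc p0 pE]] := is_derive_caratheodory (is_derive_expR (0 : R)).
have [c [cc c0 cE]] := is_derive_caratheodory (is_derive_cos (0 : R)).
have [s [sc s0 sE]] := is_derive_caratheodory (is_derive_sin (0 : R)).
rewrite expR0 in pc p0 pE; rewrite sin0 oppr0 in cc c0; rewrite cos0 in sc s0.
have pE' x : expR x = 1 + p x * x by have := pE x; rewrite (subr0 x).
have cE' x : cos x = 1 + c x * x by have := cE x; rewrite cos0 (subr0 x).
have sE' x : sin x = s x * x by have := sE x; rewrite sin0 add0r (subr0 x).
(* The real and imaginary parts will be off by at most [4 * k * n] and [5 * k * n], so [k <= e / 12]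
   leaves some room. *)
pose k := Num.min (e / 12) 1.
have k0 : 0 < k by rewrite lt_min ltr01 divr_gt0.
have k1 : k <= 1 by rewrite /k ge_min lexx orbT.
have ke : k <= e / 12 by rewrite /k ge_min lexx.
move/cvgrPdist_lt : pc => /(_ k k0) /nbhs_ballP[d1 /= d10 hp].
move/cvgrPdist_lt : cc => /(_ k k0) /nbhs_ballP[d2 /= d20 hc].
move/cvgrPdist_lt : sc => /(_ k k0) /nbhs_ballP[d3 /= d30 hs].
exists (Num.min (Num.min d1 d2) (Num.min d3 k)); first by rewrite lt_min [X in X && _]lt_min d10 d20/= lt_min d30.
move=> [x y] hn; set n := normc (x +i* y) in hn *.
have xn : `|x| <= n by exact: (normc_Re (x +i* y)).
have yn : `|y| <= n by exact: (normc_Im (x +i* y)).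
move: hn; rewrite lt_min => /andP[]; rewrite lt_min => /andP[n1 n2]; rewrite lt_min => /andP[n3 n4].
have {}hp : `|1 - p x| < k by apply: hp; rewrite /ball/= sub0r normrN (le_lt_trans xn n1).
have {}hc : `|0 - c y| < k by apply: hc; rewrite /ball/= sub0r normrN (le_lt_trans yn n2).
have {}hs : `|1 - s y| < k by apply: hs; rewrite /ball/= sub0r normrN (le_lt_trans yn n3).
rewrite sub0r normrN in hc.
have p2 : `|p x| <= 2.
  have -> : p x = 1 - (1 - p x) by ring.
  by rewrite (le_trans (ler_normB _ _))// normr1; lra.
have s2 : `|s y| <= 2.
  have -> : s y = 1 - (1 - s y) by ring.
  by rewrite (le_trans (ler_normB _ _))// normr1; lra.
have n0 : 0 <= n by exact: normc_ge0.
have cM (a b a' b' : R) : `|a| <= a' -> `|b| <= b' -> `|a * b| <= a' * b'.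
  by move=> h1 h2; rewrite normrM ler_pM.
have E : cexp (x +i* y) - 1 - (x +i* y) = (expR x * cos y - 1 - x) +i* (expR x * sin y - y).
  have o1 : (1 : C) = 1 +i* 0 by [].
  by rewrite /cexp /= o1; simpc; congr (_ +i* _).
rewrite {}E.
have hre : `|expR x * cos y - 1 - x| <= 4 * k * n.
  rewrite pE' cE'.
  have -> : (1 + p x * x) * (1 + c y * y) - 1 - x =
    (c y * y - (1 - p x) * x) + p x * x * (c y * y) by ring.
  rewrite (le_trans (ler_normD _ _))//.
  have h1 : `|c y * y - (1 - p x) * x| <= k * n + k * n.
    by rewrite (le_trans (ler_normB _ _))// lerD// cM// ltW.
  have h2 : `|p x * x * (c y * y)| <= 2 * 1 * (k * n).
    apply: (cM _ _ _ _); apply: (cM _ _ _ _) => //; [|exact: ltW].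
    by rewrite (le_trans xn)// ltW// (lt_le_trans n4).
  rewrite (le_trans (lerD h1 h2))//; lra.
have him : `|expR x * sin y - y| <= 5 * k * n.
  rewrite pE' sE'.
  have -> : (1 + p x * x) * (s y * y) - y = - ((1 - s y) * y) + p x * x * (s y * y) by ring.
  rewrite (le_trans (ler_normD _ _))// normrN.
  have h1 : `|(1 - s y) * y| <= k * n by apply: (cM _ _ _ _) => //; exact: ltW.
  have h2 : `|p x * x * (s y * y)| <= 2 * k * (2 * n).
    apply: (cM _ _ _ _); apply: (cM _ _ _ _) => //.
    by rewrite (le_trans xn)// ltW.
  rewrite (le_trans (lerD h1 h2))//; lra.
rewrite (le_trans (normc_le_ReIm _))// (le_trans (lerD hre him))//.
rewrite -!mulrDl ler_wpM2r//; lra.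
Qed.

Lemma cdiff_cexp z : cdiff (@cexp R) z.
Proof.
have d0 : cdiff (@cexp R) 0.
  exists (fun h => if h == 0 then 1 else (cexp h - 1) / h); split.
    apply/ccontinuous_atP => e e0.
    have [d d0 dP] := cexp_local (divr_gt0 e0 (ltr0n _ 2)).
    exists d => // w; rewrite subr0 eqxx => wd.
    case: eqVneq => [_|w0]; first by rewrite subrr normc0.
    have -> : (cexp w - 1) / w - 1 = (cexp w - 1 - w) / w by field.
    rewrite normcM normcV ltr_pdivrMr ?normc_gt0//.
    by rewrite (le_lt_trans (dP _ wd))// ltr_pM2r ?normc_gt0// ltr_pdivrMr// ltr_pMr// ltr1n.
  move=> w; rewrite cexp0 subr0; case: eqVneq => [->|w0]; first by rewrite mulr0 addr0 cexp0.
  by rewrite divfK// addrC subrK.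
have -> : @cexp R = (fun w => cexp z * (@cexp R \o (fun w => w - z)) w).
  by apply/funext => w; rewrite /= -cexpD addrC subrK.
apply: cdiffM; first exact: cdiff_cst.
apply: cdiff_comp; first by apply: cdiffB; [exact: cdiff_id|exact: cdiff_cst].
by rewrite subrr.
Qed.

End ComplexExponential.

Section CircleMean.
Variable R : realType.
Local Notation C := (R[i]).
Local Notation Co := (R[i]^o).
Local Notation mu := (@circle_measure R).
Local Notation param := (@circle_param R).

Lemma cdiff_plane_diff (f : C -> C) (kappa : C) (s t : R) :
  cdiff f (s%:C + kappa * t%:C) -> plane_diff (fun s t => f (s%:C + kappa * t%:C)) kappa s t.
Proof.
move=> [q [/ccontinuous_atP qc fq]]; set z := s%:C + _ in qc fq *.
exists (q z) => e e0.
pose M := 1 + normc kappa.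
have M0 : 0 < M by rewrite ltr_pwDl// normc_ge0.
have [d d0 dP] := qc (e / M) (divr_gt0 e0 M0).
exists (d / (2 * M)); first by rewrite divr_gt0// mulr_gt0.
move=> s' t' hs ht; set w := (s' - s)%:C + kappa * (t' - t)%:C.
have E : s'%:C + kappa * t'%:C = z + w by rewrite /z /w !rmorphB/=; ring.
have nw : normc w <= M * (`|s' - s| + `|t' - t|).
  rewrite (le_trans (ler_normcD _ _))// normcM !normc_real mulrDl mul1r lerD//.
    by rewrite lerDl.
  by rewrite ler_wpM2l ?normc_ge0// lerDr.
have wd : normc w < d.
  rewrite (le_lt_trans nw)// mulrC -ltr_pdivlMr//.
  have -> : d / M = d / (2 * M) + d / (2 * M) by field; rewrite gt_eqF.
  exact: ltrD.
rewrite E fq -/z.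
have -> : f z + q (z + w) * (z + w - z) - f z - q z * w = (q (z + w) - q z) * w by ring.
rewrite normcM.
have := dP (z + w); rewrite (_ : z + w - z = w); last by ring.
move=> /(_ wd) /ltW h.
apply: le_trans (ler_pM (normc_ge0 _) (normc_ge0 _) h nw) _.
by rewrite mulrA divfK// gt_eqF.
Qed.

(** The number [2 pi i]: with it, [cexp] wraps the rectangle [ln r <= x <= ln s], [0 <= t <= 1] onto
    a closed annulus. *)
Definition kappa2pi : C := 0 +i* (2 * pi).

Lemma cexp_polar (s t : R) : cexp (s%:C + kappa2pi * t%:C) = (expR s)%:C * val (param t).
Proof. by rewrite /cexp /kappa2pi; simpc. Qed.

Lemma circle_Sint (h : circle R -> C) :
  (forall t, ccvg (nbhs t) (h \o param) (h (param t))) ->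
  cmeas setT h /\ Cint mu setT h = Sint 0 1 (h \o param).
Proof.
move=> hc.
have m1 : measurable_fun setT (fun t : measurableTypeR R => Re (h (param t))).
  by apply: continuous_measurable_fun => t; exact: cvg_Re (hc t).
have m2 : measurable_fun setT (fun t : measurableTypeR R => Im (h (param t))).
  by apply: continuous_measurable_fun => t; exact: cvg_Im (hc t).
split.
  by split; apply: circle_measurableP; exact: measurable_lebesgueR.
have [i1 i2] := @seg_integrable R 0 1 (h \o param) (fun t _ => hc t).
have sub : `[0, 1[%classic `<=` (`[0, 1]%classic : set R).
  by apply: subset_itvl; rewrite bnd_simp.
rewrite /Cint !circle_Rintegral// /Sint /Cint; congr Complex.
  by apply: Rintegral_itv_bndo_bndc; exact: integrableS i1.
by apply: Rintegral_itv_bndo_bndc; exact: integrableS i2.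
Qed.

Lemma param_cvg (t : R) : ccvg (nbhs t) (fun t => val (param t)) (val (param t)).
Proof.
have h : continuous (fun t : R => 2 * pi * t).
  by move=> x; apply: cvgM; [exact: cvg_cst|exact: cvg_id].
apply: cvg_Complex => /=.
  exact: (continuous_comp (h t) (@continuous_cos R (2 * pi * t))).
exact: (continuous_comp (h t) (@continuous_sin R (2 * pi * t))).
Qed.

Lemma param01 : val (param 1) = val (param 0).
Proof. by rewrite /= !mulr0 mulr1 cos0 sin0 mulr_natl cos2pi sin2pi. Qed.

Definition circle_mean (f : C -> C) (r : R) : C :=
  Cint mu setT (fun g => f (r%:C * val g)).

Lemma normc_circle (g : circle R) : normc (val g) = 1.
Proof. by apply: complexI; rewrite -normr_normc; exact/eqP/(valP g). Qed.

Lemma circle_ray_cvg (f : C -> C) (r t : R) : ccontinuous_at f (r%:C * val (param t)) ->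
  ccvg (nbhs t) (fun t => f (r%:C * val (param t))) (f (r%:C * val (param t))).
Proof.
rewrite /ccontinuous_at ccvgE => fc; rewrite ccvgE.
apply: (cvg_comp _ _ _ fc).
rewrite -ccvgE; apply: ccvgM; first exact: ccvg_cst.
exact: param_cvg.
Qed.

(** Goursat's theorem for [f \o cexp] on the rectangle [[ln r, ln s]] by [[0, 1]]: the horizontal
    sides cancel by periodicity and the vertical ones are the two means. Differentiability is asked
    on an annulus only, so that [f] may be singular at the origin or on an inner circle. *)
Lemma circle_mean_const (f : C -> C) (r1 r2 r s : R) : 0 <= r1 -> r1 < r -> r <= s -> s < r2 ->
  (forall z, r1 < normc z < r2 -> cdiff f z) -> circle_mean f r = circle_mean f s.
Proof.
move=> r10 r1r rs sr2 fd.
have r0 : 0 < r by exact: le_lt_trans r1r.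
have s0 : 0 < s by exact: lt_le_trans rs.
have nr x t : 0 < x -> normc (x%:C * val (param t)) = x.
  by move=> x0; rewrite normcM normc_circle mulr1 normc_real gtr0_norm.
have key x : r <= x <= s -> circle_mean f x = Sint 0 1 (fun t => f (x%:C * val (param t))).
  move=> /andP[rx xs]; have [] // := @circle_Sint (fun g => f (x%:C * val g)).
  move=> t; apply: circle_ray_cvg; apply: cdiff_continuous; apply: fd.
  by rewrite nr ?(lt_le_trans r0)// (lt_le_trans r1r)// (le_lt_trans xs).
rewrite !key ?lexx ?rs//.
pose u (x t : R) := f (cexp (x%:C + kappa2pi * t%:C)).
have ud x t : ln r <= x <= ln s -> 0 <= t <= 1 -> plane_diff u kappa2pi x t.
  move=> /andP[x1 x2] _; apply: (@cdiff_plane_diff (f \o @cexp R)).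
  apply: cdiff_comp; first exact: cdiff_cexp.
  apply: fd; rewrite cexp_polar nr ?expR_gt0//.
  rewrite (lt_le_trans r1r) -1?ler_ln ?posrE ?expR_gt0// ?expRK//=.
  by rewrite (le_lt_trans _ sr2)// -ler_ln ?posrE ?expR_gt0// expRK.
have lrs : ln r <= ln s by rewrite ler_ln.
have u01 : u ^~ 1 = u ^~ 0.
  by apply/funext => x; rewrite /u !cexp_polar param01.
have k0 : kappa2pi != 0.
  by rewrite eq_complex/= eqxx/= mulf_eq0 pnatr_eq0/= gt_eqF// pi_gt0.
have bdry0 (K : fieldType) (k A B D : K) : k != 0 -> k * (A - B) - (D - D) = 0 -> A = B.
  by move=> kn0; rewrite subrr subr0 => /eqP; rewrite mulf_eq0 (negbTE kn0) subr_eq0 => /eqP.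
have := goursat lrs (@ler01 R) ud; rewrite /bdry u01 => /(bdry0 _ _ _ _ _ k0) us.
have E x : 0 < x -> u (ln x) = (fun t => f (x%:C * val (param t))).
  by move=> x0; apply/funext => t; rewrite /u cexp_polar lnK.
move: us; rewrite (E s s0) (E r r0); exact: esym.
Qed.

End CircleMean.

Section BoundedOnCircle.
Variable R : realType.
Local Notation C := (R[i]).
Local Notation Co := (R[i]^o).
Local Notation mu := (@circle_measure R).
Local Notation param := (@circle_param R).
Implicit Types (h k : circle R -> C).

Lemma circle_cst_integrable (r : R) : mu.-integrable setT (EFin \o (fun=> r)).
Proof.
apply/integrableP; split; first exact: measurable_cst.
by rewrite integral_cst//= [X in (_ * X)%E](circle_measure_setT R) mule1 ltry.
Qed.

Lemma circle_Rint_cst (r : R) : \int[mu]_g r = r.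
Proof. by rewrite Rintegral_cst// [X in fine X](circle_measure_setT R) mulr1. Qed.

Lemma Cint_circle_cst (c : C) : Cint mu setT (fun=> c) = c.
Proof. by rewrite /Cint !circle_Rint_cst; case: c. Qed.

(** Bounded measurable functions form an algebra stable under conjugation, and all of them are
    integrable since the measure is finite; integrability of the many products below is obtained
    from this. *)
Definition cbm h := cmeas setT h /\ exists M, forall g, normc (h g) <= M.

Lemma cbm_integrable h : cbm h -> Cintegrable mu setT h.
Proof.
move=> [mh [M hM]]; apply: (Cintegrable_bound _ mh (circle_cst_integrable M)) => //.
Qed.

Lemma normc_Cint_circle h M : Cintegrable mu setT h -> (forall g, normc (h g) <= M) ->
  normc (Cint mu setT h) <= M.
Proof.
move=> ih hM; rewrite -[leRHS]circle_Rint_cst.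
by apply: (normc_Cint_le _ ih (circle_cst_integrable M)) => //.
Qed.

Lemma cbm_cst (c : C) : cbm (fun=> c).
Proof. by split; [exact: cmeas_cst|exists (normc c)]. Qed.

Lemma cbmD h k : cbm h -> cbm k -> cbm (fun g => h g + k g).
Proof.
move=> [mh [M hM]] [mk [N kN]]; split; first exact: cmeasD.
exists (M + N) => g; apply: le_trans (ler_normcD _ _) _; exact: lerD.
Qed.

Lemma cbmM h k : cbm h -> cbm k -> cbm (fun g => h g * k g).
Proof.
move=> [mh [M hM]] [mk [N kN]]; split; first exact: cmeasM.
exists (M * N) => g; rewrite normcM; apply: ler_pM => //; exact: normc_ge0.
Qed.

Lemma cbmN h : cbm h -> cbm (fun g => - h g).
Proof.
by move=> [mh [M hM]]; split; [exact: cmeasN|exists M => g; rewrite normcN].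
Qed.

Lemma cbmB h k : cbm h -> cbm k -> cbm (fun g => h g - k g).
Proof. by move=> bh bk; exact: cbmD bh (cbmN bk). Qed.

Lemma cbm_conj h : cbm h -> cbm (fun g => (h g)^*).
Proof.
by move=> [mh [M hM]]; split; [exact: cmeas_conj|exists M => g; rewrite normc_conj].
Qed.

Lemma cbmX h n : cbm h -> cbm (fun g => h g ^+ n).
Proof.
move=> bh; elim: n => [|n ih]; first by under eq_fun do rewrite expr0; exact: cbm_cst.
by under eq_fun do rewrite exprS; exact: cbmM.
Qed.

Lemma cmeas_val : cmeas setT (fun g : circle R => val g).
Proof. exact: (@circle_Sint R (fun g => val g) (@param_cvg R)).1. Qed.

Lemma cbm_val : cbm (fun g : circle R => val g).
Proof. by split; [exact: cmeas_val|exists 1 => g; rewrite normc_circle]. Qed.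

Lemma cbm_real (u : circle R -> R) M : measurable_fun setT u -> (forall g, `|u g| <= M) ->
  cbm (fun g => (u g)%:C).
Proof.
by move=> mu_ uM; split; [exact: cmeas_real|exists M => g; rewrite normc_real].
Qed.

Lemma Cint_circle_cvg (hn : nat -> circle R -> C) h M :
  (forall n, cmeas setT (hn n)) -> cmeas setT h ->
  (forall n g, normc (hn n g) <= M) ->
  {ae mu, forall g, ccvg \oo (hn ^~ g) (h g)} ->
  ccvg \oo (fun n => Cint mu setT (hn n)) (Cint mu setT h).
Proof.
move=> mhn mh hM hc.
have [] // := @Cint_cvg _ _ R mu setT hn h (fun=> M) measurableT mhn mh (circle_cst_integrable M).
by apply: filterS hc => g hg _.
Qed.

End BoundedOnCircle.

(** * Cauchy and Poisson kernels *)

Section CauchyPoisson.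
Variable R : realType.
Local Notation C := (R[i]).
Local Notation Co := (R[i]^o).
Local Notation mu := (@circle_measure R).
Local Notation param := (@circle_param R).
Implicit Types (f : C -> C) (a w z : C) (r s : R) (g : circle R).

Lemma normc_ray r g : 0 <= r -> normc (r%:C * val g) = r.
Proof. by move=> r0; rewrite normcM normc_circle mulr1 normc_real ger0_norm. Qed.

Lemma cmeas_ray f r : 0 <= r -> (forall z, normc z = r -> ccontinuous_at f z) ->
  cmeas setT (fun g => f (r%:C * val g)).
Proof.
move=> r0 fc; apply: (@circle_Sint R (fun g => f (r%:C * val g)) _).1.
by move=> t; apply: circle_ray_cvg; apply: fc; rewrite normc_ray.
Qed.

Lemma circle_mean_cvg f (rn : nat -> R) r M : 0 <= r -> (forall n, 0 <= rn n) ->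
  rn n @[n --> \oo] --> r ->
  (forall z, normc z = r -> ccontinuous_at f z) ->
  (forall n z, normc z = rn n -> ccontinuous_at f z) ->
  (forall n z, normc z = rn n -> normc (f z) <= M) ->
  ccvg \oo (fun n => circle_mean f (rn n)) (circle_mean f r).
Proof.
move=> r0 rn0 rnr fr frn fM; apply: (@Cint_circle_cvg _ _ _ M).
- by move=> n; apply: cmeas_ray => //; exact: frn.
- exact: cmeas_ray.
- by move=> n g; apply: (fM n); rewrite normc_ray.
- apply: aeW => g.
  have h : ccvg \oo (fun n => (rn n)%:C * val g) (r%:C * val g).
    by apply: ccvgM; [exact: cvg_realC|exact: ccvg_cst].
  have := fr _ (normc_ray g r0).
  rewrite /ccontinuous_at !ccvgE => fc; rewrite ccvgE in h; exact: (cvg_comp _ _ h fc).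
Qed.

Lemma circle_mean0 f : circle_mean f 0 = f 0.
Proof.
rewrite /circle_mean -[RHS](Cint_circle_cst); apply: eq_Cint => g _.
by rewrite mul0r.
Qed.

Lemma cvg_shrink (c : R) : c / n.+1%:R @[n --> \oo] --> (0 : R).
Proof.
have h := @cvg_harmonic R.
rewrite -(mulr0 c); apply: cvgM; [exact: cvg_cst|exact: h].
Qed.

Lemma ler_shrink (c : R) n : 0 <= c -> c / n.+1%:R <= c.
Proof. by move=> c0; rewrite ler_pdivrMr// -{1}(mulr1 c) ler_wpM2l// ler1n. Qed.

Lemma mean_value f r rho : 0 <= r -> r < rho -> (forall z, normc z < rho -> cdiff f z) ->
  circle_mean f r = f 0.
Proof.
rewrite le_eqVlt => /predU1P[<- _ _|r0 rrho fd]; first exact: circle_mean0.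
have rho0 : 0 < rho by exact: lt_trans rrho.
have f0c : ccontinuous_at f 0 by apply: cdiff_continuous; apply: fd; rewrite normc0.
have /ccontinuous_atP/(_ 1 ltr01)[d d0 dP] := f0c.
(* The radii [c / (n + 1)] shrink to 0 inside the disc where [f] is within 1 of [f 0], which
   provides the bound for dominated convergence. *)
pose c := Num.min r (d / 2).
have c0 : 0 < c by rewrite lt_min r0 divr_gt0.
have cr : c <= r by rewrite /c ge_min lexx.
have cd : c < d by rewrite gt_min; apply/orP; right; rewrite ltr_pdivrMr// ltr_pMr// ltr1n.
have cn n : 0 < c / n.+1%:R by rewrite divr_gt0.
have cnc n : c / n.+1%:R <= c by apply: ler_shrink; exact: ltW.
have fc z : normc z < rho -> ccontinuous_at f z by move=> /fd /cdiff_continuous.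
have h := @circle_mean_cvg f (fun n => c / n.+1%:R) 0 (normc (f 0) + 1) (lexx _) (fun n => ltW (cn n)) (cvg_shrink c).
have hcv : ccvg \oo (fun n => circle_mean f (c / n.+1%:R)) (circle_mean f 0).
  apply: h.
  - by move=> z z0; apply: fc; rewrite z0.
  - by move=> n z zn; apply: fc; rewrite zn (le_lt_trans (cnc n))// (le_lt_trans cr).
  - move=> n z zn; have : normc (z - 0) < d by rewrite subr0 zn (le_lt_trans (cnc n)).
    move=> /dP/ltW; rewrite -lerBlDl; apply: le_trans; exact: lerB_normc.
rewrite -circle_mean0; apply: (ccvg_unique _ hcv).
apply: eq_ccvg (ccvg_cst (circle_mean f r)) => n.
apply/esym; apply: (@circle_mean_const R f 0 rho) => //.
  by rewrite (le_trans (cnc n)).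
by move=> z /andP[_]; exact: fd.
Qed.

(** The mean is constant on either side of the circle of radius [rho0], equals [f 0] inside, and is
    continuous across it by dominated convergence. This takes the place of removing an isolated
    singularity at a point of modulus [rho0]. *)
Lemma mean_value_removable f r rho0 M : 0 < rho0 -> rho0 < r -> r < 1 ->
  (forall z, normc z < 1 -> ccontinuous_at f z) ->
  (forall z, normc z < 1 -> normc z != rho0 -> cdiff f z) ->
  (forall z, normc z < 1 -> normc (f z) <= M) ->
  circle_mean f r = f 0.
Proof.
move=> rho00 rho0r r1 fc fd fM.
have rho1 : rho0 < 1 by exact: lt_trans r1.
have below s : 0 <= s -> s < rho0 -> circle_mean f s = f 0.
  move=> s0 srho; apply: (mean_value s0 srho) => z zr; apply: fd.
    exact: lt_trans zr rho1.
  by rewrite lt_eqF.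
have above s : rho0 < s -> s <= r -> circle_mean f s = circle_mean f r.
  move=> rs sr; apply: (@circle_mean_const R f rho0 1) => //; first exact: ltW.
  by move=> z /andP[z1 z2]; apply: fd => //; rewrite gt_eqF.
have E : circle_mean f rho0 = f 0.
  pose rn n := rho0 - rho0 / n.+1%:R.
  have rn0 n : 0 <= rn n by rewrite subr_ge0 ler_shrink// ltW.
  have rn1 n : rn n < rho0 by rewrite ltrBlDr ltrDl divr_gt0.
  have rnc : rn n @[n --> \oo] --> rho0.
    rewrite -[X in _ --> X]subr0; apply: cvgB; [exact: cvg_cst|exact: cvg_shrink].
  have hcv : ccvg \oo (fun n => circle_mean f (rn n)) (circle_mean f rho0).
    apply: (@circle_mean_cvg f rn rho0 M (ltW rho00) rn0 rnc).
    - by move=> z zr; apply: fc; rewrite zr.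
    - by move=> n z zr; apply: fc; rewrite zr (lt_trans (rn1 n)).
    - by move=> n z zr; apply: fM; rewrite zr (lt_trans (rn1 n)).
  apply: (ccvg_unique hcv); apply: eq_ccvg (ccvg_cst (f 0)) => n.
  by apply/esym; apply: below.
rewrite -E.
pose rn n := rho0 + (r - rho0) / n.+1%:R.
have dr : 0 < r - rho0 by rewrite subr_gt0.
have rn0 n : rho0 < rn n by rewrite ltrDl divr_gt0.
have rn1 n : rn n <= r by rewrite -lerBrDl ler_shrink// ltW.
have rnc : rn n @[n --> \oo] --> rho0.
  rewrite -[X in _ --> X]addr0; apply: cvgD; [exact: cvg_cst|exact: cvg_shrink].
have hcv : ccvg \oo (fun n => circle_mean f (rn n)) (circle_mean f rho0).
  apply: (@circle_mean_cvg f rn rho0 M (ltW rho00) (fun n => ltW (lt_trans rho00 (rn0 n))) rnc).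
  - by move=> z zr; apply: fc; rewrite zr.
  - by move=> n z zr; apply: fc; rewrite zr (le_lt_trans (rn1 n)).
  - by move=> n z zr; apply: fM; rewrite zr (le_lt_trans (rn1 n)).
apply: (ccvg_unique _ hcv); apply: eq_ccvg (ccvg_cst (circle_mean f r)) => n.
by apply/esym; apply: above.
Qed.

(** Equal to [gamma / (gamma - a)] on the circle, so that integration against the normalized measure
    is Cauchy's integral. *)
Definition cauchy_kernel a g : C := (1 - a * (val g)^*)^-1.

Definition poisson_kernel a g : R := (1 - normc a ^+ 2) / normc (val g - a) ^+ 2.

Lemma circle_neq_disc a g : normc a < 1 -> val g - a != 0.
Proof.
move=> a1; rewrite subr_eq0; apply/eqP => ga.
by move: a1; rewrite -ga normc_circle ltxx.
Qed.

Lemma circle_mul_conj g : val g * (val g)^* = 1.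
Proof. by rewrite mulc_conj normc_circle expr1n. Qed.

Lemma cauchy_kernelE a g : 1 - a * (val g)^* = (val g - a) * (val g)^*.
Proof. by rewrite mulrBl circle_mul_conj. Qed.

Lemma cauchy_den_neq0 a g : normc a < 1 -> 1 - a * (val g)^* != 0.
Proof.
move=> a1; rewrite cauchy_kernelE mulf_neq0 ?circle_neq_disc//.
by rewrite -normc_eq0 normc_conj normc_circle oner_eq0.
Qed.

Lemma normc_cauchy_kernel a g : normc (cauchy_kernel a g) = (normc (val g - a))^-1.
Proof. by rewrite normcV cauchy_kernelE normcM normc_conj normc_circle mulr1. Qed.

Lemma lerB_normc_circle a g : 1 - normc a <= normc (val g - a).
Proof. by rewrite -(normc_circle g) lerB_normc. Qed.

Lemma normc_cauchy_kernel_le a g : normc a < 1 -> normc (cauchy_kernel a g) <= (1 - normc a)^-1.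
Proof.
move=> a1; rewrite normc_cauchy_kernel lef_pV2 ?posrE ?subr_gt0 ?normc_gt0 ?circle_neq_disc//.
exact: lerB_normc_circle.
Qed.

Lemma cbm_cauchy_kernel a : normc a < 1 -> cbm (cauchy_kernel a).
Proof.
move=> a1; split; last by exists (1 - normc a)^-1 => g; exact: normc_cauchy_kernel_le.
have h : cmeas setT (fun g : circle R => 1 - a * (val g)^*).
  exact: cmeasB (cmeas_cst _ _) (cmeasM (cmeas_cst _ _) (cmeas_conj (@cmeas_val R))).
exact: (cmeasV measurableT h).
Qed.

Lemma poisson_kernel_ge0 a g : normc a < 1 -> 0 <= poisson_kernel a g.
Proof.
by move=> a1; rewrite divr_ge0 ?sqr_ge0// subr_ge0 expr_le1 ?normc_ge0// ltW.
Qed.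

Lemma circle_conjV g : (val g)^* = (val g)^-1.
Proof.
have g0 : val g != 0 by rewrite -normc_eq0 normc_circle oner_eq0.
by apply: (mulfI g0); rewrite circle_mul_conj mulfV.
Qed.

Lemma conj_cauchy_kernel a g : (cauchy_kernel a g)^* = (1 - a^* * val g)^-1.
Proof. by rewrite /cauchy_kernel conjcV' conjcB conjcM conjcK' conjc1. Qed.

(** The splitting of the Poisson kernel as an identity of fields: [a'] and [v'] stand for the
    conjugates, and [v * v' = 1] says that [v] lies on the circle. *)
Lemma poisson_cauchy_field (F : fieldType) (a a' v v' : F) : v * v' = 1 ->
  1 - a * v' != 0 -> 1 - a' * v != 0 ->
  (1 - a * a') / ((1 - a * v') * (1 - a' * v)) = (1 - a * v')^-1 + (1 - a' * v)^-1 - 1.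
Proof.
move=> e h1 h2; have -> : 1 - a * a' = 1 - a * a' * (v * v') by rewrite e mulr1.
by field; rewrite h1 h2.
Qed.

Lemma poisson_cauchy a g : normc a < 1 ->
  (poisson_kernel a g)%:C = cauchy_kernel a g + (cauchy_kernel a g)^* - 1.
Proof.
move=> a1; have D0 := cauchy_den_neq0 g a1.
have Dc0 : (1 - a * (val g)^*)^* != 0 by rewrite -normc_eq0 normc_conj normc_eq0.
have nD : normc (val g - a) = normc (1 - a * (val g)^*).
  by rewrite cauchy_kernelE normcM normc_conj normc_circle mulr1.
rewrite /poisson_kernel /cauchy_kernel conjcV' nD rmorphM/= fmorphV/= -mulc_conj.
have Dc : (1 - a * (val g)^*)^* = 1 - a^* * val g.
  by rewrite conjcB conjcM conjcK' conjc1.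
rewrite Dc in Dc0 *.
have -> : (1 - normc a ^+ 2)%:C = 1 - a * a^* by rewrite rmorphB/= mulc_conj.
exact: poisson_cauchy_field (circle_mul_conj g) D0 Dc0.
Qed.

Lemma cbm_poisson_kernel a : normc a < 1 -> cbm (fun g => (poisson_kernel a g)%:C).
Proof.
move=> a1; have h := cbm_cauchy_kernel a1.
have := cbmB (cbmD h (cbm_conj h)) (cbm_cst 1).
by under eq_fun do rewrite -poisson_cauchy//.
Qed.

Lemma cauchy_kernel_mean a : normc a < 1 -> Cint mu setT (cauchy_kernel a) = 1.
Proof.
move=> a1.
pose F z := (1 - a^* * z)^-1.
have F1 : circle_mean F 1 = F 0.
  have n0 := normc_ge0 a.
  have n1 : 0 < 1 + normc a by lra.
  (* A radius beyond 1 within which [F] has no pole, because [normc a * (2 / (1 + normc a)) < 1]. *)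
  have t1 : 1 < 2 / (1 + normc a) by rewrite ltr_pdivlMr//; lra.
  apply: (mean_value (@ler01 R) t1) => z zt; apply: cdiffV; last first.
    by apply: cdiffB; [exact: cdiff_cst|apply: cdiffM; [exact: cdiff_cst|exact: cdiff_id]].
  rewrite subr_eq0; apply/eqP => e1.
  have : normc (a^* * z) < 1.
    rewrite normcM normc_conj; move: zt; rewrite ltr_pdivlMr// => zt.
    have z0 := normc_ge0 z; nra.
  by rewrite -e1 normc1 ltxx.
have -> : cauchy_kernel a = (fun g => (F (1%:C * val g))^*).
  by apply/funext => g; rewrite /F mul1r -conj_cauchy_kernel conjcK'.
have iF : Cintegrable mu setT (fun g => F (1%:C * val g)).
  have -> : (fun g : circle R => F (1%:C * val g)) = (fun g => (cauchy_kernel a g)^*).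
    by apply/funext => g; rewrite conj_cauchy_kernel /F mul1r.
  exact: cbm_integrable (cbm_conj (cbm_cauchy_kernel a1)).
by rewrite (Cint_conj measurableT iF) [X in X^*]F1 /F mulr0 subr0 invr1 conjc1.
Qed.

End CauchyPoisson.

(** * Cauchy's and Poisson's formulas on circles inside the disc *)

Section PoissonFormula.
Variable R : realType.
Local Notation C := (R[i]).
Local Notation Co := (R[i]^o).
Local Notation mu := (@circle_measure R).
Implicit Types (f : C -> C) (a w z : C) (r s : R) (g : circle R).

Definition discdiff f := forall z, normc z < 1 -> cdiff f z.

Lemma cmeas_discdiff_ray f r : discdiff f -> 0 <= r < 1 -> cmeas setT (fun g => f (r%:C * val g)).
Proof.
move=> fd /andP[r0 r1]; apply: cmeas_ray => // z zr.
by apply: cdiff_continuous; apply: fd; rewrite zr.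
Qed.

(** With [p] the slope of [f] at [w], the function [q z = z * p z] vanishes at 0, so its mean on the
    circle of radius [r] is 0; on that circle [q] is [f z - f w] times the Cauchy kernel. As [q] is
    only known to be continuous at [w], its mean comes from [mean_value_removable] with the circle
    through [w], and [w = 0] is treated apart. *)
Lemma cauchy_formula f M r w : discdiff f -> (forall z, normc z < 1 -> normc (f z) <= M) ->
  0 < r < 1 -> normc w < r ->
  Cint mu setT (fun g => f (r%:C * val g) * cauchy_kernel (w / r%:C) g) = f w.
Proof.
move=> fd fM /andP[r0 r1] wr.
have w1 : normc w < 1 by exact: lt_trans r1.
have rC0 : r%:C != 0 :> C by rewrite -normc_eq0 normc_real normr_eq0 gt_eqF.
have [w0|w0] := eqVneq w 0.
  rewrite w0 mul0r -(mean_value (ltW r0) r1 fd) /circle_mean; apply: eq_Cint => g _.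
  by rewrite /cauchy_kernel mul0r subr0 invr1 mulr1.
have [p [pc fp]] := fd w w1.
pose q z := z * p z.
have pE z : z != w -> p z = (f z - f w) / (z - w).
  by move=> zw; rewrite fp addrC addKr mulfK// subr_eq0.
have qd z : normc z < 1 -> z != w -> cdiff q z.
  move=> z1 zw; apply: cdiffM; first exact: cdiff_id.
  have zwn : 0 < normc (z - w) by rewrite normc_gt0 subr_eq0.
  apply: (@near_cdiff _ (fun z => (f z - f w) * (z - w)^-1)).
    apply/nbhs_normc; exists (normc (z - w)) => // y yz; rewrite pE//.
    by apply: contraTneq yz => ->; rewrite normcBC ltxx.
  apply: cdiffM; first by apply: cdiffB; [exact: fd|exact: cdiff_cst].
  by apply: cdiffV; [rewrite subr_eq0|apply: cdiffB; [exact: cdiff_id|exact: cdiff_cst]].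
have qc z : normc z < 1 -> ccontinuous_at q z.
  move=> z1; have [->|zw] := eqVneq z w; last exact: cdiff_continuous (qd z z1 zw).
  exact: ccvgM (ccvg_id w) pc.
have /ccontinuous_atP/(_ 1 ltr01)[d d0 dP] := pc.
(* Near [w] the slope is bounded by continuity; at distance at least [d] it is bounded by
   [2 * M / d]. *)
pose K := Num.max (normc (p w) + 1) (2 * M / d).
have qM z : normc z < 1 -> normc (q z) <= K.
  move=> z1; rewrite normcM; apply: (@le_trans _ _ (normc (p z))).
    by rewrite -[leRHS]mul1r ler_wpM2r ?normc_ge0// ltW.
  rewrite /K le_max; have [zd|zd] := ltP (normc (z - w)) d.
    apply/orP; left; have := dP z zd => /ltW h.
    by rewrite -lerBlDl (le_trans (lerB_normc _ _)).
  apply/orP; right; rewrite pE; last first.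
    by apply: contraTneq zd => ->; rewrite subrr normc0 -ltNge.
  rewrite normcM normcV ler_pdivrMr ?(lt_le_trans d0)// mulrAC ler_pdivlMr//.
  apply: ler_pM => //; [exact: normc_ge0|exact: ltW|].
  by rewrite (le_trans (ler_normcB _ _))// mulr_natl mulr2n lerD// fM.
have nw0 : 0 < normc w by rewrite normc_gt0.
have qmean : circle_mean q r = 0.
  rewrite (mean_value_removable (f := q) (rho0 := normc w) (M := K))//; first by rewrite /q mul0r.
  by move=> z z1 zw; apply: qd => //; apply: contraNneq zw => ->.
have a1 : normc (w / r%:C) < 1.
  by rewrite normcM normcV normc_real gtr0_norm// ltr_pdivrMr// mul1r.
have ik := cbm_cauchy_kernel a1.
have bf : cbm (fun g => f (r%:C * val g)).
  split; first by apply: cmeas_discdiff_ray => //; rewrite (ltW r0).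
  by exists M => g; apply: fM; rewrite normc_ray ?(ltW r0).
have E : circle_mean q r =
  Cint mu setT (fun g => f (r%:C * val g) * cauchy_kernel (w / r%:C) g -
     f w * cauchy_kernel (w / r%:C) g).
  apply: eq_Cint => g _; rewrite /q pE; last first.
    by apply: contraTneq wr => <-; rewrite normc_ray ?ltxx// ltW.
  rewrite -mulrBl /cauchy_kernel cauchy_kernelE.
  have g0 : val g != 0 by rewrite -normc_eq0 normc_circle oner_eq0.
  rewrite circle_conjV.
  have -> : val g - w / r%:C = (r%:C * val g - w) / r%:C by rewrite mulrBl mulrAC mulfV// mul1r.
  have d1 : r%:C * val g - w != 0.
    by rewrite subr_eq0; apply: contraTneq wr => <-; rewrite normc_ray ?ltxx// ltW.
  by field; rewrite d1 g0 rC0.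
move: qmean; rewrite E CintB//; last 2 first.
- exact: cbm_integrable (cbmM bf ik).
- exact: cbm_integrable (cbmM (cbm_cst _) ik).
rewrite CintZl//; last exact: cbm_integrable.
by rewrite cauchy_kernel_mean// mulr1 => /eqP; rewrite subr_eq0 => /eqP.
Qed.

Lemma conj_kernel_formula f r a : discdiff f -> 0 < r < 1 -> normc a < 1 ->
  Cint mu setT (fun g => f (r%:C * val g) * (cauchy_kernel a g)^*) = f 0.
Proof.
move=> fd /andP[r0 r1] a1.
have rC0 : r%:C != 0 :> C by rewrite -normc_eq0 normc_real normr_eq0 gt_eqF.
pose F z := f z * (1 - a^* / r%:C * z)^-1.
have n0 := normc_ge0 a.
(* A number strictly between [normc a] and 1: [F] is differentiable up to the smaller of 1 and
   [r / t], which exceeds [r]. *)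
pose t := (1 + normc a) / 2.
have t0 : 0 < t by rewrite /t; lra.
have t1 : t < 1 by rewrite /t; lra.
have at1 : normc a < t by rewrite /t; lra.
have rr : r < Num.min 1 (r / t) by rewrite lt_min r1/= ltr_pdivlMr// gtr_pMr.
have : circle_mean F r = F 0.
  apply: (mean_value (ltW r0) rr) => z; rewrite lt_min ltr_pdivlMr// => /andP[z1 zt].
  apply: cdiffM; first exact: fd.
  apply: cdiffV; last first.
    by apply: cdiffB; [exact: cdiff_cst|apply: cdiffM; [exact: cdiff_cst|exact: cdiff_id]].
  rewrite subr_eq0; apply/eqP => e1.
  have : normc (a^* / r%:C * z) < 1.
    rewrite !normcM normcV normc_conj normc_real gtr0_norm// mulrAC ltr_pdivrMr// mul1r.
    have z0 := normc_ge0 z; nra.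
  by rewrite -e1 normc1 ltxx.
rewrite /F mulr0 subr0 invr1 mulr1 => <-; apply: eq_Cint => g _.
by rewrite conj_cauchy_kernel mulrA divfK.
Qed.

(** In the splitting [poisson_cauchy], the Cauchy kernel yields the value at [r a], its conjugate
    yields [f 0], and the constant term takes [f 0] away. *)
Lemma poisson_formula f M r a : discdiff f -> (forall z, normc z < 1 -> normc (f z) <= M) ->
  0 < r < 1 -> normc a < 1 ->
  Cint mu setT (fun g => f (r%:C * val g) * (poisson_kernel a g)%:C) = f (r%:C * a).
Proof.
move=> fd fM r01 a1; have /andP[r0 r1] := r01.
have rC0 : r%:C != 0 :> C by rewrite -normc_eq0 normc_real normr_eq0 gt_eqF.
have ik := cbm_cauchy_kernel a1.
have bf : cbm (fun g => f (r%:C * val g)).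
  split; first by apply: cmeas_discdiff_ray => //; rewrite (ltW r0).
  by exists M => g; apply: fM; rewrite normc_ray ?(ltW r0).
have war : normc (r%:C * a) < r.
  by rewrite normcM normc_real gtr0_norm// gtr_pMr.
have := cauchy_formula fd fM r01 war; rewrite mulrAC mulfV// mul1r => <-.
have e0 := mean_value (ltW r0) r1 fd.
transitivity (Cint mu setT (fun g => (f (r%:C * val g) * cauchy_kernel a g +
   f (r%:C * val g) * (cauchy_kernel a g)^*) - f (r%:C * val g))).
  by apply: eq_Cint => g _; rewrite poisson_cauchy// mulrBr mulrDr mulr1.
pose proof (cbm_integrable (cbmM bf ik)) as i1.
pose proof (cbm_integrable (cbmM bf (cbm_conj ik))) as i2.
pose proof (cbm_integrable bf) as i0.
rewrite CintB//; last exact: CintegrableD.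
rewrite CintD// conj_kernel_formula// -[X in _ - X]/(circle_mean f r) e0.
by rewrite addrK.
Qed.

End PoissonFormula.

(** * Boundary functions and Lebesgue points *)

Section SummableLimit.
Context d (T : measurableType d) (R : realType) (m : {measure set T -> \bar R}).

Lemma integrable_EFinZl (D : set T) (k : R) (u : T -> R) : measurable D ->
  m.-integrable D (EFin \o u) -> m.-integrable D (EFin \o (fun x => k * u x)).
Proof.
move=> mD iu; have := integrableZl mD k iu.
by apply: eq_integrable => // x _.
Qed.

Lemma integrable_EFinD (D : set T) (u v : T -> R) : measurable D ->
  m.-integrable D (EFin \o u) -> m.-integrable D (EFin \o v) ->
  m.-integrable D (EFin \o (fun x => u x + v x)).
Proof.
move=> mD iu iv; have := integrableD mD iu iv.
by apply: eq_integrable => // x _.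
Qed.

Lemma limn_sup_bounded (u : nat -> R) (M : R) : (forall n, `|u n| <= M) -> `|limn_sup u| <= M.
Proof.
move=> uM.
have hu : has_ubound (range u) by exists M => _ [n _ <-]; exact: le_trans (ler_norm _) (uM n).
have hl : has_lbound (range u).
  by exists (- M) => _ [n _ <-]; have := uM n; rewrite ler_norml => /andP[].
have -> : limn_sup u = inf (range (sups u)) by apply/cvg_lim => //; exact: cvg_sups_inf.
have sb n : - M <= sups u n <= M.
  apply/andP; split.
    apply: (@le_trans _ _ (u n)).
      by have := uM n; rewrite ler_norml => /andP[].
    by apply: ub_le_sup; [exact/has_ubound_sdrop|exists n => /=].
  apply: ge_sup; first by exists (u n), n => /=.
  by move=> _ [k _ <-]; exact: le_trans (ler_norm _) (uM k).
rewrite ler_norml; apply/andP; split.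
  apply: lb_le_inf; first by exists (sups u 0%N), 0%N.
  by move=> _ [n _ <-]; have /andP[] := sb n.
have /andP[_] := sb 0%N; apply: le_trans; apply: ge_inf; last by exists 0%N.
by exists (- M) => _ [n _ <-]; have /andP[] := sb n.
Qed.

(** The sum of the absolute increments has a finite integral, hence is finite almost everywhere;
    there the telescoping series converges absolutely. *)
Lemma ae_cvg_of_summable_differences (u : nat -> T -> R) (c : R) :
  (forall n, measurable_fun setT (u n)) ->
  (forall n, (\int[m]_x (`|u n.+1 x - u n x|)%:E <= (c / 2 ^+ n)%:E)%E) ->
  {ae m, forall x, cvgn (u ^~ x)}.
Proof.
move=> mu_ hc.
pose F x := (\sum_(n <oo) (`|u n.+1 x - u n x|)%:E)%E.
have mf n : measurable_fun setT (fun x => (`|u n.+1 x - u n x|)%:E).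
  by apply/measurable_EFinP; apply: measurableT_comp => //; exact: measurable_funB.
have mF : measurable_fun setT F.
  by apply: ge0_emeasurable_sum => // n x _ _; rewrite lee_fin.
have F0 x : (0 <= F x)%E by apply: nneseries_ge0 => n _ _; rewrite lee_fin.
have iF : m.-integrable setT F.
  apply/integrableP; split => //.
  under eq_integral do rewrite gee0_abs//.
  rewrite /F integral_nneseries//.
  apply: (@le_lt_trans _ _ (\sum_(n <oo) (c / 2 ^+ n)%:E)%E).
    by apply: lee_nneseries => // n _ _; apply: integral_ge0 => x _; rewrite lee_fin.
  have c0 : 0 <= c.
    have := hc 0%N; rewrite expr0 divr1 -lee_fin; apply: le_trans.
    by apply: integral_ge0 => x _; rewrite lee_fin.
  have h : cvgn (series (geometric c (2^-1 : R))).
    by apply: is_cvg_geometric_series; rewrite ger0_norm// invf_lt1// ltr1n.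
  rewrite (_ : (\sum_(n <oo) (c / 2 ^+ n)%:E)%E = (limn (series (geometric c (2^-1 : R))))%:E) ?ltry//.
  rewrite -EFin_lim//; congr (limn _); apply/funext => n /=.
  by rewrite /series/= -sumEFin; apply: eq_bigr => k _; rewrite /geometric/= exprVn.
have := integrable_ae measurableT iF; apply: filterS => x /(_ I) Fx.
have hs : cvgn [normed series (fun n => u n.+1 x - u n x)].
  apply: nondecreasing_is_cvgn.
    move=> a b ab; rewrite /series/= [leRHS](@big_cat_nat _ _ _ a)//= lerDl.
    by apply: sumr_ge0.
  exists (fine (F x)) => _ [n _ <-]; rewrite -lee_fin fineK//.
  rewrite /series/= -sumEFin; apply: nneseries_lim_ge => k _ _; by rewrite lee_fin.
have {}hs := normed_cvg hs.
have -> : u ^~ x = (fun n => u 0%N x + series (telescope (u ^~ x)) n).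
  by apply/funext => n; exact: eq_sum_telescope.
by apply: is_cvgD => //; exact: is_cvg_cst.
Qed.

End SummableLimit.

Section BoundaryFunction.
Variable R : realType.
Local Notation C := (R[i]).
Local Notation Co := (R[i]^o).
Local Notation mu := (@circle_measure R).
Variables (f : C -> C) (M : R).
Hypotheses (fd : discdiff f) (fM : forall z, normc z < 1 -> normc (f z) <= M).
Implicit Types (r s : R) (g : circle R).

Lemma cbm_ray r : 0 <= r < 1 -> cbm (fun g => f (r%:C * val g)).
Proof.
move=> r01; split; first exact: cmeas_discdiff_ray.
by have /andP[r0 r1] := r01; exists M => g; apply: fM; rewrite normc_ray.
Qed.

Definition ray_inner r s : C := Cint mu setT (fun g => f (r%:C * val g) * (f (s%:C * val g))^*).

Definition ray_energy r : R := Re (ray_inner r r).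

Lemma cdiff_conj (h : C -> C) z : cdiff h z^* -> cdiff (fun w => (h w^*)^*) z.
Proof.
move=> [q [qc hq]]; exists (fun w => (q w^*)^*); split.
  apply/ccontinuous_atP => e e0; have /ccontinuous_atP/(_ e e0)[k k0 kP] := qc.
  exists k => // w wk; rewrite -conjcB normc_conj; apply: kP.
  by rewrite -conjcB normc_conj.
by move=> w; rewrite hq conjcD conjcM conjcB !conjcK'.
Qed.

(** On the circle of radius [r] the integrand is the trace of [F z], the product of [f z] with the
    conjugate of [f] at the reflected point [c / conj z], where [c = r * s]. As [F] is analytic for
    [c < normc z < 1], its circle means do not depend on the radius. *)
Lemma ray_inner_const r s r' s' : 0 < r < 1 -> 0 < s < 1 -> 0 < r' < 1 -> 0 < s' < 1 ->
  r * s = r' * s' -> ray_inner r s = ray_inner r' s'.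
Proof.
wlog rr' : r s r' s' / r <= r' => [H|].
  move=> h1 h2 h3 h4 e; have [rr|rr] := leP r r'; first exact: H.
  by apply/esym; apply: H => //; exact: ltW.
move=> /andP[r0 r1] /andP[s0 s1] /andP[r'0 r'1] /andP[s'0 s'1] e.
pose c := r * s.
have c0 : 0 < c by rewrite mulr_gt0.
have cr : c < r by rewrite gtr_pMr.
pose F z := f z * (f ((c%:C / z)^*))^*.
have FE x y : 0 < x -> c = x * y -> circle_mean F x = ray_inner x y.
  move=> x0 cxy; apply: eq_Cint => g _; rewrite /F; congr (_ * (f _)^*).
  have xC0 : x%:C != 0 :> C by rewrite -normc_eq0 normc_real normr_eq0 gt_eqF.
  have g0 : val g != 0 by rewrite -normc_eq0 normc_circle oner_eq0.
  have E := circle_conjV g.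
  have -> : c%:C / (x%:C * val g) = y%:C * (val g)^*.
    by rewrite E cxy rmorphM/=; field; rewrite xC0 g0.
  by rewrite conjcM conjcK'; congr (_ * _); rewrite /= oppr0.
rewrite -(FE r s r0 erefl) -(FE r' s' r'0 e).
apply: (@circle_mean_const R F c 1) => //; first exact: ltW.
move=> z /andP[cz z1]; apply: cdiffM; first exact: fd.
have z0 : z != 0 by rewrite -normc_gt0 (lt_trans c0).
apply: (@cdiff_comp _ (fun z => c%:C / z) (fun y => (f y^*)^*)).
  by apply: cdiffM; [exact: cdiff_cst|exact: cdiff_inv].
apply: cdiff_conj; apply: fd.
rewrite normc_conj normcM normcV normc_real gtr0_norm// ltr_pdivrMr ?mul1r//.
exact: lt_trans cz.
Qed.

Lemma ray_energyE r : 0 <= r < 1 -> ray_energy r = \int[mu]_g (normc (f (r%:C * val g)) ^+ 2).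
Proof.
move=> r01; rewrite /ray_energy /ray_inner /Cint/=; apply: eq_Rintegral => g _.
by rewrite mulc_conj.
Qed.

Lemma ray_energy_bound r : 0 <= r < 1 -> 0 <= ray_energy r <= M ^+ 2.
Proof.
move=> r01; rewrite {1}ray_energyE//; apply/andP; split.
  by apply: Rintegral_ge0 => g _; exact: sqr_ge0.
have b := cbm_ray r01; have /andP[r0 r1] := r01.
apply: le_trans (ler_norm _) _; apply: le_trans (normc_Re _) _.
apply: normc_Cint_circle; first exact: cbm_integrable (cbmM b (cbm_conj b)).
move=> g; rewrite normcM normc_conj -expr2 lerXn2r ?nnegrE ?normc_ge0//.
  by rewrite (le_trans (normc_ge0 (f 0)))// fM// normc0.
by apply: fM; rewrite normc_ray.
Qed.

Lemma square_of_difference (A : comPzRingType) (x x' y y' : A) :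
  x * x' + y * y' - (x * y' + y * x') = (x - y) * (x' - y').
Proof. by ring. Qed.

Lemma L2_distance (F G : circle R -> C) : cbm F -> cbm G ->
  \int[mu]_g (normc (F g - G g) ^+ 2) =
  Re (Cint mu setT (fun g => F g * (F g)^*) + Cint mu setT (fun g => G g * (G g)^*) -
    (Cint mu setT (fun g => F g * (G g)^*) + Cint mu setT (fun g => G g * (F g)^*))).
Proof.
move=> bF bG.
pose proof (cbm_integrable (cbmM bF (cbm_conj bF))) as b1.
pose proof (cbm_integrable (cbmM bG (cbm_conj bG))) as b2.
pose proof (cbm_integrable (cbmM bF (cbm_conj bG))) as b3.
pose proof (cbm_integrable (cbmM bG (cbm_conj bF))) as b4.
rewrite -(CintD measurableT b1 b2) -(CintD measurableT b3 b4).
rewrite -(CintB measurableT (CintegrableD measurableT b1 b2) (CintegrableD measurableT b3 b4)).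
rewrite /Cint [RHS]/=; apply: eq_Rintegral => g _.
by rewrite square_of_difference -conjcB mulc_conj.
Qed.

(* Parallelogram identity, since [ray_inner r s] depends on [r * s] only. *)
Lemma ray_difference r s : 0 < r < 1 -> 0 < s < 1 ->
  \int[mu]_g (normc (f (r%:C * val g) - f (s%:C * val g)) ^+ 2) =
  ray_energy r + ray_energy s - 2 * ray_energy (Num.sqrt (r * s)).
Proof.
move=> r01 s01; have /andP[r0 r1] := r01; have /andP[s0 s1] := s01.
have r01' : 0 <= r < 1 by rewrite (ltW r0).
have s01' : 0 <= s < 1 by rewrite (ltW s0).
pose proof (cbm_ray r01') as br. pose proof (cbm_ray s01') as bs.
pose t := Num.sqrt (r * s).
have t0 : 0 < t by rewrite sqrtr_gt0 mulr_gt0.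
have t1 : t < 1.
  by rewrite -sqrtr1 ltr_sqrt// -[ltRHS]mulr1 ltr_pM// ltW.
have tt : t * t = r * s by rewrite -expr2 sqr_sqrtr// mulr_ge0// ltW.
have t01 : 0 < t < 1 by rewrite t0.
have E1 : ray_inner r s = ray_inner t t by apply: ray_inner_const.
have E2 : ray_inner s r = ray_inner t t by apply: ray_inner_const => //; rewrite mulrC.
transitivity (Re (ray_inner r r + ray_inner s s - (ray_inner r s + ray_inner s r))).
  exact: L2_distance br bs.
rewrite E1 E2 /ray_energy -/t.
move: (ray_inner r r) (ray_inner s s) (ray_inner t t) => [a a'] [b b'] [c c'] /=; ring.
Qed.

Lemma convex_step (e a b c : R) : 2 * b <= a + c -> e <= b - a -> e <= c - b.
Proof. lra. Qed.

(** By [ray_difference] the energy is convex as a function of [ln r]. If it dropped strictly from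
    [r] to [s], then along the geometric sequence [s * l ^+ n] towards 0 it would grow by at least
    that drop at each step, against the bound [M ^+ 2]. *)
Lemma ray_energy_mono r s : 0 < r -> r <= s -> s < 1 -> ray_energy r <= ray_energy s.
Proof.
move=> r0; rewrite le_eqVlt => /predU1P[->//|rs s1]; rewrite leNgt; apply/negP => h.
have s0 : 0 < s by exact: lt_trans rs.
pose l := r / s.
have l0 : 0 < l by rewrite divr_gt0.
have l1 : l < 1 by rewrite ltr_pdivrMr// mul1r.
pose x n := s * l ^+ n.
have x0 n : 0 < x n by rewrite mulr_gt0// exprn_gt0.
have x1 n : x n < 1.
  by rewrite (le_lt_trans _ s1)// ler_piMr ?(ltW s0)// exprn_ile1// ltW.
have x01 n : 0 < x n < 1 by rewrite x0 x1.
have conv n : 2 * ray_energy (x n.+1) <= ray_energy (x n) + ray_energy (x n.+2).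
  rewrite -subr_ge0; have -> : x n.+1 = Num.sqrt (x n * x n.+2).
    have -> : x n * x n.+2 = x n.+1 ^+ 2 by rewrite /x !exprS; ring.
    by rewrite sqrtr_sqr gtr0_norm.
  by rewrite -ray_difference//; apply: Rintegral_ge0 => g _; exact: sqr_ge0.
pose e := ray_energy r - ray_energy s.
have e0 : 0 < e by rewrite subr_gt0.
have xs0 : x 0%N = s by rewrite /x expr0 mulr1.
have xr : x 1%N = r by rewrite /x expr1 mulrC divfK// gt_eqF.
have step n : e <= ray_energy (x n.+1) - ray_energy (x n).
  elim: n => [|n ih]; first by rewrite xr xs0.
  exact: convex_step (conv n) ih.
have grow n : e * n%:R <= ray_energy (x n).
  elim: n => [|n ih].
    rewrite mulr0; have /andP[//] : 0 <= ray_energy (x 0%N) <= M ^+ 2.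
    by apply: ray_energy_bound; rewrite (ltW (x0 _)) x1.
  rewrite -natr1 mulrDr mulr1 -(subrK (ray_energy (x n)) (ray_energy (x n.+1))) addrC.
  exact: lerD (step n) ih.
pose n := (Num.truncn (M ^+ 2 / e)).+1.
have : M ^+ 2 < e * n%:R by rewrite mulrC -ltr_pdivrMr// truncnS_gt.
apply/negP; rewrite -leNgt (le_trans (grow n))//.
have /andP[_ //] : 0 <= ray_energy (x n) <= M ^+ 2.
by apply: ray_energy_bound; rewrite (ltW (x0 n)) x1.
Qed.

Lemma energy_gap (A B L q e t : R) : A <= L -> B <= L -> L - q < e -> e <= t ->
  A + B - 2 * t <= 2 * q.
Proof. lra. Qed.

(** The energy is bounded and nondecreasing; once two radii and their geometric mean have energies
    close to the supremum, [ray_difference] makes the two traces close in mean square. *)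
Lemma ray_cauchy_sequence : exists r : nat -> R,
  [/\ forall n, 0 < r n < 1, r n @[n --> \oo] --> (1 : R) &
  forall n, \int[mu]_g (normc (f ((r n.+1)%:C * val g) - f ((r n)%:C * val g)) ^+ 2) <= 2 / 4 ^+ n].
Proof.
pose D := [set ray_energy r | r in [set r : R | 0 < r < 1]].
have h2 : 0 < (2^-1 : R) < 1 by rewrite invr_gt0 ltr0n/= invf_lt1// ltr1n.
have hsD : has_sup D.
  split; first by exists (ray_energy 2^-1), 2^-1.
  exists (M ^+ 2) => _ [r /andP[r0 r1] <-].
  have /andP[_ //] : 0 <= ray_energy r <= M ^+ 2.
  by apply: ray_energy_bound; rewrite (ltW r0) r1.
have /choice[S hS] : forall n : nat, exists r, [/\ 0 < r < 1, sup D - (4 ^+ n)^-1 < ray_energy r &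
    1 - n.+2%:R^-1 <= r].
  move=> n; have e0 : 0 < (4 ^+ n : R)^-1 by rewrite invr_gt0 exprn_gt0.
  have [_ [r /andP[r0 r1] <-] hr] := sup_adherent e0 hsD.
  pose r' := Num.max r (1 - n.+2%:R^-1).
  have n2 : (n.+2%:R^-1 : R) < 1 by rewrite invf_lt1// ltr1n.
  have r'1 : r' < 1 by rewrite gt_max r1/= gtrBl invr_gt0.
  exists r'; split.
  - by rewrite r'1 lt_max r0.
  - by rewrite (lt_le_trans hr)// ray_energy_mono// le_max lexx.
  - by rewrite le_max lexx orbT.
(* Running maxima make the radii increase, so the geometric mean of two consecutive ones is still at
   least [S n] and its energy is as close to the supremum. *)
pose r := fix r n := if n is k.+1 then Num.max (r k) (S k.+1) else S 0%N.
have rS n : S n <= r n by case: n => [|n] //=; rewrite le_max lexx orbT.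
have r01 n : 0 < r n < 1.
  elim: n => [|n /andP[r0 r1]] /=; first by have [] := hS 0%N.
  by have [/andP[S0 S1] _ _] := hS n.+1; rewrite lt_max r0/= gt_max r1 S1.
have rmono n : r n <= r n.+1 by rewrite /= le_max lexx.
exists r; split => //.
  have hn := @cvg_harmonic R.
  have lo : (1 - (n.+2%:R^-1 : R)) @[n --> \oo] --> (1 : R).
    rewrite -[X in _ --> X]subr0; apply: cvgB; first exact: cvg_cst.
    by have := hn; rewrite -(cvg_shiftS (@harmonic R)).
  have nr : \forall n \near \oo, 1 - (n.+2%:R^-1 : R) <= r n <= 1.
    apply: nearW => n; have [_ _ h] := hS n; rewrite (le_trans h)//=.
    by have /andP[_ /ltW] := r01 n.
  exact: (squeeze_cvgr nr lo (cvg_cst _)).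
move=> n; rewrite ray_difference//.
have [/andP[S0 S1] hSn _] := hS n.
have b k : ray_energy (r k) <= sup D.
  by apply: sup_upper_bound => //; exists (r k) => //; exact: r01.
have /andP[rn0 rn1] := r01 n; have /andP[rn0' rn1'] := r01 n.+1.
set t := Num.sqrt _.
have t1 : t < 1.
  by rewrite -sqrtr1 ltr_sqrt// -[ltRHS]mulr1 ltr_pM// ltW.
have St : S n <= t.
  rewrite (le_trans (rS n))// -[leLHS]gtr0_norm// -sqrtr_sqr ler_sqrt.
    by rewrite expr2 ler_wpM2r// ltW.
  by rewrite mulr_ge0// ltW.
have ht := ray_energy_mono S0 St t1.
exact: energy_gap (b _) (b _) hSn ht.
Qed.

Lemma boundary_function : exists V : circle R -> C, cbm V /\
  forall a, normc a < 1 -> Cint mu setT (fun g => V g * (poisson_kernel a g)%:C) = f a.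
Proof.
destruct (ray_cauchy_sequence) as [r [r01 rcv rd]].
have r01' n : 0 <= r n < 1 by have /andP[h1 h2] := r01 n; rewrite (ltW h1).
pose h n g := f ((r n)%:C * val g).
have bh n : cbm (h n) by exact: cbm_ray.
have hM n g : normc (h n g) <= M.
  by have /andP[r0 r1] := r01' n; apply: fM; rewrite normc_ray.
(* Trades the mean-square decay [2 / 4 ^+ n] for the decay [3 / 2 ^+ n] of the integrals of absolute
   values, which is summable. *)
have amgm n (x : R) : `|x| <= 2 ^+ n * x ^+ 2 + (2 ^+ n)^-1.
  have p0 : 0 < (2 ^+ n : R) by rewrite exprn_gt0.
  have q0 : 0 < (2 ^+ n : R)^-1 by rewrite invr_gt0.
  have pq : 2 ^+ n * (2 ^+ n)^-1 = 1 :> R by rewrite mulfV// gt_eqF.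
  rewrite -[x ^+ 2]real_normK ?num_real//.
  have := sqr_ge0 (2 ^+ n * `|x| - 1); have := normr_ge0 x.
  set y := `|x|; set p := 2 ^+ n in p0 q0 pq *; set q := p^-1 in q0 pq * => y0 hsq.
  have : q * ((p * y - 1) ^+ 2) = p * y ^+ 2 - 2 * y + q.
    have : q * ((p * y - 1) ^+ 2) = (p * q) * (p * y ^+ 2) - 2 * y * (p * q) + q by ring.
    by rewrite pq mul1r mulr1.
  have := mulr_ge0 (ltW q0) hsq; lra.
have key (pr : C -> R) : (forall z w : C, pr (z - w) = pr z - pr w) -> (forall z, `|pr z| <= normc z) ->
   (forall n, measurable_fun setT (fun g => pr (h n g))) ->
   {ae mu, forall g, cvgn (fun n => pr (h n g))}.
  move=> prB prn mpr; apply: (@ae_cvg_of_summable_differences _ _ _ mu (fun n g => pr (h n g)) 3) => // n.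
  have bd := cbmB (bh n.+1) (bh n).
  have mB := measurable_funB (mpr n.+1) (mpr n).
  have isq : mu.-integrable setT (EFin \o (fun g => normc (h n.+1 g - h n g) ^+ 2)).
    have [i1 _] := cbm_integrable (cbmM bd (cbm_conj bd)).
    by apply: eq_integrable i1 => // g _ /=; rewrite mulc_conj.
  have p0 : 0 < (2 ^+ n : R) by rewrite exprn_gt0.
  pose G g := 2 ^+ n * normc (h n.+1 g - h n g) ^+ 2 + (2 ^+ n)^-1.
  have i2 : mu.-integrable setT (EFin \o (fun g => 2 ^+ n * normc (h n.+1 g - h n g) ^+ 2)).
    exact: integrable_EFinZl measurableT isq.
  have iG : mu.-integrable setT (EFin \o G).
    exact: integrable_EFinD measurableT i2 (circle_cst_integrable _).
  apply: (@le_trans _ _ (\int[mu]_g (G g)%:E)%E).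
    apply: ge0_le_integral.
    - exact: measurableT.
    - by move=> g _; rewrite lee_fin.
    - by apply/measurable_EFinP; exact: (measurableT_comp (@normr_measurable R setT) mB).
    - exact: (measurable_int mu iG).
    - move=> g _; rewrite lee_fin -prB (le_trans (prn _))//.
      by rewrite (le_trans (ler_norm _))// amgm.
  have -> : (\int[mu]_g (G g)%:E)%E = (\int[mu]_g G g)%:E.
    by rewrite /Rintegral fineK//; exact: integrable_fin_num iG.
  rewrite lee_fin /G RintegralD//; last exact: circle_cst_integrable.
  rewrite circle_Rint_cst RintegralZl//.
  have := rd n; set I := \int[mu]_g _ => hI.
  have h4 : 2 ^+ n * (2 / 4 ^+ n) = 2 / 2 ^+ n :> R.
    have -> : 4 = 2 * 2 :> R by rewrite -natrM.
    by rewrite exprMn; field; rewrite gt_eqF.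
  have : 2 ^+ n * I <= 2 ^+ n * (2 / 4 ^+ n) by rewrite ler_wpM2l// ltW.
  rewrite h4 => hh; apply: le_trans (lerD hh (lexx _)) _.
  by rewrite -[X in _ + X]mul1r -mulrDl (_ : 2 + 1 = 3)//; ring.
have mRe n : measurable_fun setT (fun g => Re (h n g)) by have [[]] := bh n.
have mIm n : measurable_fun setT (fun g => Im (h n g)) by have [[]] := bh n.
have cRe : {ae mu, forall g, cvgn (fun n => Re (h n g))}.
  by apply: key => //; [move=> z w; rewrite cReD cReN|exact: normc_Re].
have cIm : {ae mu, forall g, cvgn (fun n => Im (h n g))}.
  by apply: key => //; [move=> z w; rewrite cImD cImN|exact: normc_Im].
(* Upper limits are defined, bounded and measurable everywhere, and agree with the limit wherever
   there is one. *)
pose V g := (limn_sup (fun n => Re (h n g))) +i* (limn_sup (fun n => Im (h n g))).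
have bRe n g : `|Re (h n g)| <= M by exact: le_trans (normc_Re _) (hM n g).
have bIm n g : `|Im (h n g)| <= M by exact: le_trans (normc_Im _) (hM n g).
have mlim (u : nat -> circle R -> R) : (forall n, measurable_fun setT (u n)) -> (forall n g, `|u n g| <= M) ->
    measurable_fun setT (fun g => limn_sup (u ^~ g)).
  move=> mu_ uM; apply: measurable_fun_limn_sup => // g _.
    by exists M => _ [n _ <-]; exact: le_trans (ler_norm _) (uM n g).
  by exists (- M) => _ [n _ <-]; have := uM n g; rewrite ler_norml => /andP[].
have bV : cbm V.
  split; first by split; [exact: (mlim (fun n g => Re (h n g)))|exact: (mlim (fun n g => Im (h n g)))].
  exists (M + M) => g; rewrite (le_trans (normc_le_ReIm _))//= lerD//.
    exact: limn_sup_bounded (bRe^~ g).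
  exact: limn_sup_bounded (bIm^~ g).
have hV : {ae mu, forall g, ccvg \oo (h ^~ g) (V g)}.
  apply: filterS2 cRe cIm => g c1 c2; apply: cvg_Complex => /=.
    by rewrite cvg_limn_supE.
  by rewrite cvg_limn_supE.
exists V; split => // a a1.
have bp := cbm_poisson_kernel a1.
have [_ [K hK]] := bp.
have lim1 : ccvg \oo (fun n => Cint mu setT (fun g => h n g * (poisson_kernel a g)%:C))
   (Cint mu setT (fun g => V g * (poisson_kernel a g)%:C)).
  apply: (@Cint_circle_cvg _ _ _ (M * K)).
  - by move=> n; case: (cbmM (bh n) bp).
  - by case: (cbmM bV bp).
  - by move=> n g; rewrite normcM; apply: ler_pM => //; exact: normc_ge0.
  - by apply: filterS hV => g hg; apply: ccvgM hg (ccvg_cst _).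
apply: (ccvg_unique lim1).
have fa : ccontinuous_at f a by apply: cdiff_continuous; exact: fd.
have ra : ccvg \oo (fun n => (r n)%:C * a) a.
  rewrite -[X in ccvg _ _ X]mul1r; apply: ccvgM; [exact: (cvg_realC rcv)|exact: ccvg_cst].
have : ccvg \oo (fun n => f ((r n)%:C * a)) (f a).
  rewrite ccvgE; rewrite ccvgE in ra; rewrite /ccontinuous_at ccvgE in fa.
  exact: (cvg_comp _ _ ra fa).
by apply: eq_ccvg => n; rewrite -(poisson_formula fd fM).
Qed.

End BoundaryFunction.

(** * Null sets and completeness of the circle measure *)

Section LebesgueNull.
Variable R : realType.
Local Notation mu := (@circle_measure R).
Local Notation param := (@circle_param R).
Local Notation lambda := (@lebesgue_measure R).
Local Notation clambda := (@completed_lebesgue_measure R).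
Local Notation lebesgueR := (caratheodory_type (@wlength R idfun)^*%mu).

Lemma lebesgue_null_translate (k : R) (N : set (measurableTypeR R)) :
  measurable N -> lambda N = 0%E -> lambda [set t | N (t + k)] = 0%E.
Proof.
move=> mN N0.
have mk : measurable_fun setT ((fun t => t + k) : measurableTypeR R -> measurableTypeR R).
  apply: continuous_measurable_fun => x.
  by apply: cvgD; [exact: cvg_id|exact: cvg_cst].
have key (A : set (measurableTypeR R)) : measurable A ->
    lambda A = pushforward lambda ((fun t => t + k) : measurableTypeR R -> measurableTypeR R) A.
  move=> mA; apply: lebesgue_measure_unique => // _ [[a b] _ <-].
  rewrite /= /pushforward.
  have -> : (fun t => t + k) @^-1` `]a, b]%classic = `]a - k, b - k]%classic.
    by apply/seteqP; split => t /=; rewrite !in_itv/= ltrBlDr lerBrDr.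
  rewrite !lebesgue_measure_itv/= !lte_fin ltrD2r; case: ifP => // _.
  by rewrite -!EFinB; congr (_%:E); ring.
exact: (etrans (esym (key N mN)) N0).
Qed.

Lemma param_nat (t : R) (n : nat) : param (t + n%:R) = param t.
Proof.
have step s : param (s + 1) = param s.
  apply: val_inj => /=; rewrite mulrDr mulr1.
  have -> : 2 * pi = pi *+ 2 :> R by rewrite mulr_natl.
  by rewrite cosD2pi sinD2pi.
elim: n => [|n ih]; first by rewrite addr0.
by rewrite -natr1 addrA step.
Qed.

(** Measurability on the circle is tested on the whole preimage in the line, not on [[0, 1[] alone.
    This preimage is covered by the integer translates of [N], and completeness of the Lebesgue
    sigma-algebra does the rest. *)
Lemma circle_null (A : set (circle R)) (N : set (measurableTypeR R)) :
  measurable N -> lambda N = 0%E ->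
  (forall t, 0 <= t < 1 -> A (param t) -> N t) -> measurable A /\ mu A = 0%E.
Proof.
move=> mN N0 NP.
pose F : set R := \bigcup_(k in [set: nat]) ([set t | N (t + k%:R)] `|` [set t | N (t - k%:R)]).
have sub : param @^-1` A `<=` F.
  move=> t /= At; pose m := Num.floor t.
  have t01 : 0 <= t - m%:~R < 1.
    have := floor_itv t; rewrite -/m intrD1 subr_ge0 ltrBlDl => /andP[-> h]; lra.
  have pt : param (t - m%:~R) = param t.
    case: m {t01} => n; first by rewrite -(param_nat (t - _) n) subrK.
    by rewrite NegzE mulrNz opprK param_nat.
  have Nt : N (t - m%:~R).
    by apply: NP => //; rewrite pt.
  exists `|m|%N => //; case: m Nt {t01 pt} => n /= Nt; first by right.
  by left; move: Nt; rewrite NegzE mulrNz opprK.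
have mF : measurable (F : set (measurableTypeR R)).
  have mt (k : R) : measurable ([set t | N (t + k)] : set (measurableTypeR R)).
    have mk : measurable_fun setT ((fun t => t + k) : measurableTypeR R -> measurableTypeR R).
      apply: continuous_measurable_fun => x.
      by apply: cvgD; [exact: cvg_id|exact: cvg_cst].
    by have := mk measurableT _ mN; rewrite setTI.
  apply: bigcup_measurable => k _; apply: measurableU; exact: mt.
have F0 : lambda F = 0%E.
  apply/eqP; rewrite eq_le measure_ge0 andbT.
  have [B [mB B0 FB]] : lambda.-negligible F.
    apply: negligible_bigcup => k; apply: negligibleU.
      exists [set t | N (t + k%:R)]; split => //; last exact: lebesgue_null_translate.
      have mk : measurable_fun setT ((fun t => t + k%:R) : measurableTypeR R -> measurableTypeR R).
        apply: continuous_measurable_fun => x.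
        by apply: cvgD; [exact: cvg_id|exact: cvg_cst].
      by have := mk measurableT _ mN; rewrite setTI.
    exists [set t | N (t - k%:R)]; split => //; last exact: lebesgue_null_translate.
    have mk : measurable_fun setT ((fun t => t - k%:R) : measurableTypeR R -> measurableTypeR R).
      apply: continuous_measurable_fun => x.
      by apply: cvgD; [exact: cvg_id|exact: cvg_cst].
    by have := mk measurableT _ mN; rewrite setTI.
  by rewrite -B0; apply: le_measure => //; rewrite inE.
have cF0 : clambda F = 0%E := F0.
have neg : clambda.-negligible (param @^-1` A).
  by exists F; split => //; exact: sub_caratheodory.
split; first by have := negligible_sub_caratheodory neg; rewrite -[X in measurable X]setTI.
apply/eqP; rewrite eq_le measure_ge0 andbT -cF0 /circle_measure /pushforward /mrestr.
apply: le_measure; rewrite ?inE//.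
- by apply: measurableI; [exact: negligible_sub_caratheodory neg|exact: measurable_fundamental_arc].
- exact: sub_caratheodory.
- by move=> t [/sub].
Qed.

Lemma circle_ae (P : circle R -> Prop) (N : set (measurableTypeR R)) :
  measurable N -> lambda N = 0%E ->
  (forall t, 0 <= t < 1 -> ~ N t -> P (param t)) -> {ae mu, forall g, P g}.
Proof.
move=> mN N0 NP; have [mA A0] : measurable (~` [set g | P g]) /\ mu (~` [set g | P g]) = 0%E.
  apply: (circle_null mN N0) => t t01 nP; apply: contrapT => nN; apply: nP; exact: NP.
by exists (~` [set g | P g]); split.
Qed.

Lemma borel_hull_null (B : set R) : measurable (B : set lebesgueR) -> clambda B = 0%E ->
  exists N : set (measurableTypeR R), [/\ measurable N, lambda N = 0%E & B `<=` N].
Proof.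
move=> mB B0; have : (completed_algebra_gen lambda) B.
  by rewrite -g_sigma_completed_algebra_genE completed_caratheodory_measurable.
move=> [X mX [N0 [N [mN NN0 NN]] E]].
exists (X `|` N); split.
- exact: measurableU.
- apply: null_set_setU => //; apply/eqP; rewrite eq_le measure_ge0 andbT -B0.
  change (clambda X <= clambda B)%E.
  by apply: le_measure; rewrite ?inE//; [exact: sub_caratheodory|rewrite -E; left].
- by rewrite -E => t [Xt|/NN]; [left|right].
Qed.

Lemma circle_complete (A B : set (circle R)) : measurable B -> mu B = 0%E -> A `<=` B ->
  measurable A /\ mu A = 0%E.
Proof.
move=> mB B0 AB.
have mp : measurable ((param @^-1` B `&` `[0%R, 1%R[%classic) : set lebesgueR).
  apply: measurableI; last exact: measurable_fundamental_arc.
  by have := @measurable_circle_param R measurableT B mB; rewrite setTI.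
have [N [mN N0 sub]] := borel_hull_null mp B0.
apply: (circle_null mN N0) => t t01 At; apply: sub; split; first exact: AB.
by rewrite /= in_itv.
Qed.

Lemma measurable_ae_eq d (T : measurableType d) (V W : circle R -> T) : measurable_fun setT V ->
  {ae mu, forall g, V g = W g} -> measurable_fun setT W.
Proof.
move=> mV [N [mN N0 sub]] _ Y mY; rewrite setTI.
have -> : W @^-1` Y = ((V @^-1` Y) `\` N) `|` ((W @^-1` Y) `&` N).
  apply/seteqP; split => g /=.
    have [Ng|Ng] := pselect (N g); first by right.
    by left; split => //; have -> : V g = W g by apply: contrapT => h; apply: Ng; exact: sub.
  move=> [[Vg Ng]|[]//]; have <- : V g = W g by apply: contrapT => h; apply: Ng; exact: sub.
  by [].
apply: measurableU.
  by apply: measurableD => //; have := mV measurableT Y mY; rewrite setTI.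
by have [] := @circle_complete ((W @^-1` Y) `&` N) N mN N0 (@subIsetr _ _ _).
Qed.

(** The differentiation theorem is applied to a Borel function, whereas functions on the circle are
    measurable for the completed sigma-algebra. Each sublevel set at a rational level is Borel up to
    a null set, and [N] collects these countably many null sets. *)
Lemma borel_representative (u : lebesgueR -> R) : measurable_fun setT u ->
  exists N (v : measurableTypeR R -> R), [/\ measurable N, lambda N = 0%E,
    measurable_fun setT v, forall t, ~ N t -> v t = u t & forall t, N t -> v t = 0].
Proof.
move=> mu_.
have /choice[BN hBN] : forall q : rat, exists BN : set (measurableTypeR R) * set (measurableTypeR R),
   [/\ measurable BN.1, measurable BN.2, lambda BN.2 = 0%E &
     forall t, ~ BN.2 t -> (u t < ratr q <-> BN.1 t)].
  move=> q.
  have : measurable (u @^-1` `]-oo, ratr q[%classic : set lebesgueR).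
    by rewrite -[X in measurable X]setTI; apply: mu_ => //; exact: measurable_itv.
  have -> : measurable (u @^-1` `]-oo, ratr q[%classic : set lebesgueR) =
     (completed_algebra_gen lambda) (u @^-1` `]-oo, ratr q[%classic).
    by rewrite -g_sigma_completed_algebra_genE completed_caratheodory_measurable.
  move=> [B mB [N0 [N [mN N0' NN]] E]].
  exists (B, N); split => //= t nNt.
  have -> : is_true (u t < ratr q) = (u @^-1` `]-oo, ratr q[%classic) t by rewrite /= in_itv.
  rewrite -E; split; last by left.
  by move=> [//|/NN].
pose N : set (measurableTypeR R) := \bigcup_(q in [set: rat]) (BN q).2.
have mN : measurable N.
  by apply: bigcupT_measurable_rat => q; have [] := hBN q.
have N0 : lambda N = 0%E.
  apply/eqP; rewrite eq_le measure_ge0 andbT.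
  have [B [mB B0 FB]] : lambda.-negligible N.
    have -> : N = \bigcup_n (if unpickle n is Some q then (BN q).2 else set0).
      apply/seteqP; split => [t [q _ Nq]|t [n _]].
        exists (pickle q); first by [].
        by rewrite pickleK.
      by case: (unpickle n) => // q Nq; exists q.
    apply: negligible_bigcup => n; case: unpickle => [q|]; last exact: negligible_set0.
    by have [m1 m2 m3 _] := hBN q; exists (BN q).2; split.
  by rewrite -B0; apply: le_measure => //; rewrite inE.
pose v t := if pselect (N t) then 0 else u t.
exists N, v; split => //; last 2 first.
- by move=> t nN; rewrite /v; case: pselect.
- by move=> t Nt; rewrite /v; case: pselect.
apply: (measurability _ (RGenInftyO.measurableE R)) => _ [_ [x ->] <-].
rewrite setTI.
have -> : v @^-1` `]-oo, x[%classic =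
  \bigcup_(q in [set q : rat | ratr q < x]) ((BN q).1 `\` N) `|` (N `&` [set t | 0 < x]).
  apply/seteqP; split => t /=.
    rewrite in_itv/= /v; case: pselect => [Nt|nN] vx; first by right.
    left; have [q] := rat_in_itvoo vx; rewrite in_itv/= => /andP[uq qx].
    exists q => //; split => //; have [_ _ _ h] := hBN q.
    by apply/h => // Nq; apply: (nN); exists q.
  rewrite in_itv/= /v; case: pselect => [Nt|nN].
    by move=> [[q _ [_ /(_ Nt)]]|[]].
  move=> [[q /= qx [Bt _]]|[]//].
  have [_ _ _ h] := hBN q.
  by apply: lt_trans qx; apply/h => // Nq; apply: (nN); exists q.
apply: measurableU.
  rewrite bigcup_mkcond; apply: bigcupT_measurable_rat => q; case: ifP => // _.
  by apply: measurableD => //; have [] := hBN q.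
apply: measurableI => //.
have [x0|x0] := ltP 0 x.
  by rewrite (_ : [set _ | _] = setT)//; apply/seteqP; split.
by rewrite (_ : [set _ | _] = set0)//; apply/seteqP; split => // t /=; rewrite ltNge x0.
Qed.

End LebesgueNull.

(** * Lebesgue points on the circle *)

Section CircleLebesguePoint.
Variable R : realType.
Local Notation C := (R[i]).
Local Notation mu := (@circle_measure R).
Local Notation param := (@circle_param R).
Local Notation lambda := (@lebesgue_measure R).
Local Notation clambda := (@completed_lebesgue_measure R).
Local Notation lebesgueR := (caratheodory_type (@wlength R idfun)^*%mu).

Lemma chord_param (t s : R) : normc (val (param t) - val (param s)) = 2 * `|sin (pi * (t - s))|.
Proof.
apply/eqP; rewrite -(@eqrXn2 _ 2) ?normc_ge0 ?mulr_ge0//.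
rewrite normc_sqr cReD cImD cReN cImN /= exprMn real_normK ?num_real//.
set a := 2 * pi * t; set b := 2 * pi * s.
have -> : pi * (t - s) = (a - b) / 2 by rewrite /a /b; field.
have E : cos (a - b) = 1 - 2 * sin ((a - b) / 2) ^+ 2.
  have -> : cos (a - b) = cos (((a - b) / 2) *+ 2) by congr cos; rewrite -mulr_natr divfK.
  by rewrite cos_mulr2n cos2sin2; ring.
rewrite cosB in E.
have := cos2Dsin2 a; have := cos2Dsin2 b; move: E.
set ca := cos a; set sa := sin a; set cb := cos b; set sb := sin b; set x := sin _.
move=> E h1 h2.
have -> : (ca - cb) ^+ 2 + (sa - sb) ^+ 2 =
  (ca ^+ 2 + sa ^+ 2) + (cb ^+ 2 + sb ^+ 2) - 2 * (ca * cb + sa * sb) by ring.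
by rewrite h1 h2 E; apply/eqP; ring.
Qed.

Lemma sin_lower_bound (m x : R) : 0 < m -> m <= 2^-1 -> m <= x <= 1 - m ->
  sin (pi * m) <= sin (pi * x).
Proof.
move=> m0 m2 /andP[mx xm]; have p0 := pi_gt0 R.
have key y : m <= y <= 2^-1 -> sin (pi * m) <= sin (pi * y).
  move=> /andP[my y2]; have := @ltr_sin R (pi * y) (pi * m).
  rewrite !in_itv/= => h; rewrite leNgt h ?ltr_pM2l// -?leNgt//; apply/andP; split; nra.
have [x2|x2] := leP x 2^-1; first by apply: key; rewrite mx.
have -> : sin (pi * x) = sin (pi * (1 - x)).
  have -> : pi * (1 - x) = - (pi * x) + pi by ring.
  by rewrite sinDpi sinN opprK.
by apply: key; apply/andP; split; lra.
Qed.

(** Close points of the circle may have parameters near opposite ends of [[0, 1[]. An interior [t0]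
    and a small [eta] exclude this; then [|y| <= 2 |sin y|] for small [y] compares the parameters
    with the chord. *)
Lemma chord_local (t0 : R) : 0 < t0 < 1 -> exists2 eta, 0 < eta &
  forall t : R, 0 <= t < 1 -> normc (val (param t) - val (param t0)) < eta ->
    `|t - t0| <= normc (val (param t) - val (param t0)).
Proof.
move=> /andP[t00 t01]; have p0 := pi_gt0 R.
destruct (is_derive_caratheodory (is_derive_sin (0 : R))) as [p [pc p1 pE]].
rewrite cos0 in pc p1.
have h2 : 0 < (2^-1 : R) by rewrite invr_gt0.
move/cvgrPdist_lt : pc => /(_ 2^-1 h2) /nbhs_ballP[d d0 dP].
have {}d0 : 0 < d := d0.
have sinb y : `|y| < d -> `|y| <= 2 * `|sin y|.
  move=> yd; have := dP y; rewrite /ball/= sub0r normrN => /(_ yd) h.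
  have := pE y; rewrite sin0 add0r subr0 => ->.
  rewrite normrM mulrA -[leLHS]mul1r ler_wpM2r//.
  have : 1 <= `|1 - p y| + `|p y|.
    by rewrite -[leLHS](@normr1 R) -[X in `|X| <= _](subrK (p y)) ler_normD.
  have : (2^-1 : R) + 2^-1 = 1 by field.
  move: h; set u := `|1 - p y|; lra.
(* Since [m <= t0] and [m <= 1 - t0], the difference of parameters is at most [1 - m], so parameters
   at distance at least [m] have a chord of at least [2 * sin (pi * m)]; the term [d / (2 * pi)]
   brings [pi * m] below [d]. *)
pose m := Num.min (Num.min t0 (1 - t0)) (Num.min (d / (2 * pi)) 2^-1).
have m0 : 0 < m by rewrite !lt_min t00 subr_gt0 t01 h2 divr_gt0// mulr_gt0.
have m1 : m <= t0 by rewrite /m !ge_min lexx.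
have m2 : m <= 1 - t0 by rewrite /m !ge_min lexx orbT.
have m3 : m <= d / (2 * pi) by rewrite /m !ge_min lexx !orbT.
have m4 : m <= 2^-1 by rewrite /m !ge_min lexx !orbT.
have pm : pi * m <= pi / 2 by rewrite ler_pM2l.
exists (2 * sin (pi * m)).
  rewrite mulr_gt0//; apply: sin_gt0_pi; rewrite mulr_gt0//=.
  by rewrite (le_lt_trans pm)// ltr_pdivrMr// ltr_pMr// ltr1n.
move=> t /andP[t0' t1']. rewrite chord_param ltr_pM2l// => hs.
have tm : `|t - t0| < m.
  rewrite ltNge; apply/negP => mt; move: hs; rewrite ltNge => /negP; apply.
  have -> : `|sin (pi * (t - t0))| = `|sin (pi * `|t - t0|)|.
    have [h|h] := lerP 0 (t - t0); first by rewrite (ger0_norm h).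
    by rewrite (ltr0_norm h) mulrN sinN normrN.
  rewrite (le_trans _ (ler_norm _))//; apply: sin_lower_bound => //.
  rewrite mt/=; rewrite ler_norml; apply/andP; split; lra.
have xd : `|pi * (t - t0)| < d.
  rewrite normrM gtr0_norm//.
  have : pi * `|t - t0| < pi * m by rewrite (ltr_pM2l p0).
  by move: m3; rewrite ler_pdivlMr ?mulr_gt0// => h1 h3; nra.
apply: le_trans (sinb _ xd); rewrite normrM gtr0_norm//.
by rewrite ler_peMl// (le_trans _ (pi_ge2 R))// ler1n.
Qed.

Definition circle_arc (g0 : circle R) (s : R) : set (circle R) := [set g | normc (val g - val g0) < s].

Lemma measurable_chord (g0 : circle R) : measurable_fun setT (fun g : circle R => normc (val g - val g0)).
Proof. exact: measurable_normc (cmeasB (@cmeas_val R) (cmeas_cst _ _)). Qed.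

Lemma measurable_circle_arc g0 s : measurable (circle_arc g0 s).
Proof.
have := @measurable_chord g0 measurableT `]-oo, s[%classic (measurable_itv _).
rewrite setTI; congr measurable; apply/seteqP; split => g /=; by rewrite in_itv/=.
Qed.

(** Arcs are given by chord length, which for small arcs is comparable to their measure, so [e * s]
    plays the role of [e] times the measure of the arc. *)
Definition lebesgue_point (u : circle R -> R) g0 := forall e : R, 0 < e -> exists2 eta : R, 0 < eta &
  forall s : R, 0 < s -> s <= eta -> \int[mu]_g (\1_(circle_arc g0 s) g * `|u g - u g0|) <= e * s.

Lemma circle_lebesgue_points (u : circle R -> R) (M : R) : measurable_fun setT u -> (forall g, `|u g| <= M) ->
  {ae mu, forall g0, lebesgue_point u g0}.
Proof.
move=> mu_ uM.
have [N [v [mN N0 mv vE vN]]] := borel_representative (measurable_circle_comp mu_).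
have M0 : 0 <= M by exact: le_trans (normr_ge0 _) (uM (circle1 R)).
have vM t : `|v t| <= M.
  by have [Nt|Nt] := pselect (N t); [rewrite vN// normr0|rewrite vE//; exact: uM].
have loc : locally_integrable setT v.
  split => //; first exact: openT.
  move=> K _ cK; have mK := compact_measurable cK.
  apply: (@le_lt_trans _ _ (\int[lambda]_(x in K) M%:E)%E).
    apply: ge0_le_integral.
    - exact: mK.
    - by move=> x _; rewrite lee_fin.
    - apply/measurable_EFinP; apply: (measurableT_comp (@normr_measurable R setT)).
      exact: measurable_funTS.
    - exact: measurable_cst.
    - by move=> x _; rewrite lee_fin.
  rewrite integral_cst//; apply: lte_mul_pinfty => //.
  exact: compact_finite_measure.
have [N2 [mN2 N20 hN2]] := lebesgue_differentiation loc.
(* The parameter 0 is discarded as well, since [chord_local] asks for [0 < t0]. *)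
pose N3 : set (measurableTypeR R) := N `|` N2 `|` [set 0].
have mN3 : measurable N3 by apply: measurableU => //; exact: measurableU.
have N30 : lambda N3 = 0%E.
  have mNN : measurable (N `|` N2) by exact: measurableU.
  apply: (null_set_setU mNN (measurable_set1 0)); last exact: lebesgue_measure_set1.
  exact: null_set_setU.
apply: (circle_ae mN3 N30) => t0 /andP[t0ge t0lt] nN3.
have nN : ~ N t0 by move=> h; apply: nN3; left; left.
have lpt : lebesgue_pt v t0 by apply: contrapT => h; apply: nN3; left; right; exact: hN2.
have t00 : 0 < t0.
  by rewrite lt_neqAle t0ge andbT; apply/eqP => h; apply: nN3; right; rewrite /= -h.
destruct (chord_local (introT andP (conj t00 t0lt))) as [eta1 eta10 chord].
have vt0 : v t0 = u (param t0) by rewrite vE.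
move=> e e0.
(* Half of [e], because the ball of radius [s] in the line has length [2 * s]. *)
have e2 : (0 < (e / 2)%:E)%E by rewrite lte_fin divr_gt0.
have [eta2 eta20 dav] : exists2 d, 0 < d & forall r, 0 < r -> r <= d -> (davg v t0 r <= (e / 2)%:E)%E.
  have : \forall r \near (0:R)^'+, (davg v t0 r < (e / 2)%:E)%E.
    by apply: (lpt [set x | (x < (e / 2)%:E)%E]); exact: lt_nbhsl.
  rewrite near_withinE => /nbhs_ballP[d /= d0 dP]; exists (d / 2); first by rewrite divr_gt0.
  move=> r r0 rd; apply: ltW; apply: dP => //=.
  by rewrite /ball/= sub0r normrN gtr0_norm// (le_lt_trans rd)// ltr_pdivrMr// ltr_pMr// ltr1n.
exists (Num.min eta1 eta2); first by rewrite lt_min eta10.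
move=> s s0; rewrite le_min => /andP[s1 s2].
pose w (x : R) g := \1_(circle_arc (param t0) s) g * `|x - u (param t0)|.
pose F g := \1_(circle_arc (param t0) s) g * `|u g - u (param t0)|.
have mF : measurable_fun setT F.
  apply: measurable_funM; first exact/measurable_indic/measurable_circle_arc.
  apply: (measurableT_comp (@normr_measurable R setT)).
  by apply: measurable_funB => //; exact: measurable_cst.
have F0 g : 0 <= F g by rewrite mulr_ge0.
rewrite -[leLHS]/(fine (\int[mu]_g (F g)%:E)%E) -[leRHS]/(fine (e * s)%:E).
suff h : (\int[mu]_g (F g)%:E <= (e * s)%:E)%E.
  rewrite fine_le//; rewrite ge0_fin_numE ?(le_lt_trans h) ?ltry//.
  by apply: integral_ge0 => g _; rewrite lee_fin.
rewrite ge0_circle_integral; [|exact/measurable_EFinP|by move=> g; rewrite lee_fin].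
pose G (t : R) : \bar R := (\1_(ball t0 s) t * `|v t - v t0|)%:E.
have mG : measurable_fun setT (G : measurableTypeR R -> \bar R).
  apply/measurable_EFinP; apply: measurable_funM.
    by apply: measurable_indic; exact: measurable_ball.
  apply: (measurableT_comp (@normr_measurable R setT)).
  by apply: measurable_funB => //; exact: measurable_cst.
have G0 t : (0 <= G t)%E by rewrite lee_fin mulr_ge0.
pose F' (t : R) : \bar R := (\1_(circle_arc (param t0) s) (param t) * `|v t - v t0|)%:E.
have F'0 t : (0 <= F' t)%E by rewrite lee_fin mulr_ge0.
have mF' : measurable_fun setT (F' : lebesgueR -> \bar R).
  apply/measurable_EFinP; apply: measurable_funM.
    apply: (measurable_circle_comp (u := \1_(circle_arc (param t0) s) : circle R -> R)).
    exact/measurable_indic/measurable_circle_arc.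
  apply: (measurableT_comp (@normr_measurable R setT)).
  by apply: measurable_funB; [exact: measurable_lebesgueR|exact: measurable_cst].
have mfund := @measurable_fundamental_arc R.
have -> : (\int[clambda]_(t in (`[0%R, 1%R[%classic : set lebesgueR)) (F (param t))%:E =
    \int[clambda]_(t in (`[0%R, 1%R[%classic : set lebesgueR)) F' t)%E.
  apply: ge0_ae_eq_integral.
  - exact: mfund.
  - apply: measurable_funTS; apply/measurable_EFinP.
    exact: (measurable_circle_comp mF).
  - exact: measurable_funTS.
  - by move=> t _; rewrite lee_fin.
  - by move=> t _.
  - exists N; split => //; first exact: sub_caratheodory.
    move=> t /= nE; apply: contrapT => nNt; apply: nE => _.
    by rewrite /F' /F vt0 vE.
apply: (@le_trans _ _ (\int[clambda]_(t in (`[0%R, 1%R[%classic : set lebesgueR)) G t)%E).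
  apply: ge0_le_integral.
  - exact: mfund.
  - by move=> t _.
  - exact: measurable_funTS.
  - by apply: measurable_funTS; exact: measurable_lebesgueR.
  - move=> t /=; rewrite in_itv/= => t01; rewrite /F' /G lee_fin ler_wpM2r//.
    rewrite !indicE; case: (boolP (param t \in _)) => [|_]; last by case: (_ \in _).
    rewrite inE /circle_arc/= => ht.
    have ht1 : normc (val (param t) - val (param t0)) < eta1 by exact: lt_le_trans s1.
    have := chord t t01 ht1; rewrite distrC => hb.
    by rewrite mem_set// /ball/= (le_lt_trans hb).
rewrite ge0_completed_integral//; last exact: measurable_funTS.
apply: (@le_trans _ _ (\int[lambda]_t G t)%E).
  by apply: ge0_subset_integral.
have mb : measurable (ball t0 s : set (measurableTypeR R)) by exact: measurable_ball.
have -> : (\int[lambda]_t G t = \int[lambda]_(t in ball t0 s) (`|v t - v t0|)%:E)%E.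
  rewrite [RHS]integral_mkcond; apply: eq_integral => t _.
  by rewrite /G patchE indicE; case: ifP => _; rewrite ?mul1r ?mul0r.
have := dav s s0 s2; rewrite /davg /iavg lebesgue_measure_ball ?(ltW s0)//.
have s20 : 0 < s *+ 2 by rewrite mulrn_wgt0.
rewrite inver gt_eqF//= lee_pdivrMl//.
move=> /le_trans; rewrite -EFinM (_ : s *+ 2 * (e / 2) = e * s); last by rewrite -mulr_natr; field.
by apply; apply: le_trans; last by [].
Qed.

End CircleLebesguePoint.

(** * Nontangential limits *)

Section Nontangential.
Variable R : realType.
Local Notation C := (R[i]).
Local Notation mu := (@circle_measure R).
Implicit Types (a w z : C) (r s : R) (g : circle R).

Lemma poisson_kernel_mean z : normc z < 1 -> Cint mu setT (fun g => (poisson_kernel z g)%:C) = 1.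
Proof.
move=> z1; have bk := cbm_cauchy_kernel z1.
have ik := cbm_integrable bk; have ik' := cbm_integrable (cbm_conj bk).
have i1 := cbm_integrable (@cbm_cst R 1).
transitivity (Cint mu setT (fun g => cauchy_kernel z g + (cauchy_kernel z g)^* - 1)).
  by apply: eq_Cint => g _; rewrite poisson_cauchy.
have i2 := CintegrableD measurableT ik ik'.
rewrite (CintB measurableT i2 i1) (CintD measurableT ik ik') (Cint_conj measurableT ik).
by rewrite cauchy_kernel_mean// Cint_circle_cst conjc1 addrK.
Qed.

Lemma poisson_kernel_le_inv z g : normc z < 1 -> poisson_kernel z g <= 2 / (1 - normc z).
Proof.
move=> z1; have z0 := normc_ge0 z; have d0 : 0 < 1 - normc z by rewrite subr_gt0.
have h := lerB_normc_circle z g.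
have p0 : 0 < normc (val g - z) by exact: lt_le_trans h.
rewrite /poisson_kernel ler_pdivrMr ?exprn_gt0// mulrAC ler_pdivlMr//.
have e2 : 1 - normc z ^+ 2 <= 2 * (1 - normc z).
  by rewrite -subr_ge0 (_ : _ - _ = (1 - normc z) ^+ 2) ?sqr_ge0//; ring.
rewrite (le_trans (ler_wpM2r (ltW d0) e2))// -mulrA -expr2 ler_wpM2l//.
by rewrite lerXn2r ?nnegrE ?normc_ge0// ltW.
Qed.

(** Seen from a Stolz region, the distance to [g] controls the distance from [g] to the vertex: the
    triangle inequality and [1 - normc z <= normc (val g - z)] give the factor [1 + b]. *)
Lemma poisson_kernel_stolz z g g0 (b : R) : normc z < 1 -> 0 < b ->
  normc (z - val g0) <= b * (1 - normc z) ->
  poisson_kernel z g * normc (val g - val g0) ^+ 2 <= 2 * (1 + b) ^+ 2 * (1 - normc z).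
Proof.
move=> z1 b0 hz; have z0 := normc_ge0 z; have d0 : 0 < 1 - normc z by rewrite subr_gt0.
have h := lerB_normc_circle z g.
have p0 : 0 < normc (val g - z) by exact: lt_le_trans h.
have tri : normc (val g - val g0) <= (1 + b) * normc (val g - z).
  have -> : val g - val g0 = (val g - z) + (z - val g0) by ring.
  apply: le_trans (ler_normcD _ _) _; rewrite mulrDl mul1r lerD2l.
  by apply: (le_trans hz); apply: (ler_wpM2l (ltW b0)); exact: h.
rewrite /poisson_kernel mulrAC ler_pdivrMr ?exprn_gt0//.
have e1 : normc (val g - val g0) ^+ 2 <= (1 + b) ^+ 2 * normc (val g - z) ^+ 2.
  rewrite -exprMn; apply: (lerXn2r 2 _ _ tri); rewrite nnegrE; first exact: normc_ge0.
  by apply: mulr_ge0; [rewrite addr_ge0// ltW|exact: normc_ge0].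
have e2 : 1 - normc z ^+ 2 <= 2 * (1 - normc z).
  by rewrite -subr_ge0 (_ : _ - _ = (1 - normc z) ^+ 2) ?sqr_ge0//; ring.
have e3 : 0 <= 1 - normc z ^+ 2 by rewrite subr_ge0 expr_le1// ltW.
apply: le_trans (ler_pM e3 (sqr_ge0 _) e2 e1) _.
by rewrite le_eqVlt; apply/orP; left; apply/eqP; ring.
Qed.

Lemma geometric_step (e q x y : R) :
  x <= e / 4 * (2 - 2 * q) -> y <= e / 4 * q -> x + y <= e / 4 * (2 - q).
Proof. lra. Qed.

Lemma small_tail (K d e : R) : 0 <= d -> d * (2 * (K + 1)) < e -> K * d <= e / 2.
Proof. lra. Qed.

Lemma total_bound (e q x y : R) : 0 < e -> 0 < q ->
  x <= e / 4 * (2 - q) -> y <= e / 2 -> x + y <= e.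
Proof. by move=> e0 q0 h1 h2; have := mulr_gt0 e0 q0; lra. Qed.

Lemma lt_or_le r s : r < s \/ s <= r.
Proof. by case: ltP; [left|right]. Qed.

Lemma pow4 k : 4 ^+ k = (2 ^+ k) ^+ 2 :> R.
Proof. by rewrite -exprM mulnC exprM; congr (_ ^+ k); rewrite -natrX. Qed.

Lemma dyadic_scale (d eta : R) : 0 < d -> d <= eta -> exists n, 2 ^+ n * d <= eta < 2 ^+ n.+1 * d.
Proof.
move=> d0 de.
have ex : exists n, eta < 2 ^+ n * d.
  exists (Num.truncn (eta / d)).+1; rewrite -ltr_pdivrMr//.
  apply: (@lt_trans _ _ (Num.truncn (eta / d)).+1%:R); first by rewrite truncnS_gt.
  by rewrite -natrX ltr_nat ltn_expl.
case: (ex_minnP ex) => -[|n] hn min; first by move: hn; rewrite expr0 mul1r ltNge de.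
by exists n; rewrite hn andbT leNgt; apply/negP => /min; rewrite ltnn.
Qed.

(* With [dl = 1 - normc z], the kernel is dominated near [g0] by the sum over [k]
   of [8 A / (4 ^+ k * dl)] times the indicator of the arc of radius
   [2 ^+ k * dl], over which the oscillation of [u] has integral at most of order
   [e * 2 ^+ k * dl]. *)
Lemma poisson_lebesgue_point (u : circle R -> R) (M : R) g0 (b e : R) :
  measurable_fun setT u -> (forall g, `|u g| <= M) ->
  lebesgue_point u g0 -> 0 < b -> 0 < e ->
  exists2 d, 0 < d & forall z, normc z < 1 -> normc (z - val g0) <= b * (1 - normc z) ->
    normc (z - val g0) < d -> \int[mu]_g (poisson_kernel z g * `|u g - u g0|) <= e.
Proof.
move=> mu_ uM lp b0 e0.
have M0 : 0 <= M by exact: le_trans (normr_ge0 _) (uM g0).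
have [A [AE A1]] : exists A, A = (1 + b) ^+ 2 /\ 1 <= A.
  by exists ((1 + b) ^+ 2); split => //; rewrite -(expr1n _ 2) lerXn2r ?nnegrE//; lra.
have A0 : 0 < A by exact: lt_le_trans A1.
have A8 : 2 <= 8 * A by lra.
(* The arc of index [k] then contributes at most [8 * A / (4 ^+ k * dl)] times
   [e / (32 * A) * (2 ^+ k * dl)], that is [e / 4 / 2 ^+ k]; the sum over [k] stays below
   [e / 2]. *)
have e'0 : 0 < e / (32 * A) by rewrite divr_gt0// mulr_gt0.
have [eta eta0 hlp] := lp _ e'0.
(* The product [K * dl] bounds the contribution of the tail, where the kernel is at most
   [8 * A * dl / eta ^+ 2] and the oscillation at most [2 * M]. *)
pose K := 16 * A * M / eta ^+ 2.
have K0 : 0 <= K by rewrite divr_ge0 ?sqr_ge0// !mulr_ge0// ltW.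
have K1 : 0 < K + 1 by rewrite ltr_wpDl.
exists (Num.min eta (e / (2 * (K + 1)))).
  by rewrite lt_min eta0 divr_gt0// mulr_gt0.
move=> z z1 hz; rewrite lt_min => /andP[zd1 zd2].
pose dl := 1 - normc z.
have dl0 : 0 < dl by rewrite subr_gt0.
have dlz : dl <= normc (z - val g0) by rewrite normcBC lerB_normc_circle.
(* The last arc still has radius at most [eta], and the points outside it are at distance more than
   [eta / 2] from [g0]. *)
have [n /andP[n1 n2]] := dyadic_scale dl0 (ltW (le_lt_trans dlz zd1)).
pose w g := `|u g - u g0|.
have mw : measurable_fun setT w.
  apply: (measurableT_comp (@normr_measurable R setT)).
  exact: (measurable_funB mu_ (measurable_cst _)).
have wM g : `|w g| <= 2 * M.
  rewrite normr_id (le_trans (ler_normB _ _))// mulr_natl mulr2n; exact: lerD.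
have w0 g : 0 <= w g by exact: normr_ge0.
have ibd (v : circle R -> R) (B : R) : measurable_fun setT v -> (forall g, `|v g| <= B) ->
    mu.-integrable setT (EFin \o v).
  by move=> mv vB; have [] := cbm_integrable (cbm_real mv vB).
pose c k := 8 * A / (4 ^+ k * dl).
have c0 k : 0 <= c k by rewrite divr_ge0 ?mulr_ge0 ?exprn_ge0// ltW.
pose ind k g : R := \1_(circle_arc g0 (2 ^+ k * dl)) g.
have ind0 k g : 0 <= ind k g by rewrite /ind.
have mind k : measurable_fun setT (ind k) by exact/measurable_indic/measurable_circle_arc.
have ind1 k g : `|ind k g| <= 1.
  by rewrite ger0_norm// /ind indicE; case: (_ \in _).
pose H := fix H (k : nat) (g : circle R) : R := if k is j.+1 then H j g + c j.+1 * ind j.+1 g else c 0%N * ind 0%N g.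
have H0 k g : 0 <= H k g by elim: k => [|k ih] /=; rewrite ?addr_ge0// mulr_ge0.
have pk0 g := poisson_kernel_ge0 g z1.
have HP k g : normc (val g - val g0) < 2 ^+ k * dl -> poisson_kernel z g <= H k g.
  have indE k' : normc (val g - val g0) < 2 ^+ k' * dl -> ind k' g = 1.
    by move=> h; rewrite /ind indicE mem_set.
  elim: k => [|k ih] hk /=.
    rewrite indE// mulr1 (le_trans (poisson_kernel_le_inv g z1))// -/dl /c expr0 mul1r.
    by rewrite ler_pM2r ?invr_gt0.
  destruct (lt_or_le (normc (val g - val g0)) (2 ^+ k * dl)) as [h|h].
    by rewrite (le_trans (ih h))// lerDl mulr_ge0.
  rewrite indE// mulr1 (@le_trans _ _ (c k.+1))// ?lerDr//.
  have := poisson_kernel_stolz g z1 b0 hz; rewrite -AE -/dl => hs.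
  have p4 : 0 < 4 ^+ k :> R by rewrite exprn_gt0.
  rewrite /c ler_pdivlMr ?mulr_gt0 ?exprn_gt0//.
  have h2 : 4 ^+ k * dl ^+ 2 <= normc (val g - val g0) ^+ 2.
    rewrite pow4 -exprMn.
    by rewrite lerXn2r ?nnegrE ?normc_ge0// mulr_ge0 ?exprn_ge0// ltW.
  have := ler_wpM2l (pk0 g) h2 => h3; have := le_trans h3 hs => h4.
  rewrite -(ler_pM2r dl0) exprS; apply: le_trans (_ : 4 * (2 * A * dl) <= _); last by rewrite !mulrA -natrM.
  apply: le_trans (_ : 4 * (poisson_kernel z g * (4 ^+ k * dl ^+ 2)) <= _); last by rewrite ler_wpM2l.
  by rewrite le_eqVlt; apply/orP; left; apply/eqP; ring.
have tail g : poisson_kernel z g <= H n g + 8 * A * dl / eta ^+ 2.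
  have t0 : 0 <= 8 * A * dl / eta ^+ 2 by rewrite divr_ge0 ?sqr_ge0// !mulr_ge0// ltW.
  destruct (lt_or_le (normc (val g - val g0)) (2 ^+ n * dl)) as [h|h].
    by rewrite (le_trans (HP _ _ h))// lerDl.
  rewrite (@le_trans _ _ (8 * A * dl / eta ^+ 2))// ?lerDr//.
  have := poisson_kernel_stolz g z1 b0 hz; rewrite -AE -/dl => hs.
  rewrite ler_pdivlMr ?exprn_gt0//.
  have h2 : eta <= 2 * normc (val g - val g0).
    by rewrite (le_trans (ltW n2))// exprS -mulrA ler_wpM2l.
  have h3 : eta ^+ 2 <= 4 * normc (val g - val g0) ^+ 2.
    have -> : 4 * normc (val g - val g0) ^+ 2 = (2 * normc (val g - val g0)) ^+ 2 by ring.
    by rewrite lerXn2r ?nnegrE ?mulr_ge0 ?normc_ge0// ltW.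
  apply: le_trans (ler_wpM2l (pk0 g) h3) _; rewrite mulrCA.
  by rewrite (_ : 8 * A * dl = 4 * (2 * A * dl)) ?ler_wpM2l// !mulrA -natrM.
have mH k : measurable_fun setT (H k).
  elim: k => [|k ih] /=; first exact: (measurable_funM (measurable_cst (c 0%N)) (mind 0%N)).
  exact: (measurable_funD ih (measurable_funM (measurable_cst (c k.+1)) (mind k.+1))).
have iind k : mu.-integrable setT (EFin \o (fun g => ind k g * w g)).
  apply: (ibd _ (1 * (2 * M))); first exact: measurable_funM (mind k) mw.
  by move=> g; rewrite normrM ler_pM.
have iH k : mu.-integrable setT (EFin \o (fun g => H k g * w g)) /\
    ((k <= n)%N -> \int[mu]_g (H k g * w g) <= e / 4 * (2 - (2 ^+ k)^-1)).
  have est j : (j <= n)%N -> c j * \int[mu]_g (ind j g * w g) <= e / 4 * (2 ^+ j)^-1.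
    move=> jn; have s0 : 0 < 2 ^+ j * dl by rewrite mulr_gt0// exprn_gt0.
    have s1 : 2 ^+ j * dl <= eta.
      by rewrite (le_trans _ n1)// ler_wpM2r ?(ltW dl0)// ler_eXn2l ?ltr1n.
    have := ler_wpM2l (c0 j) (hlp _ s0 s1); move=> /le_trans; apply.
    rewrite le_eqVlt; apply/orP; left; apply/eqP; rewrite /c.
    rewrite pow4.
    field; rewrite !gt_eqF//.
  elim: k => [|k [ih1 ih2]] /=.
    have -> : (fun g => c 0%N * ind 0%N g * w g) = (fun g => c 0%N * (ind 0%N g * w g)).
      by apply/funext => g; rewrite mulrA.
    split; first exact: integrable_EFinZl measurableT (iind 0%N).
    move=> _; rewrite RintegralZl//.
    rewrite (le_trans (est 0%N _))// expr0 invr1 (_ : 2 - 1 = 1)//; ring.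
  have E : (fun g => (H k g + c k.+1 * ind k.+1 g) * w g) =
      (fun g => H k g * w g + c k.+1 * (ind k.+1 g * w g)).
    by apply/funext => g; rewrite mulrDl mulrA.
  have i2 := integrable_EFinZl (c k.+1) measurableT (iind k.+1).
  rewrite E; split; first exact: integrable_EFinD measurableT ih1 i2.
  move=> kn; rewrite RintegralD// RintegralZl//.
  have := est _ kn; have := ih2 (ltnW kn).
  have -> : (2 ^+ k)^-1 = 2 * (2 ^+ k.+1)^-1 :> R.
    by rewrite exprS invfM mulrA mulfV// mul1r.
  exact: geometric_step.
have [iHn hHn] := iH n.
pose t := 8 * A * dl / eta ^+ 2.
have t0 : 0 <= t by rewrite divr_ge0 ?sqr_ge0// !mulr_ge0// ltW.
have it : mu.-integrable setT (EFin \o (fun g => t * (2 * M))) by exact: circle_cst_integrable.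
have ip : mu.-integrable setT (EFin \o (fun g => poisson_kernel z g * w g)).
  have [mp _] := (cbm_poisson_kernel z1).1.
  apply: (ibd _ (2 / (1 - normc z) * (2 * M))); first exact: measurable_funM mp mw.
  by move=> g; rewrite normrM ler_pM// ger0_norm// poisson_kernel_le_inv.
apply: (@le_trans _ _ (\int[mu]_g (H n g * w g + t * (2 * M)))).
  apply: le_Rintegral => //; first exact: integrable_EFinD measurableT iHn it.
  move=> g _; apply: (@le_trans _ _ ((H n g + t) * w g)).
    by rewrite ler_wpM2r// tail.
  by rewrite mulrDl lerD2l ler_wpM2l// (le_trans (ler_norm _) (wM g)).
rewrite RintegralD// circle_Rint_cst.
have ht : t * (2 * M) = K * dl by rewrite /t /K; field; rewrite gt_eqF.
have hd : K * dl <= e / 2.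
  have d2 : dl < e / (2 * (K + 1)) by exact: le_lt_trans dlz zd2.
  by move: d2; rewrite ltr_pdivlMr ?mulr_gt0//; exact: small_tail (ltW dl0).
have := hHn (leqnn n); rewrite ht.
have q0 : 0 < (2 ^+ n : R)^-1 by rewrite invr_gt0 exprn_gt0.
move=> h; exact: total_bound e0 q0 h hd.
Qed.

Lemma stolzP (g : circle R) (b : R) z : stolz g b z <-> normc z < 1 /\ normc (z - val g) < b * (1 - normc z).
Proof.
rewrite /stolz/= !normr_normc.
have -> : b%:C * (1 - (normc z)%:C) = (b * (1 - normc z))%:C by rewrite rmorphM rmorphB.
have -> : ((normc z)%:C < 1) = (normc z < 1) by rewrite -[RHS]ltcR.
by rewrite ltcR.
Qed.

Lemma nontangential_limitP (f : C -> C) g w : nontangential_limit f g w <->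
  forall b : R, 1 < b -> forall e, 0 < e -> exists2 d, 0 < d &
    forall z, normc z < 1 -> normc (z - val g) < b * (1 - normc z) -> normc (z - val g) < d ->
      normc (f z - w) < e.
Proof.
split=> h b b1.
  move=> e e0; have : ccvg (within (stolz g b) (nbhs (val g : R[i]^o))) f w by rewrite ccvgE; exact: h.
  move=> /ccvgP/(_ e e0).
  move=> /nbhs_normc[d d0 dP]; exists d => // z z1 zb zd.
  by apply: (dP z zd); apply/stolzP.
suff: ccvg (within (stolz g b) (nbhs (val g : R[i]^o))) f w by rewrite ccvgE.
apply/ccvgP => e e0.
destruct (h b b1 e e0) as [d d0 dP].
apply/nbhs_normc; exists d => // z zd /stolzP[z1 zb]; exact: dP.
Qed.

Lemma quarter_bound (e x y : R) : 0 < e -> y <= e / 4 -> x <= e / 4 -> x + y < e.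
Proof. lra. Qed.

(** The kernel has mean 1, so [f z - V g0] is the Poisson integral of [V - V g0]; this is small in a
    Stolz region when [g0] is a Lebesgue point of both the real and the imaginary part. *)
Lemma poisson_nontangential (V : circle R -> C) (f : C -> C) : cbm V ->
  (forall z, normc z < 1 -> Cint mu setT (fun g => V g * (poisson_kernel z g)%:C) = f z) ->
  {ae mu, forall g, nontangential_limit f g (V g)}.
Proof.
move=> bV fV; have [[m1 m2] [M VM]] := bV.
have M1 g : `|Re (V g)| <= M by exact: le_trans (normc_Re _) (VM g).
have M2 g : `|Im (V g)| <= M by exact: le_trans (normc_Im _) (VM g).
have l1 := circle_lebesgue_points m1 M1.
have l2 := circle_lebesgue_points m2 M2.
apply: filterS2 l1 l2 => g0 h1 h2.
apply/nontangential_limitP => b b1 e e0.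
have b0 : 0 < b by exact: lt_trans b1.
have e4 : 0 < e / 4 by rewrite divr_gt0.
destruct (poisson_lebesgue_point m1 M1 h1 b0 e4) as [d1 d10 H1].
destruct (poisson_lebesgue_point m2 M2 h2 b0 e4) as [d2 d20 H2].
exists (Num.min d1 d2); first by rewrite lt_min d10.
move=> z z1 zb; rewrite lt_min => /andP[zd1 zd2].
have bp := cbm_poisson_kernel z1.
have bW : cbm (fun g => (V g - V g0) * (poisson_kernel z g)%:C).
  exact: cbmM (cbmB bV (cbm_cst _)) bp.
have -> : f z - V g0 = Cint mu setT (fun g => (V g - V g0) * (poisson_kernel z g)%:C).
  have i1 := cbm_integrable (cbmM bV bp).
  have i2 := cbm_integrable (cbmM (cbm_cst (V g0)) bp).
  transitivity (Cint mu setT (fun g => V g * (poisson_kernel z g)%:C - V g0 * (poisson_kernel z g)%:C)).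
    rewrite (CintB measurableT i1 i2) fV// (CintZl (V g0) measurableT (cbm_integrable bp)).
    by rewrite poisson_kernel_mean// mulr1.
  by apply: eq_Cint => g _; rewrite mulrBl.
have ibd (v : circle R -> R) (B : R) : measurable_fun setT v -> (forall g, `|v g| <= B) ->
    mu.-integrable setT (EFin \o v).
  by move=> mv vB; have [] := cbm_integrable (cbm_real mv vB).
have [mp _] := bp.1.
have ip (v : circle R -> R) : measurable_fun setT v -> (forall g, `|v g| <= M) ->
    mu.-integrable setT (EFin \o (fun g => poisson_kernel z g * `|v g - v g0|)).
  move=> mv vM; apply: (ibd _ (2 / (1 - normc z) * (2 * M))).
    exact: (measurable_funM mp (measurableT_comp (@normr_measurable R setT) (measurable_funB mv (measurable_cst (v g0))))).
  move=> g; rewrite normrM ler_pM//; first by rewrite ger0_norm ?poisson_kernel_ge0// poisson_kernel_le_inv.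
  rewrite normr_id (le_trans (ler_normB _ _))// mulr_natl mulr2n; exact: lerD.
have i1 := ip _ m1 M1; have i2 := ip _ m2 M2.
have := normc_Cint_le measurableT (cbm_integrable bW) (integrable_EFinD measurableT i1 i2).
have pt (g : circle R) : setT g -> normc ((V g - V g0) * (poisson_kernel z g)%:C) <=
   poisson_kernel z g * `|Re (V g) - Re (V g0)| + poisson_kernel z g * `|Im (V g) - Im (V g0)|.
  move=> _; rewrite normcM normc_real ger0_norm ?poisson_kernel_ge0// mulrC -mulrDr.
  apply: ler_wpM2l; first exact: poisson_kernel_ge0.
  by apply: le_trans (normc_le_ReIm _) _; rewrite cReD cReN cImD cImN.
move=> /(_ pt) /le_lt_trans; apply; rewrite RintegralD//.
exact: (quarter_bound e0 (H2 z z1 (ltW zb) zd2) (H1 z z1 (ltW zb) zd1)).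
Qed.

End Nontangential.

(** * Boundary values and Fatou's theorem *)

Section BoundaryValues.
Variable R : realType.
Local Notation C := (R[i]).
Local Notation Co := (R[i]^o).
Local Notation mu := (@circle_measure R).
Implicit Types (f h : C -> C) (w z : C) (g : circle R).

Definition nt_filter g (b : R) : set_system Co := within (stolz g b) (nbhs (val g : Co)).

Lemma nt_limit_ccvg f g w : nontangential_limit f g w <-> forall b : R, 1 < b -> ccvg (nt_filter g b) f w.
Proof. by split=> h b b1; [rewrite ccvgE|rewrite -ccvgE]; exact: h. Qed.

Lemma nt_limitM f h g w w' : nontangential_limit f g w -> nontangential_limit h g w' ->
  nontangential_limit (fun z => f z * h z) g (w * w').
Proof. by rewrite !nt_limit_ccvg => h1 h2 b b1; exact: ccvgM (h1 b b1) (h2 b b1). Qed.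

Lemma nt_limitV f g w : w != 0 -> nontangential_limit f g w ->
  nontangential_limit (fun z => (f z)^-1) g w^-1.
Proof. by move=> w0; rewrite !nt_limit_ccvg => h1 b b1; exact: ccvgV w0 (h1 b b1). Qed.

Lemma nt_limit_cst (c : C) g : nontangential_limit (fun=> c) g c.
Proof. by rewrite nt_limit_ccvg => b b1; exact: ccvg_cst. Qed.

Lemma nt_limit_comp f h g w : nontangential_limit f g w -> ccontinuous_at h w ->
  nontangential_limit (fun z => h (f z)) g (h w).
Proof.
rewrite !nt_limit_ccvg => fw; rewrite /ccontinuous_at ccvgE => hw b b1.
by have := fw b b1; rewrite !ccvgE => fb; exact: (cvg_comp _ _ fb hw).
Qed.

(** Supplies points of every Stolz region arbitrarily close to the vertex; uniqueness of
    nontangential limits and the bounds on them rest on it. *)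
Lemma radial_stolz g (t b : R) : 0 < t < 1 -> 1 < b ->
  let z := (1 - t)%:C * val g in
  [/\ normc z < 1, normc (z - val g) < b * (1 - normc z) & normc (z - val g) = t].
Proof.
move=> /andP[t0 t1] b1 z.
have nz : normc z = 1 - t by rewrite normc_ray// subr_ge0 ltW.
have nzg : normc (z - val g) = t.
  have -> : z - val g = (- t)%:C * val g by rewrite /z rmorphB rmorphN/=; ring.
  by rewrite normcM normc_circle mulr1 normc_real normrN gtr0_norm.
by rewrite nzg nz; split => //; [rewrite ltrBlDr ltrDl|rewrite opprB addrC subrK ltr_pMl].
Qed.

Lemma nt_limit_unique f g w w' : nontangential_limit f g w -> nontangential_limit f g w' -> w = w'.
Proof.
move=> /nontangential_limitP h /nontangential_limitP h'.
apply/eqP; rewrite -subr_eq0 -normc_eq0 eq_le normc_ge0 andbT leNgt; apply/negP => e0.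
have b1 : 1 < (2 : R) by rewrite ltr1n.
have e2 : 0 < normc (w - w') / 2 by rewrite divr_gt0.
destruct (h 2 b1 _ e2) as [d d0 dP]. destruct (h' 2 b1 _ e2) as [d' d'0 d'P].
pose t := Num.min (Num.min d d') 1 / 2.
have m0 : 0 < Num.min (Num.min d d') 1 by rewrite !lt_min d0 d'0 ltr01.
have tm : t < Num.min (Num.min d d') 1 by rewrite ltr_pdivrMr// ltr_pMr// ltr1n.
move: tm; rewrite !lt_min => /andP[/andP[td td'] t1].
have t01 : 0 < t < 1 by rewrite t1 divr_gt0.
destruct (radial_stolz g t01 b1) as [z1 zb zt].
set z := _ * _ in z1 zb zt; rewrite -zt in td td'.
have := dP z z1 zb td; have := d'P z z1 zb td'.
rewrite normcBC => h1 h2.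
have : normc (w - w') < normc (w - w') / 2 + normc (w - w') / 2.
  have -> : w - w' = (w - f z) + (f z - w') by ring.
  apply: le_lt_trans (ler_normcD _ _) _; rewrite addrC.
  have -> : (w - f z) + (f z - w') = w - w' by ring.
  by apply: ltrD; rewrite // normcBC.
by rewrite -splitr ltxx.
Qed.

Lemma boundary_valueE f g w : nontangential_limit f g w -> boundary_value f g = w.
Proof.
move=> fw; rewrite /boundary_value; apply: xget_unique => // w' h.
exact: nt_limit_unique h fw.
Qed.

Lemma nt_limit_bound f g w M : (forall z, normc z < 1 -> normc (f z) <= M) ->
  nontangential_limit f g w -> normc w <= M.
Proof.
move=> fM /nontangential_limitP h; rewrite leNgt; apply/negP => Mw.
have b1 : 1 < (2 : R) by rewrite ltr1n.
have e0 : 0 < normc w - M by rewrite subr_gt0.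
destruct (h 2 b1 _ e0) as [d d0 dP].
pose t := Num.min d 1 / 2.
have m0 : 0 < Num.min d 1 by rewrite lt_min d0 ltr01.
have tm : t < Num.min d 1 by rewrite ltr_pdivrMr// ltr_pMr// ltr1n.
move: tm; rewrite lt_min => /andP[td t1].
have t01 : 0 < t < 1 by rewrite t1 divr_gt0.
destruct (radial_stolz g t01 b1) as [z1 zb zt].
set z := _ * _ in z1 zb zt; rewrite -zt in td.
have := dP z z1 zb td; rewrite normcBC => h1.
have := le_lt_trans (lerB_normc w (f z)) h1; rewrite ltrD2l ltrN2.
by rewrite ltNge fM.
Qed.

Lemma boundary_value_bound f M : (forall z, normc z < 1 -> normc (f z) <= M) ->
  forall g, normc (boundary_value f g) <= M.
Proof.
move=> fM g; rewrite /boundary_value; case: xgetP => [w _ fw|_].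
  exact: nt_limit_bound fM fw.
(* The default value 0 respects the bound too, as [M] is nonnegative. *)
by rewrite normc0 (le_trans (normc_ge0 (f 0)))// fM// normc0.
Qed.

Definition bounded_disc f := discdiff f /\ exists M : R, forall z, normc z < 1 -> normc (f z) <= M.

Lemma discE z : disc z <-> normc z < 1.
Proof.
rewrite /disc/= normr_normc.
by have -> : ((normc z)%:C < 1) = (normc z < 1) by rewrite -[RHS]ltcR.
Qed.

Lemma analytic_discdiff f : analytic f <-> discdiff f.
Proof.
split=> h z; first by move=> /discE /h /derivable_cdiff.
by move=> /discE /h /derivable_cdiff.
Qed.

Lemma bounded_analyticE f : bounded_analytic f <-> bounded_disc f.
Proof.
split=> -[/analytic_discdiff h1 [M h2]]; split => //; exists M => z.
  by move=> /discE /h2; rewrite normr_normc lecR.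
by move=> /discE /h2; rewrite normr_normc lecR.
Qed.

Lemma bounded_discM f h : bounded_disc f -> bounded_disc h -> bounded_disc (fun z => f z * h z).
Proof.
move=> [d1 [M h1]] [d2 [K h2]]; split; first by move=> z z1; exact: cdiffM (d1 z z1) (d2 z z1).
exists (M * K) => z z1; rewrite normcM; apply: ler_pM; [exact: normc_ge0|exact: normc_ge0|exact: h1|exact: h2].
Qed.

Lemma bounded_disc_cst (c : C) : bounded_disc (fun=> c).
Proof. by split; [move=> z _; exact: cdiff_cst|exists (normc c)]. Qed.

Lemma bounded_discX f n : bounded_disc f -> bounded_disc (fun z => f z ^+ n).
Proof.
move=> bf; elim: n => [|n ih]; first by under eq_fun do rewrite expr0; exact: bounded_disc_cst.
by under eq_fun do rewrite exprS; exact: bounded_discM.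
Qed.

Section Fatou.
Variable f : C -> C.
Hypothesis bf : bounded_disc f.

Lemma fatou_nt : {ae mu, forall g, nontangential_limit f g (boundary_value f g)}.
Proof.
have [fd [M fM]] := bf; have [V [bV fV]] := boundary_function fd fM.
have := poisson_nontangential bV fV; apply: filterS => g h.
by rewrite (boundary_valueE h).
Qed.

(** Measurability is inherited from the boundary function [V], with which [boundary_value f] agrees
    almost everywhere; this relies on the completeness of the circle measure. *)
Lemma cbm_boundary_value : cbm (boundary_value f).
Proof.
have [fd [M fM]] := bf; have [V [bV fV]] := boundary_function fd fM.
have h := poisson_nontangential bV fV.
have e : {ae mu, forall g, V g = boundary_value f g}.
  by apply: filterS h => g /boundary_valueE ->.
split; last by exists M; exact: boundary_value_bound.
have [m1 m2] := bV.1; split.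
  by apply: (measurable_ae_eq m1); apply: filterS e => g ->.
by apply: (measurable_ae_eq m2); apply: filterS e => g ->.
Qed.

Lemma fatou_poisson z : normc z < 1 ->
  Cint mu setT (fun g => boundary_value f g * (poisson_kernel z g)%:C) = f z.
Proof.
move=> z1; have [fd [M fM]] := bf; have [V [bV fV]] := boundary_function fd fM.
have h := poisson_nontangential bV fV.
rewrite -(fV z z1); have bp := cbm_poisson_kernel z1.
apply: (Cint_ae_eq measurableT).
- exact: (cbmM cbm_boundary_value bp).1.
- exact: (cbmM bV bp).1.
- by apply: filterS h => g /boundary_valueE -> _.
Qed.

Lemma fatou_mean : Cint mu setT (boundary_value f) = f 0.
Proof.
rewrite -(fatou_poisson (z := 0)) ?normc0//; apply: eq_Cint => g _.
by rewrite /poisson_kernel subr0 normc_circle normc0 expr0n subr0 expr1n divr1 mulr1.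
Qed.

End Fatou.

Lemma boundary_valueM f h : bounded_disc f -> bounded_disc h ->
  {ae mu, forall g, boundary_value (fun z => f z * h z) g = boundary_value f g * boundary_value h g}.
Proof.
move=> /fatou_nt h1 /fatou_nt h2; apply: filterS2 h1 h2 => g h1 h2.
by rewrite (boundary_valueE (nt_limitM h1 h2)).
Qed.

Lemma boundary_valueX f n : bounded_disc f ->
  {ae mu, forall g, boundary_value (fun z => f z ^+ n) g = boundary_value f g ^+ n}.
Proof.
move=> /fatou_nt; apply: filterS => g h.
apply: boundary_valueE; elim: n => [|n ih].
  by rewrite expr0; under eq_fun do rewrite expr0; exact: nt_limit_cst.
by rewrite exprS; under eq_fun do rewrite exprS; exact: nt_limitM.
Qed.

End BoundaryValues.

(** * Moments and measures on the circle *)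

Section HalfPlanes.
Variable R : realType.
Local Notation C := (R[i]).
Local Notation mu := (@circle_measure R).
Local Notation param := (@circle_param R).
Local Notation lambda := (@lebesgue_measure R).
Local Notation lebesgueR := (caratheodory_type (@wlength R idfun)^*%mu).

(** The arc cut off by a half-plane. Arcs are described in this way because the real part is a
    polynomial in [gamma] and its conjugate, which moments control. *)
Definition half_plane (c : circle R) (s : R) : set (circle R) :=
  [set g | s < Re (val g * (val c)^*)].

Definition half_planes : set (set (circle R)) :=
  [set A | exists c s, -1 <= s <= 1 /\ A = half_plane c s].

(** The sigma-algebra reached from moments; [borel_approx] links it to the complete one carried by
    the circle. *)
Definition borel_circle := <<s half_planes >>.

Lemma Re_param (t m : R) : Re (val (param t) * (val (param m))^*) = cos (2 * pi * (t - m)).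
Proof. by rewrite cReM /= mulrN opprK mulrBr cosB. Qed.

Lemma half_plane_param (m s t : R) :
  half_plane (param m) s (param t) = (s < cos (2 * pi * (t - m))) :> Prop.
Proof. by rewrite -Re_param. Qed.

Lemma param_surj (g : circle R) : exists2 t, 0 <= t < 1 & param t = g.
Proof.
have n1 := normc_circle g; have p0 := pi_gt0 R.
have := normc_sqr (val g); rewrite n1 expr1n.
set x := Re (val g); set y := Im (val g) => xy.
have x1 : -1 <= x <= 1 by rewrite -ler_norml -(normc_circle g); exact: normc_Re.
have th := acosK; pose a := acos x.
have ca : cos a = x by rewrite acosK// in_itv.
have a0 : 0 <= a by exact: acos_ge0.
have ap : a <= pi by exact: acos_lepi.
have sa : sin a = `|y|.
  have : 0 <= sin a by rewrite sin_ge0_pi// a0.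
  move=> s0; apply/eqP; rewrite -(@eqrXn2 _ 2)// real_normK ?num_real// sin2cos2 ca xy.
  by rewrite addrAC subrr add0r.
have ge : val g = x +i* y by rewrite /x /y; case: (val g).
have [y0|y0] := ler0P y; last first.
  exists (a / (2 * pi)).
    rewrite divr_ge0 ?mulr_ge0 ?(ltW p0)//= ltr_pdivrMr ?mulr_gt0// mul1r.
    by rewrite (le_lt_trans ap)// ltr_pMl// ltr1n.
  apply: val_inj; rewrite /= ge mulrC divfK ?gt_eqF ?mulr_gt0// ca sa.
  by rewrite gtr0_norm.
have [y00|yn] := eqVneq y 0.
  have : x ^+ 2 = 1 by rewrite xy y00 expr0n addr0.
  move=> /eqP; rewrite sqrf_eq1 => /orP[|] /eqP xe.
    exists 0; first by rewrite lexx ltr01.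
    by apply: val_inj; rewrite /= ge mulr0 cos0 sin0 xe y00.
  exists 2^-1; first by rewrite invr_ge0 ler0n invf_lt1// ltr1n.
  by apply: val_inj; rewrite /= ge mulrAC mulfV// mul1r cospi sinpi xe y00.
have yl : y < 0 by rewrite lt_neqAle yn.
have a00 : 0 < a.
  rewrite lt_neqAle a0 andbT; apply: contra yn => /eqP ae.
  by move: sa; rewrite -ae sin0 => /esym/eqP; rewrite normr_eq0.
exists (1 - a / (2 * pi)).
  have h1 : 0 < a / (2 * pi) by rewrite divr_gt0// mulr_gt0.
  have h2 : a / (2 * pi) <= 1.
    by rewrite ler_pdivrMr ?mulr_gt0// mul1r (le_trans ap)// ler_peMl ?(ltW p0)// ler1n.
  by rewrite subr_ge0 h2 ltrBlDr ltrDl.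
apply: val_inj; rewrite /= ge.
have -> : 2 * pi * (1 - a / (2 * pi)) = - a + pi *+ 2.
  by rewrite mulrBr mulr1 [X in _ - X]mulrC divfK ?gt_eqF ?mulr_gt0// addrC mulr_natl.
by rewrite cosD2pi sinD2pi cosN sinN ca sa ler0_norm// opprK.
Qed.

(** The parameters in []a, 1[] describe the arc centred at [m], the midpoint, with half-length [r]
    in parameter; it is cut off at height [cos (2 * pi * r)]. Rays generate the Borel sets of the
    line, whence [borel_circle_pullback]. *)
Lemma arc_half_plane (a : R) : 0 <= a < 1 ->
  exists2 A, borel_circle A & forall t, 0 <= t < 1 -> (A (param t) <-> a < t).
Proof.
move=> /andP[a0 a1]; have p0 := pi_gt0 R.
pose m := (a + 1) / 2; pose r := (1 - a) / 2.
exists (half_plane (param m) (cos (2 * pi * r))).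
  apply: sub_sigma_algebra; exists (param m), (cos (2 * pi * r)).
  by rewrite cos_geN1 cos_le1.
have r0 : 0 < r by rewrite divr_gt0// subr_gt0.
have r2 : r <= 2^-1 by rewrite /r -[leRHS]mul1r ler_pM2r ?invr_gt0// lerBlDr lerDl.
have key (x : R) : 0 <= x <= 2^-1 -> (cos (2 * pi * r) < cos (2 * pi * x)) = (x < r).
  have dom (y : R) : 0 <= y <= 2^-1 -> 2 * pi * y \in `[0, pi].
    move=> /andP[y0 y2]; rewrite in_itv/=; apply/andP; split.
      apply: mulr_ge0 y0; apply: mulr_ge0; [exact: ler0n|exact: (ltW p0)].
    have y3 : 2 * y <= 1 by lra.
    by rewrite mulrAC -[leRHS]mul1r (ler_pM2r p0).
  move=> x02; rewrite ltr_cos ?dom ?(ltW r0)//.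
  by rewrite ltr_pM2l// mulr_gt0.
move=> t /andP[t0 t1]; rewrite (half_plane_param m _ t).
have -> : cos (2 * pi * (t - m)) = cos (2 * pi * `|t - m|).
  have [h|h] := lerP 0 (t - m); first by rewrite ger0_norm.
  by rewrite ltr0_norm// mulrN cosN.
have hm : m = a + r by rewrite /m /r; lra.
have hm1 : m = 1 - r by rewrite /m /r; lra.
have [h|h] := lt_or_le 2^-1 `|t - m|; last first.
  rewrite key ?normr_ge0//; split.
    by move=> /ltr_normlP[h1 h2]; lra.
  by move=> h1; apply/ltr_normlP; split; lra.
have n1 : `|t - m| < 1 by apply/ltr_normlP; split; rewrite /m; lra.
(* Beyond half a turn, the distance to [m] is measured the other way round the circle. *)
have -> : cos (2 * pi * `|t - m|) = cos (2 * pi * (1 - `|t - m|)).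
  have -> : 2 * pi * (1 - `|t - m|) = - (2 * pi * `|t - m|) + pi *+ 2 by rewrite -mulr_natl; ring.
  by rewrite cosD2pi cosN.
rewrite key; last by apply/andP; split; lra.
split; first by have [h1|h1] := lerP 0 (t - m); [rewrite ger0_norm//|rewrite ltr0_norm//] => h2; lra.
move=> h1; exfalso; move: h; apply/negP; rewrite -leNgt.
by apply/ler_normlP; split; rewrite /m; lra.
Qed.

Lemma borel_circle_sigma : sigma_algebra setT borel_circle.
Proof. exact: smallest_sigma_algebra. Qed.

Lemma borel_circle_pullback (B : set (measurableTypeR R)) : measurable B ->
  exists2 A, borel_circle A & forall t, 0 <= t < 1 -> (A (param t) <-> B t).
Proof.
have [s0 sC sU] := borel_circle_sigma.
pose T := [set B : set R | exists2 A, borel_circle A & forall t, 0 <= t < 1 -> (A (param t) <-> B t)].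
suff h : <<s (@RGenOInfty.G R) >> `<=` T by rewrite RGenOInfty.measurableE; exact: h.
apply: smallest_sub; first split.
- by exists set0.
- move=> D [A bA AB]; exists (setT `\` A); first exact: sC.
  by move=> t /AB h; split => -[_ n]; split => //; move=> /h; apply: n.
- move=> F hF; have /choice[A hA] : forall n, exists A, borel_circle A /\ forall t, 0 <= t < 1 -> (A (param t) <-> F n t).
    by move=> n; have [A h1 h2] := hF n; exists A.
  exists (\bigcup_n A n); first by apply: sU => n; have [] := hA n.
  move=> t t01; split => -[n _ h]; exists n => //; have [_ hn] := hA n; exact/(hn t t01).
move=> _ [x ->].
have [x0|x0] := ltP x 0.
  exists setT; first by have := sC _ s0; rewrite setD0.
  by move=> t /andP[t0 _]; rewrite /= in_itv/= andbT; split => // _; exact: lt_le_trans t0.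
have [x1|x1] := ltP x 1.
  have [A bA hA] := arc_half_plane (introT andP (conj x0 x1)).
  by exists A => // t /hA; rewrite /= in_itv/= andbT.
exists set0 => // t /andP[_ t1]; rewrite /= in_itv/= andbT; split => //.
by move=> h; have := lt_trans h t1; rewrite ltNge x1.
Qed.

Lemma borel_approx (A0 : set (circle R)) : measurable A0 ->
  exists A AN, [/\ borel_circle A, borel_circle AN, mu AN = 0%E & forall g, ~ AN g -> (A0 g <-> A g)].
Proof.
move=> mA0.
have mp : measurable (param @^-1` A0 : set lebesgueR).
  by have := @measurable_circle_param R measurableT A0 mA0; rewrite setTI.
have : (completed_algebra_gen lambda) (param @^-1` A0).
  by rewrite -g_sigma_completed_algebra_genE completed_caratheodory_measurable.
move=> [X mX [N0 [N [mN NN0 NN]] E]].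
have [A bA hA] := borel_circle_pullback mX.
have [AN bAN hAN] := borel_circle_pullback mN.
exists A, AN; split => //.
  have [] // := @circle_null R AN N mN NN0 _.
  by move=> t t01 /(hAN t t01).
move=> g; have [t t01 <-] := param_surj g => nAN.
rewrite -[A0 (param t)]/((param @^-1` A0) t) -E; split.
  by move=> [/(hA t t01)//|/NN /(hAN t t01)/nAN].
by move=> /(hA t t01); left.
Qed.

Lemma borel_circle_measurable A : borel_circle A -> measurable A.
Proof.
apply: smallest_sub; first exact: sigma_algebra_measurable.
move=> _ [c [s [_ ->]]].
have [m1 _] : cmeas setT (fun g : circle R => val g * (val c)^*).
  exact: cmeasM (@cmeas_val R) (cmeas_cst _ _).
have := m1 measurableT `]s, +oo[%classic (measurable_itv _).
rewrite setTI; congr measurable; apply/seteqP; split => g /=; by rewrite in_itv/= andbT.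
Qed.

End HalfPlanes.

(** * Polynomials tending to a step function *)

Section StepPolynomials.
Variable R : realType.
Implicit Types (x y t r s : R).

Lemma bernoulli_le y n : 0 <= y <= 1 -> 1 - y *+ n <= (1 - y) ^+ n.
Proof.
move=> /andP[y0 y1]; elim: n => [|n ih]; first by rewrite mulr0n subr0 expr0.
rewrite exprS mulrS; apply: (@le_trans _ _ ((1 - y) * (1 - y *+ n))).
  have : 0 <= y * (y *+ n) by rewrite mulr_ge0// mulrn_wge0.
  lra.
by rewrite ler_wpM2l// subr_ge0.
Qed.

Lemma bernoulli_ge y n : 0 <= y -> 1 + y *+ n <= (1 + y) ^+ n.
Proof.
move=> y0; elim: n => [|n ih]; first by rewrite mulr0n addr0 expr0.
rewrite exprS mulrS; apply: (@le_trans _ _ ((1 + y) * (1 + y *+ n))).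
  have : 0 <= y * (y *+ n) by rewrite mulr_ge0// mulrn_wge0.
  lra.
by rewrite ler_wpM2l// addr_ge0.
Qed.

Lemma cvg_nat_geometric t : 0 <= t < 1 -> (t ^+ n *+ n) @[n --> \oo] --> (0 : R).
Proof.
(* By the inequality of means [t <= s ^+ 2], so [t ^+ n *+ n] is at most [s ^+ n *+ n], bounded by
   Bernoulli's inequality, times [s ^+ n]. *)
move=> /andP[t0 t1]; pose s := (1 + t) / 2.
have s0 : 0 < s by rewrite /s; lra.
have s1 : s < 1 by rewrite /s; lra.
have ts : t <= s ^+ 2.
  rewrite -subr_ge0 /s (_ : _ - _ = ((1 - t) / 2) ^+ 2) ?sqr_ge0//; by field.
pose q := s^-1 - 1.
have q0 : 0 < q by rewrite subr_gt0 invf_gt1.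
have hs n : s ^+ n *+ n <= q^-1.
  have h := bernoulli_ge n (ltW q0).
  have e : (1 + q) ^+ n = (s ^+ n)^-1 by rewrite /q addrC subrK exprVn.
  have sn : 0 < s ^+ n by rewrite exprn_gt0.
  have qn : q * n%:R <= (s ^+ n)^-1.
    by rewrite -e mulr_natr; apply: le_trans h; rewrite lerDr.
  rewrite -mulr_natr -[leRHS]mul1r ler_pdivlMr// -mulrA [n%:R * q]mulrC.
  have := ler_wpM2l (ltW sn) qn; by rewrite mulfV ?gt_eqF.
have up : (q^-1 * s ^+ n) @[n --> \oo] --> (0 : R).
  rewrite -(mulr0 q^-1); apply: cvgM; first exact: cvg_cst.
  by apply: cvg_expr; rewrite ger0_norm// ltW.
have nr : \forall n \near \oo, (0 : R) <= t ^+ n *+ n <= q^-1 * s ^+ n.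
  apply: nearW => n; rewrite mulrn_wge0 ?exprn_ge0//=.
  apply: (@le_trans _ _ ((s ^+ n *+ n) * s ^+ n)).
    rewrite mulrnAl lerMn2r; apply/orP; right.
    by rewrite -expr2 -exprM mulnC exprM lerXn2r ?nnegrE ?sqr_ge0.
  by rewrite ler_wpM2r// exprn_ge0// ltW.
exact: (squeeze_cvgr nr (cvg_cst _) up).
Qed.

(* Bernoulli: [(1 - t) ^+ m >= 1 - m * t] and [(1 - t) ^+ m * (1 + t) ^+ m <= 1]
   with [t = x ^+ n] and [m = n * 2 ^ n], so that [m * t = n * (2 * x) ^+ n]. *)
Lemma step_polynomial x : 0 <= x <= 1 ->
  ((1 - x ^+ n) ^+ (n * 2 ^ n)) @[n --> \oo] --> ((x < 2^-1)%R%:R : R).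
Proof.
move=> /andP[x0 x1].
have xn0 n : 0 <= x ^+ n by rewrite exprn_ge0.
have xn1 n : x ^+ n <= 1 by rewrite exprn_ile1.
have E n : x ^+ n *+ (n * 2 ^ n) = (2 * x) ^+ n *+ n.
  by rewrite mulnC mulrnA exprMn -[x ^+ n *+ _]mulr_natl natrX.
have [h|h] := ltP x 2^-1.
  have t01 : 0 <= 2 * x < 1 by apply/andP; split; lra.
  have lo : (1 - (2 * x) ^+ n *+ n) @[n --> \oo] --> (1 : R).
    rewrite -[X in _ --> X]subr0; apply: cvgB; [exact: cvg_cst|exact: cvg_nat_geometric].
  have nr : \forall n \near \oo, 1 - (2 * x) ^+ n *+ n <= (1 - x ^+ n) ^+ (n * 2 ^ n) <= 1.
    apply: nearW => n; rewrite -E bernoulli_le ?xn0 ?xn1//=.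
    by rewrite exprn_ile1 ?subr_ge0// lerBlDr lerDl.
  exact: (squeeze_cvgr nr lo (cvg_cst _)).
have up : (n.+1%:R^-1) @[n --> \oo] --> (0 : R) by exact: cvg_harmonic.
have nr : \forall n \near \oo, (0 : R) <= (1 - x ^+ n) ^+ (n * 2 ^ n) <= n.+1%:R^-1.
  apply: nearW => n; rewrite exprn_ge0 ?subr_ge0//=.
  set y := x ^+ n; set N := (n * 2 ^ n)%N.
  have y0 : 0 <= y := xn0 n. have y1 : y <= 1 := xn1 n.
  have hN : n.+1%:R <= (1 + y) ^+ N.
    apply: le_trans (bernoulli_ge N y0); rewrite /y E -natr1 addrC lerD2l.
    by rewrite -[leRHS]mulr_natl -[leLHS]mulr1 ler_wpM2l// exprn_ege1//; lra.
  have hp : (1 - y) ^+ N * (1 + y) ^+ N <= 1.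
    rewrite -exprMn exprn_ile1//; nra.
  have p0 : 0 < (1 + y) ^+ N by rewrite exprn_gt0// ltr_wpDr.
  rewrite -[leRHS]mul1r ler_pdivlMr//; apply: le_trans hp.
  by rewrite ler_wpM2l// exprn_ge0// subr_ge0.
exact: (squeeze_cvgr nr (cvg_cst _) up).
Qed.

Lemma affine_unit_itv r s : -1 <= r <= 1 -> -1 <= s <= 1 -> 0 <= 2^-1 - (r - s) / 4 <= 1.
Proof. by move=> /andP[? ?] /andP[? ?]; apply/andP; split; lra. Qed.

Lemma affine_ltr_half r s : (2^-1 - (r - s) / 4 < 2^-1) = (s < r).
Proof. by rewrite gtrBl pmulr_lgt0 ?invr_gt0// subr_gt0. Qed.

End StepPolynomials.

(** * From moments to indicator functions *)

Section MomentClass.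
Variable R : realType.
Local Notation C := (R[i]).
Local Notation mu := (@circle_measure R).
Implicit Types (g : circle R).

Lemma ccvg_le (T : Type) (F : set_system T) {FF : ProperFilter F} (f : T -> C) l (K : R) :
  ccvg F f l -> (\forall x \near F, normc (f x) <= K) -> normc l <= K.
Proof. by move=> fl fK; exact: (cvgr_to_le (cvg_normc fl) fK). Qed.

Lemma ccvg_bound (u : nat -> C) l (K : R) :
  ccvg \oo u l -> (forall n, normc (u n) <= K) -> normc l <= K.
Proof. by move=> ul uK; apply: ccvg_le ul _; exact: nearW. Qed.

Lemma cmeas_cvg (hn : nat -> circle R -> C) h : (forall n, cmeas setT (hn n)) ->
  (forall g, ccvg \oo (hn ^~ g) (h g)) -> cmeas setT h.
Proof.
move=> mh hc; split.
  apply: (measurable_fun_cvg (h := fun n g => Re (hn n g))) => [n|g _]; first by have [] := mh n.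
  exact: cvg_Re (hc g).
apply: (measurable_fun_cvg (h := fun n g => Im (hn n g))) => [n|g _]; first by have [] := mh n.
exact: cvg_Im (hc g).
Qed.

Variables (psi : circle R -> circle R) (U V : circle R -> C).
Hypotheses (mpsi : cmeas setT (fun g => val (psi g))) (bU : cbm U) (bV : cbm V).

(** Equality of all Fourier coefficients of [U] along [psi] and of [V] on the circle. For
    [U = V = 1] it leads to the invariance of the measure; for the boundary values of a function and
    of its average, to the conditional expectation. *)
Definition same_moments := forall n,
  Cint mu setT (fun g => U g * val (psi g) ^+ n) = Cint mu setT (fun g => V g * val g ^+ n) /\
  Cint mu setT (fun g => U g * (val (psi g))^* ^+ n) = Cint mu setT (fun g => V g * (val g)^* ^+ n).

Hypothesis mom : same_moments.

Lemma cbm_psi : cbm (fun g => val (psi g)).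
Proof. by split => //; exists 1 => g; rewrite normc_circle. Qed.

Lemma circle_cancel (x y : C) g : x * val g * ((val g)^* * y) = x * y.
Proof. by rewrite mulrA -(mulrA x) circle_mul_conj mulr1. Qed.

Lemma circle_cancel_conj (x y : C) g : x * (val g)^* * (val g * y) = x * y.
Proof. by rewrite mulrA -(mulrA x) (mulrC (_^*)) circle_mul_conj mulr1. Qed.

Definition balanced (k : circle R -> C) := [/\ cbm k, cbm (fun g => k (psi g)) &
  Cint mu setT (fun g => U g * k (psi g)) = Cint mu setT (fun g => V g * k g)].

Lemma balanced_lin (c : C) h k : balanced h -> balanced k -> balanced (fun g => c * h g + k g).
Proof.
move=> [h1 h2 h3] [k1 k2 k3].
have lin (W j l : circle R -> C) : cbm W -> cbm j -> cbm l ->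
    Cint mu setT (fun g => W g * (c * j g + l g)) =
    c * Cint mu setT (fun g => W g * j g) + Cint mu setT (fun g => W g * l g).
  move=> bW bj bl; have i1 := cbm_integrable (cbmM bW bj); have i2 := cbm_integrable (cbmM bW bl).
  rewrite -(CintZl c measurableT i1) -(CintD measurableT (CintegrableZl c measurableT i1) i2).
  by apply: eq_Cint => g _; rewrite mulrDr mulrCA.
have b1 : cbm (fun g => c * h g + k g) := cbmD (cbmM (cbm_cst c) h1) k1.
have b2 : cbm (fun g => c * h (psi g) + k (psi g)) := cbmD (cbmM (cbm_cst c) h2) k2.
split; [exact: b1|exact: b2|].
by rewrite (lin U (fun g => h (psi g)) (fun g => k (psi g)) bU h2 k2) (lin V h k bV h1 k1) h3 k3.
Qed.

Lemma balanced_lim (hn : nat -> circle R -> C) h (K : R) : (forall n, balanced (hn n)) ->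
  (forall n g, normc (hn n g) <= K) -> (forall g, ccvg \oo (hn ^~ g) (h g)) -> balanced h.
Proof.
move=> bhn hK hc.
have hb : cbm h.
  split; last by exists K => g; exact: ccvg_bound (hc g) (hK^~ g).
  by apply: (cmeas_cvg _ hc) => n; have [[]] := bhn n.
have hb' : cbm (fun g => h (psi g)).
  split; last by exists K => g; exact: ccvg_bound (hc (psi g)) (hK^~ (psi g)).
  apply: (@cmeas_cvg (fun n g => hn n (psi g))); last by move=> g; exact: hc.
  by move=> n; have [_ []] := bhn n.
have lim (W k : circle R -> C) (kn : nat -> circle R -> C) : cbm W -> cbm k -> (forall n, cbm (kn n)) ->
    (forall n g, normc (kn n g) <= K) -> (forall g, ccvg \oo (kn ^~ g) (k g)) ->
    ccvg \oo (fun n => Cint mu setT (fun g => W g * kn n g)) (Cint mu setT (fun g => W g * k g)).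
  move=> bW bk bkn knK knc; have [M hM] := bW.2.
  apply: (@Cint_circle_cvg _ _ _ (M * K)).
  - by move=> n; exact: (cbmM bW (bkn n)).1.
  - exact: (cbmM bW bk).1.
  - by move=> n g; rewrite normcM; apply: ler_pM; [exact: normc_ge0|exact: normc_ge0|exact: hM|exact: knK].
  - by apply: aeW => g; exact: ccvgM (ccvg_cst _) (knc g).
split; [exact: hb|exact: hb'|].
have l1 := lim U (fun g => h (psi g)) (fun n g => hn n (psi g)) bU hb'
  (fun n => let: And3 _ b _ := bhn n in b) (fun n g => hK n (psi g)) (fun g => hc (psi g)).
have l2 := lim V h hn bV hb (fun n => let: And3 b _ _ := bhn n in b) hK hc.
apply: (ccvg_unique l1); apply: (eq_ccvg _ l2) => n.
by destruct (bhn n) as [_ _ e]; rewrite e.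
Qed.

(* [b] tells apart the monomials in [gamma] and in its conjugate. *)
Definition monomial (b : bool) n g : C := if b then val g ^+ n else (val g)^* ^+ n.

(** Asking for all monomials at once makes the class stable under multiplication by [gamma] and by
    its conjugate, hence by trigonometric polynomials and by their bounded pointwise limits. *)
Definition moment_class (h : circle R -> C) := forall b n, balanced (fun g => h g * monomial b n g).

Lemma moment_class1 : moment_class (fun=> 1).
Proof.
move=> b n; have -> : (fun g => 1 * monomial b n g) = monomial b n by apply/funext => g; rewrite mul1r.
destruct (mom n) as [m1 m2]; case: b; split.
- exact: cbmX n (@cbm_val R).
- exact: cbmX n cbm_psi.
- exact: m1.
- exact: cbmX n (cbm_conj (@cbm_val R)).
- exact: cbmX n (cbm_conj cbm_psi).
- exact: m2.
Qed.

Lemma eq_moment_class h k : h =1 k -> moment_class h -> moment_class k.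
Proof. by move=> /funext ->. Qed.

Lemma moment_class_lin (c : C) h k : moment_class h -> moment_class k -> moment_class (fun g => c * h g + k g).
Proof.
move=> mh mk b n; have := balanced_lin c (mh b n) (mk b n); congr balanced.
by apply/funext => g; rewrite mulrDl mulrA.
Qed.

Lemma moment_class0 : moment_class (fun=> 0).
Proof. by apply: eq_moment_class (moment_class_lin (-1) moment_class1 moment_class1) => g; rewrite mulN1r addNr. Qed.

Lemma moment_classZ (c : C) h : moment_class h -> moment_class (fun g => c * h g).
Proof. by move=> mh; apply: eq_moment_class (moment_class_lin c mh moment_class0) => g; rewrite addr0. Qed.

Lemma moment_classB h k : moment_class h -> moment_class k -> moment_class (fun g => h g - k g).
Proof. by move=> mh mk; apply: eq_moment_class (moment_class_lin (-1) mk mh) => g; rewrite mulN1r addrC. Qed.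

Lemma moment_class_val h : moment_class h -> moment_class (fun g => h g * val g).
Proof.
move=> mh [] n.
  have := mh true n.+1; congr balanced; apply/funext => g.
  by rewrite /monomial exprS mulrA.
case: n => [|n].
  have := mh true 1%N; congr balanced; apply/funext => g.
  by rewrite /monomial expr1 expr0 mulr1.
have := mh false n; congr balanced; apply/funext => g.
by rewrite /monomial exprS circle_cancel.
Qed.

Lemma moment_class_conj h : moment_class h -> moment_class (fun g => h g * (val g)^*).
Proof.
move=> mh [] n; last first.
  have := mh false n.+1; congr balanced; apply/funext => g.
  by rewrite /monomial exprS mulrA.
case: n => [|n].
  have := mh false 1%N; congr balanced; apply/funext => g.
  by rewrite /monomial expr1 expr0 mulr1.
have := mh true n; congr balanced; apply/funext => g.
by rewrite /monomial exprS circle_cancel_conj.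
Qed.

Lemma moment_class_lim (hn : nat -> circle R -> C) h (K : R) : (forall n, moment_class (hn n)) ->
  (forall n g, normc (hn n g) <= K) -> (forall g, ccvg \oo (hn ^~ g) (h g)) -> moment_class h.
Proof.
move=> mhn hK hc b n; apply: (@balanced_lim (fun m g => hn m g * monomial b n g) _ K).
- by move=> m; exact: mhn.
- move=> m g; rewrite normcM /monomial.
  have -> : normc (if b then val g ^+ n else (val g)^* ^+ n) = 1.
    by case: b; rewrite normcX ?normc_conj normc_circle expr1n.
  by rewrite mulr1.
- by move=> g; exact: ccvgM (hc g) (ccvg_cst _).
Qed.

Lemma moment_class_cbm h : moment_class h -> cbm h.
Proof.
move=> mh; have [b _ _] := mh true 0%N; move: b; congr cbm.
by apply/funext => g; rewrite /monomial expr0 mulr1.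
Qed.

Lemma affine_regroup (A : comPzRingType) (e p q a a' b b' : A) :
  1 * (p * e) + (- q * b' * (e * a)) - q * b * (e * a') = e * (p - q * (a * b' + a' * b)).
Proof. by ring. Qed.

Lemma affine_cos (x y : C) (s : R) :
  (2^-1 - (Re (x * y^*) - s) / 4)%:C = (2^-1 + s / 4)%:C - (8^-1)%:C * (x * y^* + x^* * y).
Proof. by case: x y => [a b] [a' b']; simpc; congr (_ +i* _) => /=; field. Qed.

(** The function [x] is a trigonometric polynomial with values in [[0, 1]] that is below [2^-1]
    exactly on the half-plane; step polynomials in [x] tend boundedly to the indicator. *)
Lemma moment_class_half_plane c (s : R) h : -1 <= s <= 1 -> moment_class h ->
  moment_class (fun g => h g * (\1_(half_plane c s) g)%:C).
Proof.
move=> s12 mh.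
pose x g : R := 2^-1 - (Re (val g * (val c)^*) - s) / 4.
have x01 g : 0 <= x g <= 1.
  apply: affine_unit_itv => //; rewrite -ler_norml; apply: le_trans (normc_Re _) _.
  by rewrite normcM normc_conj !normc_circle mul1r.
have mx k : moment_class k -> moment_class (fun g => k g * (x g)%:C).
  move=> mk; have mk1 := moment_classZ (2^-1 + s / 4)%:C mk.
  have mk2 := moment_classZ (- (8^-1)%:C * (val c)^*) (moment_class_val mk).
  have mk3 := moment_classZ ((8^-1)%:C * val c) (moment_class_conj mk).
  apply: eq_moment_class (moment_classB (moment_class_lin 1 mk1 mk2) mk3) => g.
  by rewrite affine_cos; exact: affine_regroup.
have mxn k n : moment_class k -> moment_class (fun g => k g * (x g)%:C ^+ n).
  move=> mk; elim: n => [|n ih].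
    by apply: eq_moment_class mk => g; rewrite expr0 mulr1.
  by apply: eq_moment_class (mx _ ih) => g; rewrite exprSr mulrA.
have mq k n m : moment_class k -> moment_class (fun g => k g * (1 - (x g)%:C ^+ n) ^+ m).
  move=> mk; elim: m => [|m ih].
    by apply: eq_moment_class mk => g; rewrite expr0 mulr1.
  apply: eq_moment_class (moment_classB ih (mxn _ n ih)) => g.
  by rewrite exprSr mulrA mulrBr mulr1.
have [K hK] := (moment_class_cbm mh).2.
have qE n m g : (1 - (x g)%:C ^+ n) ^+ m = ((1 - x g ^+ n) ^+ m)%:C.
  have rX (t : R) k : (t ^+ k)%:C = t%:C ^+ k by exact: rmorphXn.
  have rB (t : R) : (1 - t)%:C = 1 - t%:C by exact: rmorphB.
  by rewrite rX rB rX.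
apply: (@moment_class_lim (fun n g => h g * (1 - (x g)%:C ^+ n) ^+ (n * 2 ^ n)) _ K).
- by move=> n; exact: mq.
- move=> n g; rewrite qE normcM normc_real -[leRHS]mulr1.
  have /andP[x0 x1] := x01 g.
  apply: ler_pM; [exact: normc_ge0|exact: normr_ge0|exact: hK|].
  rewrite ger0_norm; first by rewrite exprn_ile1 ?subr_ge0 ?exprn_ile1// lerBlDr lerDl exprn_ge0.
  by rewrite exprn_ge0// subr_ge0 exprn_ile1.
- move=> g; apply: ccvgM; first exact: ccvg_cst.
  have -> : \1_(half_plane c s) g = (x g < 2^-1)%R%:R :> R.
    rewrite indicE /x affine_ltr_half; congr ((nat_of_bool _)%:R).
    by apply/idP/idP; rewrite inE.
  apply: eq_ccvg (cvg_realC (step_polynomial (x01 g))) => n.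
  by rewrite qE.
Qed.

(** Quantifying over all [h] of the class makes the sets in question a sigma-algebra directly: an
    intersection is two successive multiplications, and a countable union is a bounded pointwise
    limit of finite ones. *)
Lemma moment_class_borel A h : borel_circle A -> moment_class h ->
  moment_class (fun g => h g * (\1_A g)%:C).
Proof.
pose S := [set A : set (circle R) | forall h, moment_class h -> moment_class (fun g => h g * (\1_A g)%:C)].
suff sub : borel_circle (R:=R) `<=` S by move=> bA; exact: (sub A bA h).
have S0 : S set0.
  by move=> k mk; apply: eq_moment_class (moment_classZ 0 mk) => g; rewrite indic0 mulr0 mul0r.
have SC B : S B -> S (setT `\` B).
  move=> SB k mk; have := moment_classB mk (SB k mk); congr moment_class; apply/funext => g.
  by rewrite setTD !indicE in_setC; case: (g \in B); rewrite /= ?mulr0 ?mulr1 ?subr0 ?subrr.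
have SI B B' : S B -> S B' -> S (B `&` B').
  move=> SB SB' k mk; have := SB' _ (SB k mk); congr moment_class; apply/funext => g.
  by rewrite !indicE in_setI; case: (g \in B); case: (g \in B'); rewrite /= ?mulr0 ?mulr1.
have SU B B' : S B -> S B' -> S (B `|` B').
  move=> SB SB'; have -> : B `|` B' = setT `\` ((setT `\` B) `&` (setT `\` B')).
    by rewrite !setTD -setCU setCK.
  exact: (SC _ (SI _ _ (SC _ SB) (SC _ SB'))).
rewrite /borel_circle; apply: smallest_sub; first (split; [exact: S0|exact: SC|]).
- move=> F SF k mk.
  pose G n := \big[setU/set0]_(i < n) F i.
  have SG n : S (G n).
    by rewrite /G; elim: n => [|n ih]; [rewrite big_ord0|rewrite big_ord_recr; exact: SU].
  have [K hK] := (moment_class_cbm mk).2.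
  apply: (@moment_class_lim (fun n g => k g * (\1_(G n) g)%:C) _ K).
  + by move=> n; exact: SG.
  + move=> n g; rewrite normcM normc_real -[leRHS]mulr1; apply: ler_pM => //; first exact: normc_ge0.
    by rewrite indicE; case: (_ \in _); rewrite ?normr1 ?normr0.
  + move=> g; apply: ccvgM; first exact: ccvg_cst.
    apply: cvg_realC; have [[i _ Fi]|nF] := pselect ((\bigcup_n F n) g).
      apply: cvg_near_cst; exists i.+1 => // n /= ni.
      rewrite !indicE !mem_set//; first by exists i.
      by rewrite /G -bigcup_mkord; exists i.
    apply: cvg_near_cst; apply: nearW => n; rewrite !indicE !memNset//.
    by rewrite /G -bigcup_mkord => -[i /= _ Fi]; apply: nF; exists i.
- by move=> _ [c [s [s12 ->]]] k mk; exact: moment_class_half_plane.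
Qed.

Lemma moment_indicator A : borel_circle A ->
  measurable_fun setT (fun g => \1_A (psi g) : R) /\
  Cint mu setT (fun g => U g * (\1_A (psi g))%:C) = Cint mu setT (fun g => V g * (\1_A g)%:C).
Proof.
move=> bA; have [_ b e] := moment_class_borel bA moment_class1 true 0%N.
have mE g : 1 * (\1_A g : R)%:C * monomial true 0 g = (\1_A g)%:C.
  by rewrite /monomial expr0 mulr1 mul1r.
split.
  have -> : (fun g => \1_A (psi g) : R) = (fun g => Re (1 * (\1_A (psi g))%:C * monomial true 0 (psi g))).
    by apply/funext => g; rewrite mE.
  exact: b.1.1.
transitivity (Cint mu setT (fun g => U g * (1 * (\1_A (psi g))%:C * monomial true 0 (psi g)))).
  by apply: eq_Cint => g _; rewrite mE.
by rewrite e; apply: eq_Cint => g _; rewrite mE.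
Qed.

End MomentClass.

(** * Invariance of the measure under the boundary map *)

Section Transport.
Variable R : realType.
Local Notation C := (R[i]).
Local Notation mu := (@circle_measure R).
Implicit Types (g : circle R) (A : set (circle R)).

Lemma circle_fin_num A : measurable A -> mu A \is a fin_num.
Proof.
move=> mA; rewrite ge0_fin_numE ?measure_ge0//; apply: le_lt_trans (ltry 1).
by rewrite -[leRHS](@circle_measure_setT R); apply: le_measure; rewrite ?inE.
Qed.

Lemma cbm_indic A : measurable A -> cbm (fun g => (\1_A g : R)%:C).
Proof.
move=> mA; apply: (@cbm_real R _ 1); first exact: measurable_indic.
by move=> g; rewrite indicE; case: (_ \in _); rewrite ?normr1 ?normr0.
Qed.

Lemma Cint_indic A : measurable A -> Cint mu setT (fun g => 1 * (\1_A g)%:C) = (fine (mu A))%:C.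
Proof.
move=> mA; rewrite /Cint; congr (_ +i* _).
  rewrite /Rintegral; under eq_integral do rewrite mul1r /=.
  by rewrite integral_indic// setIT.
rewrite /Rintegral; under eq_integral do rewrite mul1r /=.
by rewrite integral0.
Qed.

Lemma ae_notin A : measurable A -> mu A = 0%E -> {ae mu, forall g, ~ A g}.
Proof. by move=> mA A0; exists A; split => // g /= /contrapT. Qed.

Lemma circle_nullU A B D : measurable A -> measurable B -> mu A = 0%E -> mu B = 0%E ->
  D `<=` A `|` B -> measurable D /\ mu D = 0%E.
Proof.
move=> mA mB A0 B0; apply: circle_complete; first exact: measurableU.
apply/eqP; rewrite eq_le measure_ge0 andbT.
have : (mu (A `|` B) <= mu A + mu B)%E by exact: measureU2.
by rewrite A0 B0 adde0.
Qed.

Variables (psi : circle R -> circle R).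
Hypothesis mpsi : cmeas setT (fun g => val (psi g)).
Hypothesis mom1 : same_moments psi (fun=> 1) (fun=> 1).

Lemma borel_preimage A : borel_circle A ->
  measurable (psi @^-1` A) /\ mu (psi @^-1` A) = mu A.
Proof.
move=> bA; have mA := borel_circle_measurable bA.
have [m e] := moment_indicator mpsi (cbm_cst _) (cbm_cst _) mom1 bA.
have mpA : measurable (psi @^-1` A).
  have -> : psi @^-1` A = setT `&` (fun g => \1_A (psi g) : R) @^-1` [set 1].
    apply/seteqP; split => g /=; rewrite indicE.
      by move=> h; split => //; rewrite mem_set.
    by move=> [_]; case: (boolP (psi g \in A)) => [/set_mem//|_ /eqP]; rewrite eq_sym oner_eq0.
  exact: (m measurableT).
split=> //; move: e.
rewrite (Cint_indic mA) -[X in Cint _ _ X]/(fun g => 1 * (\1_(psi @^-1` A) g)%:C).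
by rewrite (Cint_indic mpA) => -[e1]; rewrite -(fineK (circle_fin_num mpA)) e1 fineK ?circle_fin_num.
Qed.

(** A measurable set agrees with a Borel one off a Borel null set [N]. The preimage of [N] is null
    by [borel_preimage], and completeness absorbs the difference. *)
Lemma transport_measurable A : measurable A -> measurable (psi @^-1` A).
Proof.
move=> mA; have [A' [N [bA' bN N0 AA']]] := borel_approx mA.
have [mN' N'0] := borel_preimage bN; have [mA'' _] := borel_preimage bA'.
rewrite N0 in N'0.
have m : measurable_fun setT (\1_(psi @^-1` A) : circle R -> R).
  have m1 : measurable_fun setT (\1_(psi @^-1` A') : circle R -> R) by exact: measurable_indic.
  apply: (measurable_ae_eq m1).
  apply: filterS (ae_notin mN' N'0) => g /= nN; rewrite !indicE.
  by congr ((nat_of_bool _)%:R); apply/idP/idP; rewrite !inE /= => /(AA' _ nN).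
have -> : psi @^-1` A = setT `&` (\1_(psi @^-1` A) : circle R -> R) @^-1` [set 1].
  apply/seteqP; split => g /=; rewrite indicE.
    by move=> h; split => //; rewrite mem_set.
  by move=> [_]; case: (boolP (g \in _)) => [/set_mem//|_ /eqP]; rewrite eq_sym oner_eq0.
exact: (m measurableT).
Qed.

Lemma transport_null A : measurable A -> mu A = 0%E -> mu (psi @^-1` A) = 0%E.
Proof.
move=> mA A0; have [A' [N [bA' bN N0 AA']]] := borel_approx mA.
have [mN' N'0] := borel_preimage bN; have [mA'' A''] := borel_preimage bA'.
have mA' := borel_circle_measurable bA'; have mN := borel_circle_measurable bN.
have [_ A'0] : measurable A' /\ mu A' = 0%E.
  apply: (circle_nullU mA mN A0 N0) => g A'g.
  by have [Ng|/AA' h] := pselect (N g); [right|left; apply/h].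
rewrite A'0 in A''; rewrite N0 in N'0.
have [] // := @circle_nullU _ _ (psi @^-1` A) mA'' mN' A'' N'0.
by move=> g /= Ag; have [Ng|/AA' h] := pselect (N (psi g)); [right|left; apply/h].
Qed.

Lemma transport_ae (P : circle R -> Prop) : {ae mu, forall g, P g} -> {ae mu, forall g, P (psi g)}.
Proof.
move=> [N [mN N0 PN]]; exists (psi @^-1` N); split.
- exact: transport_measurable.
- exact: transport_null.
- by move=> g /= nP; exact: PN.
Qed.

Lemma transport_Cint (U V : circle R -> C) A : cbm U -> cbm V -> same_moments psi U V -> measurable A ->
  Cint mu setT (fun g => U g * (\1_A (psi g))%:C) = Cint mu setT (fun g => V g * (\1_A g)%:C).
Proof.
move=> bU bV momUV mA; have [A' [N [bA' bN N0 AA']]] := borel_approx mA.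
have mN := borel_circle_measurable bN; have mA' := borel_circle_measurable bA'.
have [mA'' _] := borel_preimage bA'.
have AE : {ae mu, forall g, \1_A' g = \1_A g :> R}.
  apply: filterS (ae_notin mN N0) => g /= nN; rewrite !indicE.
  by congr ((nat_of_bool _)%:R); apply/idP/idP; rewrite !inE /= => /(AA' _ nN).
have [_ e] := moment_indicator mpsi bU bV momUV bA'.
have mpA := transport_measurable mA.
transitivity (Cint mu setT (fun g => U g * (\1_A' (psi g))%:C)).
  apply: (Cint_ae_eq measurableT).
  - exact: (cbmM bU (cbm_indic mpA)).1.
  - exact: (cbmM bU (cbm_indic mA'')).1.
  - by apply: filterS (transport_ae AE) => g /= -> _.
rewrite e; apply: (Cint_ae_eq measurableT).
- exact: (cbmM bV (cbm_indic mA')).1.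
- exact: (cbmM bV (cbm_indic mA)).1.
- by apply: filterS AE => g /= -> _.
Qed.

Lemma transport_measure A : measurable A -> mu (psi @^-1` A) = mu A.
Proof.
move=> mA; have := transport_Cint (cbm_cst _) (cbm_cst _) mom1 mA; have mpA := transport_measurable mA.
rewrite (Cint_indic mA) -[X in Cint _ _ X]/(fun g => 1 * (\1_(psi @^-1` A) g)%:C).
by rewrite (Cint_indic mpA) => -[e1]; rewrite -(fineK (circle_fin_num mpA)) e1 fineK ?circle_fin_num.
Qed.

Lemma transport_measurable_fun : measurable_fun setT psi.
Proof. by move=> _ A mA; rewrite setTI; exact: transport_measurable. Qed.

Lemma transport_integral (h : circle R -> \bar R) : measurable_fun setT h -> (forall g, (0 <= h g)%E) ->
  (\int[mu]_g h (psi g) = \int[mu]_g h g)%E.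
Proof.
move=> mh h0; have mp := transport_measurable_fun.
have e := ge0_integral_pushforward mp mu measurableT mh (fun y _ => h0 y).
apply: (etrans (esym e)); apply: (eq_measure_integral mu) => A mA _.
exact: (transport_measure mA).
Qed.

End Transport.

(** * Inner functions *)

Section InnerFunctions.
Variable R : realType.
Local Notation C := (R[i]).
Local Notation mu := (@circle_measure R).
Implicit Types (f h : C -> C) (z w : C) (g : circle R).

Definition shrink (n : nat) : R := 1 - n.+2%:R^-1.

Lemma shrink_gap n : 0 < (n.+2%:R^-1 : R) < 1.
Proof. by rewrite invr_gt0 ltr0n invf_lt1 ?ltr1n. Qed.

Lemma shrink_itv n : 0 < shrink n < 1.
Proof. by have /andP[h1 h2] := shrink_gap n; rewrite subr_gt0 h2 ltrBlDr ltrDl h1. Qed.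

Lemma shrink_cvg : shrink n @[n --> \oo] --> (1 : R).
Proof.
rewrite -[X in _ --> X]subr0; apply: cvgB; first exact: cvg_cst.
have h : (n.+1%:R^-1 : R) @[n --> \oo] --> (0 : R) by exact: cvg_harmonic.
by rewrite -(cvg_shiftS (fun n => n.+1%:R^-1 : R)) in h.
Qed.

Lemma nt_limit_radial f g w : nontangential_limit f g w ->
  ccvg \oo (fun n => f ((shrink n)%:C * val g)) w.
Proof.
move=> /nontangential_limitP h; apply/ccvgP => e e0.
have b1 : 1 < (2 : R) by rewrite ltr1n.
destruct (h 2 b1 _ e0) as [d d0 dP].
have := near_infty_natSinv_lt (PosNum d0); apply: filterS => n nd.
destruct (radial_stolz g (shrink_gap n) b1) as [z1 zb zt].
apply: (dP _ z1 zb); rewrite zt; apply: le_lt_trans nd.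
by rewrite lef_pV2 ?posrE// ler_nat.
Qed.

Lemma cmeas_ae_eq (h k : circle R -> C) : cmeas setT h -> {ae mu, forall g, h g = k g} -> cmeas setT k.
Proof.
move=> [m1 m2] e; split.
  by apply: (measurable_ae_eq m1); apply: filterS e => g ->.
by apply: (measurable_ae_eq m2); apply: filterS e => g ->.
Qed.

Lemma conjcX z n : (z ^+ n)^* = z^* ^+ n.
Proof. by elim: n => [|n ih]; [rewrite !expr0 conjc1|rewrite !exprS conjcM ih]. Qed.

(** The right-hand side is 1 for [n = 0] and 0 otherwise; this way of writing orthogonality matches
    the value of [phi ^+ n] at 0. *)
Lemma circle_power_mean n : Cint mu setT (fun g => val g ^+ n) = 0 ^+ n.
Proof.
have r1 : (1 : R) < 2 by rewrite ltr1n.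
rewrite -(@mean_value R (fun z => z ^+ n) 1 2 ler01 r1).
  by apply: eq_Cint => g _; rewrite mul1r.
by move=> z _; exact: cdiffX (cdiff_id z).
Qed.

Variable phi : C -> C.
Hypotheses (phi_inner : inner phi) (phi0 : phi 0 = 0).
Local Notation psi := (boundary_map phi).

Lemma inner_bounded : bounded_disc phi.
Proof.
have [h1 h2 _] := phi_inner; apply/bounded_analyticE; split => //.
by exists 1 => z /h2.
Qed.

Lemma inner_le1 z : normc z < 1 -> normc (phi z) <= 1.
Proof. by have [_ h _] := phi_inner; move=> /discE /h; rewrite normr_normc -[leRHS]/(1%:C) lecR. Qed.

Lemma boundary_mapE : {ae mu, forall g, val (psi g) = boundary_value phi g}.
Proof.
have [_ _] := phi_inner; apply: filterS => g h.
by rewrite /boundary_map insubdK// unfold_in /= h.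
Qed.

Lemma cmeas_boundary_map : cmeas setT (fun g => val (psi g)).
Proof.
apply: (cmeas_ae_eq (cbm_boundary_value inner_bounded).1).
by apply: filterS boundary_mapE => g ->.
Qed.

Lemma cbm_boundary_map : cbm (fun g => val (psi g)).
Proof. by split; [exact: cmeas_boundary_map|exists 1 => g; rewrite normc_circle]. Qed.

(** The power [phi ^+ n] is bounded and analytic, so the mean of its boundary value is its value at
    0. *)
Lemma boundary_map_moment n : Cint mu setT (fun g => val (psi g) ^+ n) = 0 ^+ n.
Proof.
rewrite -[in RHS]phi0 -(fatou_mean (bounded_discX n inner_bounded)).
apply: (Cint_ae_eq measurableT).
- exact: (cbmX n cbm_boundary_map).1.
- exact: (cbm_boundary_value (bounded_discX n inner_bounded)).1.
- by apply: filterS2 boundary_mapE (boundary_valueX n inner_bounded) => g -> -> _.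
Qed.

Lemma boundary_map_moments : same_moments psi (fun=> 1) (fun=> 1).
Proof.
have E (k : circle R -> C) : Cint mu setT (fun g => 1 * k g) = Cint mu setT k.
  by apply: eq_Cint => g _; rewrite mul1r.
have EX n (k : circle R -> C) : cbm k -> Cint mu setT (fun g => (k g)^* ^+ n) = (Cint mu setT (fun g => k g ^+ n))^*.
  move=> bk; rewrite -(Cint_conj measurableT (cbm_integrable (cbmX n bk))).
  by apply: eq_Cint => g _; rewrite conjcX.
move=> n; split.
  rewrite (E (fun g => val (psi g) ^+ n)) (E (fun g => val g ^+ n)).
  by rewrite boundary_map_moment circle_power_mean.
rewrite (E (fun g => (val (psi g))^* ^+ n)) (E (fun g => (val g)^* ^+ n)).
rewrite (EX n _ cbm_boundary_map) (EX n _ (@cbm_val R)).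
by rewrite boundary_map_moment circle_power_mean.
Qed.

Let mpsi := cmeas_boundary_map.
Let mom := boundary_map_moments.

(* If [|phi z| = 1], then the nonnegative function [1 - Re (conj (phi z) * phi)]
   has Poisson integral 0 at [z], hence mean 0, whereas its mean is its value 1
   at 0. *)
Lemma inner_lt1 z : normc z < 1 -> normc (phi z) < 1.
Proof.
move=> z1; rewrite lt_neqAle inner_le1// andbT; apply/negP => /eqP n1.
have bp := cbm_poisson_kernel z1; have bb := cbm_boundary_value inner_bounded.
(* The number [k] is a positive lower bound of the Poisson kernel at [z], as
   [normc (val g - z) <= 2]. *)
pose c := (phi z)^*; pose k := (1 - normc z ^+ 2) / 4.
pose F g := 1 - c * boundary_value phi g.
have z21 : 0 < 1 - normc z ^+ 2 by rewrite subr_gt0 expr_lt1// normc_ge0.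
have k0 : 0 < k by rewrite divr_gt0.
have bF : cbm F by exact: cbmB (cbm_cst _) (cbmM (cbm_cst _) bb).
have F0 g : 0 <= Re (F g).
  rewrite /F cReD cReN subr_ge0.
  have h1 := normc_Re (c * boundary_value phi g).
  have h2 : normc (c * boundary_value phi g) <= 1.
    rewrite normcM normc_conj n1 mul1r; apply: boundary_value_bound => w; exact: inner_le1.
  by apply: le_trans (ler_norm _) (le_trans h1 h2).
have Pk g : k <= poisson_kernel z g.
  rewrite /poisson_kernel ler_pM2l// lef_pV2 ?posrE//; last first.
    by rewrite exprn_gt0// normc_gt0 circle_neq_disc.
  have h : normc (val g - z) <= 2.
    by apply: le_trans (ler_normcB _ _) _; rewrite normc_circle; have := ltW z1; lra.
  by rewrite (_ : 4 = 2 ^+ 2 :> R) ?lerXn2r ?nnegrE ?normc_ge0//; rewrite expr2 -natrM.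
have bFP := cbmM bF bp; have bFk := cbmM bF (cbm_cst k%:C).
have e1 : Cint mu setT (fun g => F g * (poisson_kernel z g)%:C) = 0.
  transitivity (Cint mu setT (fun g => (poisson_kernel z g)%:C - c * (boundary_value phi g * (poisson_kernel z g)%:C))).
    by apply: eq_Cint => g _; rewrite /F mulrBl mul1r mulrA.
  rewrite (CintB measurableT (cbm_integrable bp) (CintegrableZl c measurableT (cbm_integrable (cbmM bb bp)))).
  rewrite poisson_kernel_mean// (CintZl c measurableT (cbm_integrable (cbmM bb bp))).
  by rewrite (fatou_poisson inner_bounded)// mulrC mulc_conj n1 expr1n subrr.
have e2 : Cint mu setT (fun g => F g * k%:C) = k%:C.
  transitivity (Cint mu setT (fun g => k%:C - (k%:C * c) * boundary_value phi g)).
    by apply: eq_Cint => g _; rewrite /F; ring.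
  rewrite (CintB measurableT (cbm_integrable (cbm_cst _)) (CintegrableZl _ measurableT (cbm_integrable bb))).
  rewrite Cint_circle_cst (CintZl _ measurableT (cbm_integrable bb)).
  by rewrite (fatou_mean inner_bounded) phi0 mulr0 subr0.
have : Re (Cint mu setT (fun g => F g * k%:C)) <= Re (Cint mu setT (fun g => F g * (poisson_kernel z g)%:C)).
  apply: le_Rintegral; [exact: measurableT|exact: (cbm_integrable bFk).1|exact: (cbm_integrable bFP).1|].
  move=> g _; rewrite !cReM /= !mulr0 !subr0.
  by apply: ler_wpM2l; [exact: F0|exact: Pk].
by rewrite e1 e2 /= leNgt k0.
Qed.

Lemma bounded_disc_inner f : bounded_disc f -> bounded_disc (fun z => f (phi z)).
Proof.
move=> [fd [M fM]]; split.
  move=> z z1; apply: (cdiff_comp (inner_bounded.1 z z1)); apply: fd; exact: inner_lt1.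
by exists M => z z1; apply: fM; exact: inner_lt1.
Qed.

Lemma bounded_disc_shrink f n : bounded_disc f -> bounded_disc (fun z => f ((shrink n)%:C * z)) /\
  forall w, normc w <= 1 -> cdiff (fun z => f ((shrink n)%:C * z)) w.
Proof.
move=> [fd [M fM]]; have /andP[s0 s1] := shrink_itv n.
have lt1 w : normc w <= 1 -> normc ((shrink n)%:C * w) < 1.
  move=> w1; rewrite normcM normc_real gtr0_norm//.
  by apply: le_lt_trans s1; rewrite -[leRHS]mulr1 ler_pM2l.
have cd w : normc w <= 1 -> cdiff (fun z => f ((shrink n)%:C * z)) w.
  move=> w1; apply: (@cdiff_comp _ (fun z => (shrink n)%:C * z) f).
    exact: cdiffM (cdiff_cst _ _) (cdiff_id _).
  by apply: fd; exact: lt1.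
split=> //; split; first by move=> w /ltW; exact: cd.
by exists M => w /ltW w1; apply: fM; exact: lt1.
Qed.

(** As [phi z] may approach [psi g] tangentially, nontangential limits do not compose. Dilations of
    [f] are continuous on the closed disc, where composition is harmless; letting them tend to [f]
    shows that [f \o phi] is the Poisson integral of [boundary_value f \o psi], and
    [poisson_nontangential] concludes. *)
Lemma boundary_value_comp f : bounded_disc f ->
  {ae mu, forall g, nontangential_limit (fun z => f (phi z)) g (boundary_value f (psi g))}.
Proof.
move=> bf; have [fd [M fM]] := bf.
have bV : cbm (fun g => boundary_value f (psi g)).
  have [[m1 m2] [K hK]] := cbm_boundary_value bf.
  have mp := transport_measurable_fun mpsi mom.
  split; last by exists K => g; exact: hK.
  by split; [exact: (measurableT_comp m1 mp)|exact: (measurableT_comp m2 mp)].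
apply: (poisson_nontangential bV) => z z1; have bp := cbm_poisson_kernel z1.
pose fn n (w : C) := f ((shrink n)%:C * phi w).
have bfn n : bounded_disc (fn n).
  exact: (bounded_disc_inner (bounded_disc_shrink n bf).1).
have hM n w : normc w < 1 -> normc (fn n w) <= M.
  move=> w1; apply: fM; have /andP[s0 s1] := shrink_itv n.
  rewrite normcM normc_real gtr0_norm// -[ltRHS]mulr1; apply: ltr_pM => //.
  - exact: ltW.
  - exact: normc_ge0.
  - exact: inner_lt1.
have bvn n : {ae mu, forall g, boundary_value (fn n) g = f ((shrink n)%:C * val (psi g))}.
  apply: filterS2 boundary_mapE (fatou_nt inner_bounded) => g e h.
  rewrite e; apply: boundary_valueE; apply: (@nt_limit_comp _ phi (fun z => f ((shrink n)%:C * z)) _ _ h).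
  apply: cdiff_continuous; apply: (bounded_disc_shrink n bf).2.
  by rewrite -e normc_circle.
have l1 : ccvg \oo (fun n => Cint mu setT (fun g => boundary_value (fn n) g * (poisson_kernel z g)%:C))
    (Cint mu setT (fun g => boundary_value f (psi g) * (poisson_kernel z g)%:C)).
  have [K hK] := bp.2.
  apply: (@Cint_circle_cvg _ _ _ (M * K)).
  - by move=> n; exact: (cbmM (cbm_boundary_value (bfn n)) bp).1.
  - exact: (cbmM bV bp).1.
  - move=> n g; rewrite normcM; apply: ler_pM; [exact: normc_ge0|exact: normc_ge0| |exact: hK].
    by apply: boundary_value_bound => w; exact: hM.
  - have h1 : {ae mu, forall g, forall n, boundary_value (fn n) g = f ((shrink n)%:C * val (psi g))}.
      exact: ae_foralln.
    (* Limits of [f] exist at almost every point of the circle; by invariance of the measure, they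
       exist at [psi g] for almost every [g]. *)
    have h2 := transport_ae mpsi mom (fatou_nt bf).
    apply: filterS2 h1 h2 => g h1 h2.
    apply: (ccvgM _ (ccvg_cst _)); apply: eq_ccvg (nt_limit_radial h2) => n.
    by rewrite h1.
have l2 : ccvg \oo (fun n => Cint mu setT (fun g => boundary_value (fn n) g * (poisson_kernel z g)%:C)) (f (phi z)).
  have E n : f ((shrink n)%:C * phi z) = Cint mu setT (fun g => boundary_value (fn n) g * (poisson_kernel z g)%:C).
    by rewrite (fatou_poisson (bfn n)).
  apply: (eq_ccvg E).
  have c1 : ccvg \oo (fun n => (shrink n)%:C * phi z) (phi z).
    by rewrite -[X in ccvg _ _ X](mul1r (phi z)); exact: (ccvgM (cvg_realC shrink_cvg) (ccvg_cst (phi z))).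
  have c2 := cdiff_continuous (fd _ (inner_lt1 z1)).
  move: c1 c2; rewrite /ccontinuous_at !ccvgE => c1 c2; exact: (cvg_comp _ _ c1 c2).
exact: (ccvg_unique l1 l2).
Qed.

End InnerFunctions.

(** * Cauchy transforms and averages along an inner function *)

Section CauchyTransform.
Variable R : realType.
Local Notation C := (R[i]).
Local Notation Co := (R[i]^o).
Local Notation mu := (@circle_measure R).
Implicit Types (f h : C -> C) (z w : C) (g : circle R) (u : circle R -> C).

Lemma cdiff_quadratic f z (Q : C) (d B : R) : 0 < d -> 0 <= B ->
  (forall w, normc (w - z) < d -> normc (f w - f z - Q * (w - z)) <= B * normc (w - z) ^+ 2) ->
  cdiff f z.
Proof.
move=> d0 B0 fB; exists (fun w => if w == z then Q else (f w - f z) / (w - z)); split; last first.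
  move=> w; case: eqVneq => [->|wz]; first by rewrite subrr mulr0 addr0.
  by rewrite divfK ?subr_eq0// addrC subrK.
rewrite /ccontinuous_at eqxx; apply/ccvgP => e e0.
have d'0 : 0 < Num.min d (e / (B + 1)).
  by rewrite lt_min d0 divr_gt0// ltr_wpDl.
apply/nbhs_normc; exists (Num.min d (e / (B + 1))) => // w; rewrite lt_min => /andP[wd we].
case: eqVneq => [_|wz]; first by rewrite subrr normc0.
have wz0 : w - z != 0 by rewrite subr_eq0.
have n0 : 0 < normc (w - z) by rewrite normc_gt0.
have -> : (f w - f z) / (w - z) - Q = (f w - f z - Q * (w - z)) / (w - z).
  by rewrite [RHS]mulrBl mulfK.
rewrite normcM normcV ltr_pdivrMr//; apply: (le_lt_trans (fB w wd)).
rewrite expr2 mulrA ltr_pM2r//.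
move: we; rewrite ltr_pdivlMr ?ltr_wpDl// => we; apply: le_lt_trans we.
by rewrite mulrC ler_wpM2l ?lerDl// ltW.
Qed.

(** The map [s] is [psi] for averages along the inner function and the identity for the classical
    transform; [inner_average] compares the two. *)
Definition cauchy_transform (s : circle R -> circle R) u w : C :=
  Cint mu setT (fun g => u g * cauchy_kernel w (s g)).

Lemma cauchy_kernel_taylor w z g : normc w < 1 -> normc z < 1 ->
  cauchy_kernel w g - cauchy_kernel z g =
    (w - z) * ((val g)^* * (cauchy_kernel w g * cauchy_kernel z g)).
Proof.
move=> w1 z1; pose proof (cauchy_den_neq0 g w1) as e1; pose proof (cauchy_den_neq0 g z1) as e2; move: e2 e1.
rewrite /cauchy_kernel => h1 h2; field; by rewrite h1 h2.
Qed.

Variables (s : circle R -> circle R) (u : circle R -> C).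
Hypotheses (ms : cmeas setT (fun g => val (s g))) (iu : Cintegrable mu setT u).

Lemma Cintegrable_normc : mu.-integrable setT (EFin \o (fun g => normc (u g))).
Proof.
have [i1 i2] := iu; have mn := measurable_normc (Cintegrable_cmeas iu).
apply: (@le_integrable _ _ _ mu setT measurableT (EFin \o (fun g => normc (u g)))
  (fun g => (`|Re (u g)| + `|Im (u g)|)%:E)).
- exact/measurable_EFinP.
- move=> g _ /=; rewrite lee_fin ger0_norm ?normc_ge0// [leRHS]ger0_norm ?addr_ge0//.
  exact: normc_le_ReIm.
- exact: (integrableD measurableT (integrable_abse i1) (integrable_abse i2)).
Qed.

Lemma CintegrableM_bounded (k : circle R -> C) (M : R) : cmeas setT k ->
  (forall g, normc (k g) <= M) -> Cintegrable mu setT (fun g => u g * k g).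
Proof.
move=> mk kM; apply: (@Cintegrable_bound _ _ _ _ _ _ (fun g => normc (u g) * M) measurableT).
- exact: cmeasM (Cintegrable_cmeas iu) mk.
- have := integrableZr measurableT M Cintegrable_normc; exact.
- by move=> g _; rewrite normcM ler_wpM2l ?normc_ge0.
Qed.

Lemma cmeas_cauchy_kernel w : cmeas setT (fun g => cauchy_kernel w (s g)).
Proof.
apply: (cmeasV measurableT); apply: (cmeasB (cmeas_cst _ _)).
exact: cmeasM (cmeas_cst _ _) (cmeas_conj ms).
Qed.

Lemma cauchy_transform_integrable w : normc w < 1 ->
  Cintegrable mu setT (fun g => u g * cauchy_kernel w (s g)).
Proof.
move=> w1; apply: (CintegrableM_bounded (M := (1 - normc w)^-1) (cmeas_cauchy_kernel w)) => g.
exact: normc_cauchy_kernel_le.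
Qed.

(** Differentiation under the integral, made explicit: the second-order remainder of the kernel is
    [(w - z) ^+ 2] times a function bounded by [d^-1 ^+ 3] while [w] stays within [d] of [z]. *)
Lemma cdiff_cauchy_transform : discdiff (cauchy_transform s u).
Proof.
(* Half the distance from [z] to the circle, so that the kernels at [z] and at nearby [w] are at
   most [d^-1]. *)
move=> z z1; pose d := (1 - normc z) / 2.
have d0 : 0 < d by rewrite divr_gt0// subr_gt0.
pose Q := Cint mu setT (fun g => u g * ((val (s g))^* * cauchy_kernel z (s g) ^+ 2)).
pose B := \int[mu]_g (normc (u g) * d^-1 ^+ 3).
have kd w g : normc (w - z) < d -> normc w < 1 /\ normc (cauchy_kernel w (s g)) <= d^-1.
  move=> wd; have wz : normc w < 1 - d.
    have -> : w = z + (w - z) by ring.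
    by apply: le_lt_trans (ler_normcD _ _) _; move: wd; rewrite /d; lra.
  have w1 : normc w < 1 by apply: lt_trans wz _; rewrite ltrBlDr ltrDl.
  split=> //; apply: le_trans (normc_cauchy_kernel_le (s g) w1) _.
  by rewrite lef_pV2 ?posrE ?subr_gt0//; move: wz; lra.
have kz g : normc (cauchy_kernel z (s g)) <= d^-1 by apply: (kd z g _).2; rewrite subrr normc0.
have iB : mu.-integrable setT (EFin \o (fun g => normc (u g) * d^-1 ^+ 3)).
  by have := integrableZr measurableT (d^-1 ^+ 3) Cintegrable_normc; exact.
have mz := cmeas_cauchy_kernel z.
have iQ : Cintegrable mu setT (fun g => u g * ((val (s g))^* * cauchy_kernel z (s g) ^+ 2)).
  apply: (CintegrableM_bounded (M := d^-1 ^+ 2)).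
    exact: cmeasM (cmeas_conj ms) (cmeasX 2 mz).
  move=> g; rewrite normcM normc_conj normc_circle mul1r normcX.
  by rewrite lerXn2r ?nnegrE ?normc_ge0 ?invr_ge0 ?(ltW d0).
apply: (@cdiff_quadratic _ z Q d B d0).
  apply: Rintegral_ge0 => g _; apply: mulr_ge0; first exact: normc_ge0.
  by apply: exprn_ge0; rewrite invr_ge0 (ltW d0).
move=> w wd; have [w1 _] := kd w (circle1 R) wd; have mw := cmeas_cauchy_kernel w.
have iw := cauchy_transform_integrable w1; have iz := cauchy_transform_integrable z1.
pose E g := (val (s g))^* ^+ 2 * (cauchy_kernel w (s g) * cauchy_kernel z (s g) ^+ 2).
have mE : cmeas setT E by exact: cmeasM (cmeasX 2 (cmeas_conj ms)) (cmeasM mw (cmeasX 2 mz)).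
have bE g : normc (E g) <= d^-1 ^+ 3.
  rewrite /E normcM normcX normc_conj normc_circle expr1n mul1r normcM normcX [leRHS]exprS.
  apply: ler_pM; [exact: normc_ge0|by rewrite exprn_ge0 ?normc_ge0|exact: (kd w g wd).2|].
  by rewrite lerXn2r ?nnegrE ?normc_ge0 ?invr_ge0 ?(ltW d0).
have iE := CintegrableM_bounded mE bE.
have -> : cauchy_transform s u w - cauchy_transform s u z - Q * (w - z) =
    (w - z) ^+ 2 * Cint mu setT (fun g => u g * E g).
  rewrite [Q * _]mulrC -(CintZl (w - z) measurableT iQ) -(CintZl ((w - z) ^+ 2) measurableT iE).
  rewrite -(CintB measurableT iw iz).
  rewrite -(CintB measurableT (CintegrableB measurableT iw iz) (CintegrableZl (w - z) measurableT iQ)).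
  apply: eq_Cint => g _; rewrite /E; have := cauchy_kernel_taylor (s g) w1 z1.
  move: (cauchy_kernel w (s g)) (cauchy_kernel z (s g)) (val (s g))^* (u g) => kw kz' v x e.
  transitivity (x * ((kw - kz') - (w - z) * v * kz' ^+ 2)); first by ring.
  rewrite e; transitivity (x * ((w - z) * v * kz' * (kw - kz'))); first by ring.
  by rewrite e; ring.
rewrite normcM normcX mulrC; apply: ler_wpM2r; first by rewrite exprn_ge0 ?normc_ge0.
apply: (normc_Cint_le measurableT iE iB) => g _.
by rewrite normcM ler_wpM2l ?normc_ge0.
Qed.

Lemma cauchy_transform0 : cauchy_transform s u 0 = Cint mu setT u.
Proof. by apply: eq_Cint => g _; rewrite /cauchy_kernel mul0r subr0 invr1 mulr1. Qed.

End CauchyTransform.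

(** * Cauchy and Poisson kernels along an inner function *)

Section InnerKernels.
Variable R : realType.
Local Notation C := (R[i]).
Local Notation Co := (R[i]^o).
Local Notation mu := (@circle_measure R).
Implicit Types (z w : C) (g : circle R).

Lemma nt_limit_id g : nontangential_limit (@id C) g (val g).
Proof.
rewrite nt_limit_ccvg => b b1; rewrite ccvgE; apply: cvg_within_filter; exact: cvg_id.
Qed.

Lemma boundary_map_id g : boundary_map (@id C) g = g.
Proof.
rewrite /boundary_map (boundary_valueE (@nt_limit_id g)); apply: val_inj.
by rewrite insubdK//; exact: (valP g).
Qed.

(** The results on [psi] are used a second time with the identity as inner function, on the side of
    the averaged function. *)
Lemma inner_id : inner (@id C).
Proof.
split.
- by apply/analytic_discdiff => z _; exact: cdiff_id.
- by move=> z /ltW.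
- by apply: aeW => g; rewrite (boundary_valueE (@nt_limit_id g)); apply/eqP; exact: (valP g).
Qed.

Variables (phi : C -> C).
Hypotheses (phi_inner : inner phi) (phi0 : phi 0 = 0).
Local Notation psi := (boundary_map phi).
Let mpsi := cmeas_boundary_map phi_inner.

Lemma cbm_kernel_inner w : normc w < 1 -> cbm (fun g => cauchy_kernel w (psi g)).
Proof.
move=> w1; split; first exact: (cmeas_cauchy_kernel mpsi w).
by exists (1 - normc w)^-1 => g; exact: normc_cauchy_kernel_le.
Qed.

Variable G : C -> C.
Hypothesis bG : bounded_disc G.
Local Notation U := (boundary_value G).
Let bU := cbm_boundary_value bG.

(** Along [psi] the conjugate kernel is the boundary value of [h], which is bounded and analytic
    with [h 0 = 1] because [phi 0 = 0]; the integral is the mean of the product of [G] and [h]. *)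
Lemma conj_kernel_inner w : normc w < 1 ->
  Cint mu setT (fun g => U g * (cauchy_kernel w (psi g))^*) = G 0.
Proof.
move=> w1; pose h z := (1 - w^* * phi z)^-1.
have d0 z : normc z < 1 -> 1 - normc w <= normc (1 - w^* * phi z).
  move=> z1; apply: (@le_trans _ _ (normc (1 : C) - normc (w^* * phi z))); last exact: lerB_normc.
  rewrite normcM normc_conj (_ : normc (1 : C) = 1) ?lerD2l ?lerN2; last first.
    by rewrite -[1 in LHS]/(1%:C) normc_real normr1.
  by rewrite -[leRHS]mulr1 ler_wpM2l ?normc_ge0 ?inner_le1.
have w1' : 0 < 1 - normc w by rewrite subr_gt0.
have bh : bounded_disc h.
  split.
    move=> z z1; apply: cdiffV.
      by rewrite -normc_gt0; exact: lt_le_trans w1' (d0 z z1).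
    exact: cdiffB (cdiff_cst _ _) (cdiffM (cdiff_cst _ _) ((inner_bounded phi_inner).1 z z1)).
  exists (1 - normc w)^-1 => z z1; rewrite /h normcV lef_pV2 ?posrE ?d0//.
  exact: lt_le_trans w1' (d0 z z1).
have h0 : h 0 = 1 by rewrite /h phi0 mulr0 subr0 invr1.
rewrite -[RHS]mulr1 -h0 -(fatou_mean (bounded_discM bG bh)).
apply: (Cint_ae_eq measurableT).
- exact: (cbmM bU (cbm_conj (cbm_kernel_inner w1))).1.
- exact: (cbm_boundary_value (bounded_discM bG bh)).1.
pose proof (boundary_mapE phi_inner) as a1. pose proof (fatou_nt (inner_bounded phi_inner)) as a2.
have a3 := boundary_valueM bG bh; apply: filterS3 a1 a2 a3 => g e1 e2 e3 _.
rewrite e3; congr (_ * _); apply/esym; rewrite -e1 in e2.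
have -> : (cauchy_kernel w (psi g))^* = (1 - w^* * val (psi g))^-1.
  exact: conj_cauchy_kernel.
have n0 : 1 - w^* * val (psi g) != 0.
  rewrite -[val _]conjcK' -conjcM -{1}conjc1 -conjcB.
  rewrite -normc_gt0 normc_conj normc_gt0; exact: cauchy_den_neq0.
apply: boundary_valueE; apply: (nt_limitV n0).
apply: (@nt_limit_comp _ phi (fun x => 1 - w^* * x) g _ e2).
apply: cdiff_continuous; exact: cdiffB (cdiff_cst _ _) (cdiffM (cdiff_cst _ _) (cdiff_id _)).
Qed.

(** In the splitting of the Poisson kernel, the conjugate kernel and the constant both integrate to
    [G 0] and cancel. The Cauchy transform is thus an integral against a positive kernel, of mean 1
    by [poisson_kernel_inner], so it inherits the bound of [U]. *)
Lemma poisson_transform w : normc w < 1 ->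
  Cint mu setT (fun g => U g * (poisson_kernel w (psi g))%:C) = cauchy_transform psi U w.
Proof.
move=> w1; have bk := cbm_kernel_inner w1.
have i1 := cbm_integrable (cbmM bU bk); have i2 := cbm_integrable (cbmM bU (cbm_conj bk)).
have i3 := cbm_integrable bU.
transitivity (Cint mu setT (fun g => U g * cauchy_kernel w (psi g) + (U g * (cauchy_kernel w (psi g))^* - U g))).
  by apply: eq_Cint => g _; rewrite poisson_cauchy//; ring.
rewrite (CintD measurableT i1 (CintegrableB measurableT i2 i3)) (CintB measurableT i2 i3).
by rewrite (conj_kernel_inner w1) (fatou_mean bG) subrr addr0.
Qed.

Lemma power_moment n : Cint mu setT (fun g => U g * val (psi g) ^+ n) = G 0 * 0 ^+ n.
Proof.
have bX := bounded_discX n (inner_bounded phi_inner).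
have -> : G 0 * 0 ^+ n = G 0 * phi 0 ^+ n by rewrite phi0.
rewrite -(fatou_mean (bounded_discM bG bX)).
apply: (Cint_ae_eq measurableT).
- exact: (cbmM bU (cbmX n (cbm_boundary_map phi_inner))).1.
- exact: (cbm_boundary_value (bounded_discM bG bX)).1.
pose proof (boundary_mapE phi_inner) as a1. pose proof (boundary_valueX n (inner_bounded phi_inner)) as a2.
have a3 := boundary_valueM bG bX; apply: filterS3 a1 a2 a3 => g e1 e2 e3 _.
by rewrite e3 e2 e1.
Qed.

End InnerKernels.

Section InnerAverage.
Variable R : realType.
Local Notation C := (R[i]).
Local Notation Co := (R[i]^o).
Local Notation mu := (@circle_measure R).
Implicit Types (z w : C) (g : circle R).
Variables (phi : C -> C).
Hypotheses (phi_inner : inner phi) (phi0 : phi 0 = 0).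
Local Notation psi := (boundary_map phi).

Lemma poisson_kernel_inner w : normc w < 1 ->
  Cint mu setT (fun g => (poisson_kernel w (psi g))%:C) = 1.
Proof.
move=> w1; have bk := cbm_kernel_inner phi_inner w1.
have b1 := bounded_disc_cst (1 : C).
have e1 : {ae mu, forall g, boundary_value (fun=> 1 : C) g = 1}.
  by apply: aeW => g; apply: boundary_valueE; exact: nt_limit_cst.
have bvE : boundary_value (fun=> 1 : C) = (fun=> 1).
  by apply/funext => g; apply: boundary_valueE; exact: nt_limit_cst.
have := conj_kernel_inner phi_inner phi0 b1 w1; rewrite bvE => e2.
have e3 : Cint mu setT (fun g => (cauchy_kernel w (psi g))^*) = 1.
  by rewrite -[RHS]e2; apply: eq_Cint => g _; rewrite mul1r.
have := poisson_transform phi_inner phi0 b1 w1; rewrite bvE => e4.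
transitivity (Cint mu setT (fun g => 1 * (poisson_kernel w (psi g))%:C)).
  by apply: eq_Cint => g _; rewrite mul1r.
rewrite e4; transitivity ((Cint mu setT (fun g => (cauchy_kernel w (psi g))^*))^*); last by rewrite e3 conjc1.
rewrite (Cint_conj measurableT (cbm_integrable bk)) conjcK'.
by apply: eq_Cint => g _; rewrite mul1r.
Qed.

(* [F] is the Cauchy transform of [G] along [psi]; the equality says that the
   boundary value of [F] is the conditional expectation of that of [G] given
   [psi]. *)
Lemma inner_average G : bounded_disc G -> exists F, [/\ bounded_disc F, F 0 = G 0 &
  forall A, measurable A -> Cint mu setT (fun g => boundary_value G g * (\1_A (psi g))%:C) =
    Cint mu setT (fun g => boundary_value F g * (\1_A g)%:C)].
Proof.
move=> bG; have bU := cbm_boundary_value bG; have mpsi := cmeas_boundary_map phi_inner.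
have iU := cbm_integrable bU.
pose U := boundary_value G; pose F := cauchy_transform psi U.
have F0 : F 0 = G 0 by rewrite /F cauchy_transform0 (fatou_mean bG).
have [M hM] := bU.2.
have bF : bounded_disc F.
  split; first exact: cdiff_cauchy_transform.
  exists M => w w1; rewrite /F -(poisson_transform phi_inner phi0 bG w1).
  have bP : cbm (fun g => (poisson_kernel w (psi g))%:C).
    have bk := cbm_kernel_inner phi_inner w1.
    have e : (fun g => (poisson_kernel w (psi g))%:C) = (fun g => cauchy_kernel w (psi g) + (cauchy_kernel w (psi g))^* - 1).
      by apply/funext => g; rewrite poisson_cauchy.
    by rewrite e; exact: cbmB (cbmD bk (cbm_conj bk)) (cbm_cst _).
  have iP := (CintegrableZl M%:C measurableT (cbm_integrable bP)).
  have iP' : mu.-integrable setT (EFin \o (fun g => M * poisson_kernel w (psi g))).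
    have e : (fun g => M * poisson_kernel w (psi g)) = (fun g => Re (M%:C * (poisson_kernel w (psi g))%:C)).
      by apply/funext => g; rewrite cReM /= mulr0 subr0.
    by rewrite e; exact: iP.1.
  apply: le_trans (normc_Cint_le measurableT (cbm_integrable (cbmM bU bP)) iP' _) _.
    move=> g _; have p0 := poisson_kernel_ge0 (psi g) w1.
    by rewrite normcM normc_real ger0_norm// ler_wpM2r.
  have : Re (Cint mu setT (fun g => M%:C * (poisson_kernel w (psi g))%:C)) = M.
    by rewrite (CintZl _ measurableT (cbm_integrable bP)) poisson_kernel_inner// mulr1.
  rewrite /Cint /= => e; rewrite -[leRHS]e le_eqVlt; apply/orP; left; apply/eqP.
  by apply: eq_Rintegral => g _; rewrite mul0r subr0.
exists F; split => // A mA; have bV := cbm_boundary_value bF; have iV := cbm_integrable bV.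
apply: (transport_Cint mpsi (boundary_map_moments phi_inner phi0) bU bV _ mA) => {A mA} n.
pose proof (@cmeas_val R) as mval.
have idE : boundary_map (@id C) = id by apply/funext => g; exact: boundary_map_id.
(* As a bounded analytic function, [F] is the Poisson integral of its own boundary value, hence also
   the Cauchy transform of it along the identity. *)
have E w : normc w < 1 -> cauchy_transform psi U w = cauchy_transform id (boundary_value F) w.
  move=> w1; have := poisson_transform (@inner_id R) erefl bF w1; rewrite idE => <-.
  by rewrite (fatou_poisson bF w1).
split.
  rewrite (power_moment phi_inner phi0 bG) -F0.
  by have := power_moment (@inner_id R) erefl bF n; rewrite idE => <-.
(* The moments against powers of the conjugate are the Taylor coefficients at 0 of the two Cauchy
   transforms; multiplying by the conjugate acts as the backward shift. *)
pose Un m g := U g * (val (psi g))^* ^+ m.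
pose Vn m g := boundary_value F g * (val g)^* ^+ m.
have iUn m : Cintegrable mu setT (Un m) := cbm_integrable (cbmM bU (cbmX m (cbm_conj (cbm_boundary_map phi_inner)))).
have iVn m : Cintegrable mu setT (Vn m) := cbm_integrable (cbmM bV (cbmX m (cbm_conj (@cbm_val R)))).
(* The kernel [k] at [w] satisfies [k = 1 + w * conj gamma * k], which splits off the coefficient of
   order 0. *)
have step (s : circle R -> circle R) u w m : cmeas setT (fun g => val (s g)) -> (forall m, Cintegrable mu setT (fun g => u g * (val (s g))^* ^+ m)) ->
    normc w < 1 -> cauchy_transform s (fun g => u g * (val (s g))^* ^+ m) w =
      Cint mu setT (fun g => u g * (val (s g))^* ^+ m) + w * cauchy_transform s (fun g => u g * (val (s g))^* ^+ m.+1) w.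
  move=> ms iu w1; rewrite /cauchy_transform.
  pose proof (cauchy_transform_integrable ms (iu m.+1) w1) as i1.
  rewrite -(CintZl w measurableT i1) -(CintD measurableT (iu m) (CintegrableZl w measurableT i1)).
  apply: eq_Cint => g _; have := cauchy_den_neq0 (s g) w1.
  by rewrite /cauchy_kernel exprS => h; field.
have EN m w : normc w < 1 -> cauchy_transform psi (Un m) w = cauchy_transform id (Vn m) w.
  elim: m w => [|m ih] w w1.
    have e1 : Un 0 = U by apply/funext => g; rewrite /Un expr0 mulr1.
    have e2 : Vn 0 = boundary_value F by apply/funext => g; rewrite /Vn expr0 mulr1.
    by rewrite e1 e2; exact: E.
  have ne x : normc x < 1 -> x != 0 -> cauchy_transform psi (Un m.+1) x = cauchy_transform id (Vn m.+1) x.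
    move=> x1 x0; apply: (mulfI x0).
    pose proof (step psi U x m mpsi iUn x1) as s1. pose proof (step id (boundary_value F) x m mval iVn x1) as s2.
    have := ih x x1; rewrite s1 s2.
    have -> : Cint mu setT (fun g => U g * (val (psi g))^* ^+ m) = Cint mu setT (fun g => boundary_value F g * (val (id g))^* ^+ m).
      by have := ih 0; rewrite normc0 => /(_ ltr01); rewrite !cauchy_transform0.
    by move=> /addrI.
  (* The factor [w] cannot be cancelled at 0; there the equality follows by continuity along
     [1 / (n + 2)]. *)
  have [->|] := eqVneq w 0; last exact: ne.
  have c1 := cdiff_continuous (@cdiff_cauchy_transform _ _ _ mpsi (iUn m.+1) 0 _).
  have c2 := cdiff_continuous (@cdiff_cauchy_transform _ _ _ mval (iVn m.+1) 0 _).
  rewrite normc0 in c1 c2.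
  have r0 : ccvg \oo (fun n => (n.+2%:R^-1)%:C) (0 : C).
    have h : (n.+2%:R^-1 : R) @[n --> \oo] --> (0 : R).
      have h : (n.+1%:R^-1 : R) @[n --> \oo] --> (0 : R) by exact: cvg_harmonic.
      by rewrite -(cvg_shiftS (fun n => n.+1%:R^-1 : R)) in h.
    exact: (cvg_realC h).
  have l1 : ccvg \oo (fun n => cauchy_transform psi (Un m.+1) (n.+2%:R^-1)%:C) (cauchy_transform psi (Un m.+1) 0).
    have := c1 ltr01; move: r0; rewrite /ccontinuous_at !ccvgE => r0 c; exact: (cvg_comp _ _ r0 c).
  have l2 : ccvg \oo (fun n => cauchy_transform id (Vn m.+1) (n.+2%:R^-1)%:C) (cauchy_transform id (Vn m.+1) 0).
    have := c2 ltr01; move: r0; rewrite /ccontinuous_at !ccvgE => r0 c; exact: (cvg_comp _ _ r0 c).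
  apply: (ccvg_unique l1); apply: eq_ccvg l2 => k; apply/esym; apply: ne.
    by have /andP[h1 h2] := shrink_gap R k; rewrite normc_real gtr0_norm.
  by rewrite -normc_gt0 normc_real; have /andP[h1 _] := shrink_gap R k; rewrite gtr0_norm.
by have := EN n 0; rewrite normc0 => /(_ ltr01); rewrite !cauchy_transform0.
Qed.

End InnerAverage.

(** * Outer functions and the Smirnov class *)

Section Herglotz.
Variable R : realType.
Local Notation C := (R[i]).
Local Notation Co := (R[i]^o).
Local Notation mu := (@circle_measure R).
Implicit Types (f : C -> C) (z w : C) (g : circle R) (u v : circle R -> R).

(** The exponent in the definition of [outer], for [u] the logarithm of the boundary modulus; its
    real part is the Poisson integral of [u]. *)
Definition herglotz u z : C :=
  Cint mu setT (fun g => (val g + z) / (val g - z) * (u g)%:C).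

Lemma mulr1_inv (x y : C) : x * y = 1 -> y^-1 = x.
Proof.
move=> xy; have y0 : y != 0 by apply/eqP => y0; move: xy; rewrite y0 mulr0 => /esym/eqP; rewrite oner_eq0.
by apply: (mulIf y0); rewrite mulVf.
Qed.

Lemma herglotz_kernel z g : normc z < 1 ->
  (val g + z) / (val g - z) = 2 * cauchy_kernel z g - 1.
Proof.
move=> z1; rewrite /cauchy_kernel cauchy_kernelE invfM (mulr1_inv (circle_mul_conj g)).
have := circle_neq_disc g z1; move: (val g) => x h; by field.
Qed.

Lemma Re_herglotz_kernel z g : normc z < 1 -> Re ((val g + z) / (val g - z)) = poisson_kernel z g.
Proof.
move=> z1; rewrite (herglotz_kernel g z1).
have := congr1 (@complex.Re R) (poisson_cauchy g z1); rewrite [LHS]/= => ->.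
by rewrite !(cReD, cReN, cReM) /=; case: (cauchy_kernel z g) => a b /=; ring.
Qed.

Definition rintegrable u := mu.-integrable setT (EFin \o u).

Lemma rintegrable_complex u : rintegrable u -> Cintegrable mu setT (fun g => (u g)%:C).
Proof. by move=> iu; split; [exact: iu|exact: circle_cst_integrable]. Qed.

Lemma herglotz_integrable u z : rintegrable u -> normc z < 1 ->
  Cintegrable mu setT (fun g => (val g + z) / (val g - z) * (u g)%:C).
Proof.
move=> iu z1; have iuC := rintegrable_complex iu.
have i1 := cauchy_transform_integrable (@cmeas_val R) iuC z1.
have -> : (fun g => (val g + z) / (val g - z) * (u g)%:C) =
    (fun g => 2 * ((u g)%:C * cauchy_kernel z g) - (u g)%:C).
  by apply/funext => g; rewrite (herglotz_kernel g z1); ring.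
exact: (CintegrableB measurableT (CintegrableZl 2 measurableT i1) iuC).
Qed.

Lemma herglotz_cauchy u z : rintegrable u -> normc z < 1 ->
  herglotz u z = 2 * cauchy_transform id (fun g => (u g)%:C) z - Cint mu setT (fun g => (u g)%:C).
Proof.
move=> iu z1; have iuC := rintegrable_complex iu.
have i1 := cauchy_transform_integrable (@cmeas_val R) iuC z1.
rewrite /cauchy_transform -(CintZl 2 measurableT i1) -(CintB measurableT (CintegrableZl 2 measurableT i1) iuC).
by apply: eq_Cint => g _; rewrite (herglotz_kernel g z1); ring.
Qed.

Lemma near_disc z : normc z < 1 -> \forall w \near (z : Co), normc w < 1.
Proof.
move=> z1; apply/nbhs_normc; exists (1 - normc z); first by rewrite subr_gt0.
move=> w wz; have -> : w = z + (w - z) by ring.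
by apply: le_lt_trans (ler_normcD _ _) _; rewrite addrC -ltrBrDr.
Qed.

Lemma herglotz_discdiff u : rintegrable u -> discdiff (herglotz u).
Proof.
move=> iu z z1; have iuC := rintegrable_complex iu.
have h := cdiff_cauchy_transform (@cmeas_val R) iuC z1.
apply: (near_cdiff _ (cdiffB (cdiffM (cdiff_cst 2 z) h) (cdiff_cst (Cint mu setT (fun g => (u g)%:C)) z))).
by apply: filterS (near_disc z1) => w w1; rewrite (herglotz_cauchy iu w1).
Qed.

Lemma Re_herglotz u z : normc z < 1 -> Re (herglotz u z) = \int[mu]_g (poisson_kernel z g * u g).
Proof.
move=> z1; rewrite /herglotz /Cint [LHS]/=; apply: eq_Rintegral => g _.
by rewrite cReM -(Re_herglotz_kernel g z1) /= mulr0 subr0.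
Qed.

Lemma le_Re_herglotz u v z : rintegrable u -> rintegrable v -> normc z < 1 ->
  (forall g, u g <= v g) -> Re (herglotz u z) <= Re (herglotz v z).
Proof.
move=> iu iv z1 uv; have iP (x : circle R -> R) : rintegrable x -> rintegrable (fun g => poisson_kernel z g * x g).
  move=> iw; have := (herglotz_integrable iw z1).1; congr (mu.-integrable setT (EFin \o _)).
  by apply/funext => g; rewrite cReM -(Re_herglotz_kernel g z1) /= mulr0 subr0.
rewrite !Re_herglotz//; apply: (le_Rintegral measurableT (iP u iu) (iP v iv)) => g _.
by rewrite ler_wpM2l// poisson_kernel_ge0.
Qed.

Lemma Re_herglotz_cst (c : R) z : normc z < 1 -> Re (herglotz (fun=> c) z) = c.
Proof.
move=> z1; rewrite Re_herglotz//.
have := congr1 (@complex.Re R) (CintZl c%:C measurableT (cbm_integrable (cbm_poisson_kernel z1))).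
rewrite (poisson_kernel_mean z1) mulr1 => e; apply: etrans e; rewrite /Cint [RHS]/=.
by apply: eq_Rintegral => g _ /=; rewrite mul0r subr0 mulrC.
Qed.

Lemma herglotz0 u : herglotz u 0 = (\int[mu]_g u g)%:C.
Proof.
rewrite /herglotz.
have E : Cint mu setT (fun g => (val g + 0) / (val g - 0) * (u g)%:C) = Cint mu setT (fun g => (u g)%:C).
  apply: eq_Cint => g _; rewrite addr0 subr0 divff ?mul1r//.
  by rewrite -normc_gt0 normc_circle.
by rewrite E /Cint /=; congr (_ +i* _); exact: circle_Rint_cst.
Qed.

(* The roots [A n = exp (f / (n + 1))] vanish on the boundary where [exp f] does,
   so [|A n 0|] is at most the measure of the complement of this set; and
   [A n 0] tends to 1. *)
Lemma exp_boundary_neq0 f : discdiff f -> (forall z, normc z < 1 -> Re (f z) <= 0) ->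
  bounded_disc (fun z => cexp (f z)) /\
  {ae mu, forall g, boundary_value (fun z => cexp (f z)) g != 0}.
Proof.
move=> fd f0.
pose A n z := cexp ((n.+1%:R^-1)%:C * f z).
have bA n : bounded_disc (A n).
  split.
    move=> z z1; apply: (@cdiff_comp _ (fun z => (n.+1%:R^-1)%:C * f z) (@cexp R)); last exact: cdiff_cexp.
    exact: cdiffM (cdiff_cst _ _) (fd z z1).
  exists 1 => z z1; rewrite normc_cexp -expR0 ler_expR cReM /= mul0r subr0.
  by rewrite mulr_ge0_le0 ?invr_ge0// f0.
have A1 n z : normc z < 1 -> normc (A n z) <= 1.
  move=> z1; rewrite normc_cexp -expR0 ler_expR cReM /= mul0r subr0.
  by rewrite mulr_ge0_le0 ?invr_ge0// f0.
have cexpn z n : cexp z ^+ n = cexp (n%:R * z).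
  elim: n => [|n ih]; first by rewrite expr0 mul0r cexp0.
  by rewrite exprS ih -cexpD -natr1; congr cexp; ring.
have AX n z : A n z ^+ n.+1 = cexp (f z).
  rewrite /A cexpn mulrA.
  have -> : n.+1%:R * (n.+1%:R^-1)%:C = 1 :> C by rewrite fmorphV/= rmorph_nat mulfV// pnatr_eq0.
  by rewrite mul1r.
have eA : A 0%N = (fun z => cexp (f z)).
  by apply/funext => z; rewrite -(AX 0%N z) expr1.
split; first by rewrite -eA; exact: bA.
pose B := boundary_value (fun z => cexp (f z)).
have bB : cbm B by rewrite /B -eA; exact: cbm_boundary_value.
pose Z := [set g | B g = 0].
have mZ : measurable Z.
  have -> : Z = (setT `&` (fun g => Re (B g)) @^-1` [set 0]) `&` (setT `&` (fun g => Im (B g)) @^-1` [set 0]).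
    apply/seteqP; split => g; rewrite /Z/=; first by move=> ->.
    by case: (B g) => a b [[_ /= ->] [_ /= ->]].
  by apply: measurableI; [apply: bB.1.1|apply: bB.1.2].
have mZC : measurable (~` Z) by exact: measurableC.
have bI := cbm_indic mZC.
have iI : mu.-integrable setT (EFin \o (\1_(~` Z) : circle R -> R)) := (cbm_integrable bI).1.
have le n : normc (A n 0) <= fine (mu (~` Z)).
  have bAn := cbm_boundary_value (bA n).
  rewrite -(fatou_mean (bA n)).
  have -> : Cint mu setT (boundary_value (A n)) = Cint mu setT (fun g => boundary_value (A n) g * (\1_(~` Z) g)%:C).
    apply: (Cint_ae_eq measurableT bAn.1 (cbmM bAn bI).1).
    apply: filterS (boundary_valueX n.+1 (bA n)) => g e _.
    rewrite indicE; case: (boolP (g \in ~` Z)) => h; first by rewrite mulr1.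
    rewrite mulr0; have Zg : B g = 0 by apply: contrapT => h'; move/negP: h; apply; rewrite inE.
    have e0 : boundary_value (A n) g ^+ n.+1 = 0.
      by rewrite -e -Zg /B; congr boundary_value; apply/funext => z; exact: AX.
    by have := e0 => /eqP; rewrite expf_eq0 /= => /eqP.
  have -> : fine (mu (~` Z)) = \int[mu]_g (\1_(~` Z) g).
    by rewrite /Rintegral integral_indic// setIT.
  apply: (normc_Cint_le measurableT (cbm_integrable (cbmM bAn bI)) iI) => g _.
  rewrite normcM normc_real ger0_norm; last by rewrite indicE.
  rewrite -[leRHS]mul1r; apply: ler_wpM2r; first by rewrite indicE.
  by apply: boundary_value_bound => z; exact: A1.
have lim : ccvg \oo (fun n => A n 0) 1.
  have c0 : ccvg \oo (fun n => (n.+1%:R^-1)%:C * f 0) (0 : C).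
    have h : (n.+1%:R^-1 : R) @[n --> \oo] --> (0 : R) by exact: cvg_harmonic.
    by rewrite -[X in ccvg _ _ X](mul0r (f 0)); exact: (ccvgM (cvg_realC h) (ccvg_cst _)).
  have := cdiff_continuous (cdiff_cexp (0 : C)); rewrite /ccontinuous_at cexp0.
  move: c0; rewrite !ccvgE => c0 c; exact: (cvg_comp _ _ c0 c).
have := ccvg_bound lim le; rewrite (_ : normc (1 : C) = 1); last first.
  by rewrite -[1 in LHS]/(1%:C) normc_real normr1.
move=> h1; have mZ0 : mu Z = 0%E.
  have h2 : (1 <= mu (~` Z))%E by rewrite -(fineK (circle_fin_num mZC)) lee_fin.
  have h3 : (mu Z + mu (~` Z) = 1)%E.
    rewrite -(@circle_measure_setT R) -(setUv Z) measureU//; exact: setICr.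
  apply/eqP; rewrite eq_le measure_ge0 andbT.
  have h4 : (mu Z + 1 <= 1)%E by rewrite -[leRHS]h3 leeD2l.
  move: h4; rewrite -(fineK (circle_fin_num mZ)) -EFinD !lee_fin.
  by rewrite gerDr.
by apply: filterS (ae_notin mZ mZ0) => g nZ; apply/eqP.
Qed.

End Herglotz.

(** * Clearing denominators in the Smirnov class *)

Section SmirnovQuotients.
Variable R : realType.
Local Notation C := (R[i]).
Local Notation Co := (R[i]^o).
Local Notation mu := (@circle_measure R).
Implicit Types (f : C -> C) (z w : C) (g : circle R) (u v : circle R -> R).

Lemma rintegrableD u v : rintegrable u -> rintegrable v -> rintegrable (fun g => u g + v g).
Proof. by move=> iu iv; exact: (integrableD measurableT iu iv). Qed.

Lemma rintegrable_le u v : measurable_fun setT u -> rintegrable v ->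
  (forall g, `|u g| <= v g) -> rintegrable u.
Proof.
move=> mu_ iv uv; apply: (le_integrable measurableT _ _ iv); first exact/measurable_EFinP.
by move=> g _ /=; rewrite lee_fin (le_trans (uv g))// ler_norm.
Qed.

Lemma rintegrable_norm u : rintegrable u -> rintegrable (fun g => `|u g|).
Proof. by move=> iu; exact: (integrable_abse iu). Qed.

Lemma rintegrable_sum (I : Type) (s : seq I) (F : I -> circle R -> R) :
  (forall i, rintegrable (F i)) -> rintegrable (fun g => \sum_(i <- s) F i g).
Proof.
move=> iF; elim: s => [|i s ih].
  by under eq_fun do rewrite big_nil; exact: circle_cst_integrable.
by under eq_fun do rewrite big_cons; exact: rintegrableD (iF i) ih.
Qed.

Lemma herglotzD u v z : rintegrable u -> rintegrable v -> normc z < 1 ->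
  herglotz (fun g => u g + v g) z = herglotz u z + herglotz v z.
Proof.
move=> iu iv z1; rewrite /herglotz.
rewrite -(CintD measurableT (herglotz_integrable iu z1) (herglotz_integrable iv z1)).
by apply: eq_Cint => g _; rewrite rmorphD mulrDr.
Qed.

(** Keeps of the quotient what the construction of multipliers uses: the numerator is bounded by
    [M], and the outer denominator has modulus [expR (Re (herglotz l z))] with [l] the logarithm of
    its boundary modulus. *)
Lemma smirnov_bound f : smirnov f -> discdiff f /\ exists l (M : R), [/\ rintegrable l, 0 <= M &
  forall z, normc z < 1 -> normc (f z) <= M * expR (- Re (herglotz l z))].
Proof.
move=> sf; destruct sf as [fd0 [a [b [ba _ [c [k [c1 k0 ik bE]]] fE]]]].
destruct ((bounded_analyticE a).1 ba) as [_ [M aM]].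
pose proof ((analytic_discdiff f).1 fd0) as fd.
split=> //; exists (fun g => ln (k g)), M; split=> //.
  by apply: le_trans (aM 0 _); rewrite ?normc_ge0// normc0.
move=> z z1; have dz : disc z by apply/discE.
have nc : normc c = 1.
  by move/(congr1 (@complex.Re R)): c1; rewrite normr_normc.
rewrite (fE z dz) (bE z dz) normcM normcV normcM nc mul1r normc_cexp expRN.
by rewrite ler_wpM2r ?invr_ge0 ?expR_ge0// aM.
Qed.

Lemma smirnov_bounded_disc f : bounded_disc f -> smirnov f.
Proof.
move=> bf; split; first by apply/analytic_discdiff; exact: bf.1.
exists f, (fun=> 1); split.
- exact/bounded_analyticE.
- by apply/bounded_analyticE; exact: bounded_disc_cst.
- exists 1, (fun=> 1); split => //.
  + exact: normr1.
  + by rewrite ln1; exact: circle_cst_integrable.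
  + move=> z dz; rewrite mul1r ln1.
    have -> : (fun g : circle R => (val g + z) / (val g - z) * 0%:C) = (fun=> 0).
      by apply/funext => g; rewrite mulr0.
    by have := Cint_circle_cst (0 : C); rewrite /Cint => h; rewrite /cintegral h cexp0.
- by move=> z _; rewrite divr1.
Qed.

(* [B n] is the outer function with boundary modulus
   [\prod_j Num.min 1 (e ^ n * k j)], where [k j] is the boundary modulus of the
   denominator of [F j]. *)
Lemma smirnov_bounded (N : nat) (F : 'I_N -> C -> C) : (forall j, smirnov (F j)) ->
  exists B : nat -> C -> C, [/\ forall n, bounded_disc (B n),
    forall n z, normc z < 1 -> normc (B n z) <= 1,
    ccvg \oo (fun n => B n 0) 1,
    forall n j, bounded_disc (fun z => B n z * F j z) &
    forall n j, {ae mu, forall g, boundary_value (fun z => B n z * F j z) g =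
       boundary_value (B n) g * boundary_value (F j) g}].
Proof.
move=> sF; have fd j : discdiff (F j) by have [] := smirnov_bound (sF j).
have /choice[l hl] : forall j, exists l : circle R -> R, rintegrable l /\ exists2 M : R, 0 <= M &
    forall z, normc z < 1 -> normc (F j z) <= M * expR (- Re (herglotz l z)).
  by move=> j; have [_ [l [M [h1 h2 h3]]]] := smirnov_bound (sF j); exists l; split => //; exists M.
have il j : rintegrable (l j) := (hl j).1.
(* The inequality [m n j <= n + l j] will make the multiplier times [F j] bounded, by [M * expR n];
   and at each point [m n j] is 0 once [n] exceeds [- l j], so the exponents tend to 0. *)
pose m n j g : R := Num.min 0 (n%:R + l j g).
pose u n g := \sum_j m n j g.
have m0 n j g : m n j g <= 0 by rewrite /m ge_min lexx.
have mb n j g : `|m n j g| <= `|l j g|.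
  rewrite ler0_norm ?m0// /m; case: (leP 0 (n%:R + l j g)) => [_|h]; first by rewrite oppr0.
  have n0 : 0 <= n%:R :> R by [].
  have l0 : l j g < 0 by apply: le_lt_trans h; rewrite lerDr.
  by rewrite (ltr0_norm l0) lerN2 lerDr.
have mm n j : measurable_fun setT (m n j).
  apply: measurable_minr; first exact: measurable_cst.
  apply: measurable_funD; first exact: measurable_cst.
  by apply/measurable_EFinP; exact: measurable_int (il j).
have im n j : rintegrable (m n j) := rintegrable_le (mm n j) (rintegrable_norm (il j)) (mb n j).
have iu n : rintegrable (u n) := rintegrable_sum _ (im n).
have u0 n g : u n g <= 0 by apply: sumr_le0 => j _.
have Hd n : discdiff (herglotz (u n)) := herglotz_discdiff (iu n).
have H0 n z : normc z < 1 -> Re (herglotz (u n) z) <= 0.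
  move=> z1; rewrite -[leRHS](Re_herglotz_cst 0 z1).
  exact: (le_Re_herglotz (iu n) (circle_cst_integrable 0) z1 (u0 n)).
have HB n := exp_boundary_neq0 (Hd n) (H0 n).
have bBF n j : bounded_disc (fun z => cexp (herglotz (u n) z) * F j z).
  split; first by move=> z z1; exact: cdiffM ((HB n).1.1 z z1) (fd j z z1).
  have [_ [M M0 FM]] := hl j; exists (M * expR n%:R) => z z1.
  rewrite normcM normc_cexp.
  apply: (@le_trans _ _ (expR (Re (herglotz (u n) z)) * (M * expR (- Re (herglotz (l j) z))))).
    by rewrite ler_wpM2l ?expR_ge0// FM.
  rewrite mulrCA -expRD ler_wpM2l// ler_expR lerBlDr.
  have in_ : rintegrable (fun g => n%:R + l j g) := rintegrableD (circle_cst_integrable n%:R) (il j).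
  apply: (le_trans (le_Re_herglotz (iu n) in_ z1 _)).
    move=> g; rewrite /u (bigD1 j)//= -[leRHS]addr0; apply: lerD.
      by rewrite /m ge_min lexx orbT.
    by apply: sumr_le0 => i _.
  by rewrite (herglotzD (circle_cst_integrable n%:R) (il j) z1) cReD (Re_herglotz_cst _ z1).
exists (fun n z => cexp (herglotz (u n) z)); split.
- by move=> n; exact: (HB n).1.
- by move=> n z z1; rewrite normc_cexp -expR0 ler_expR H0.
- have c0 : ccvg \oo (fun n => herglotz (u n) 0) (0 : C).
    have iS : rintegrable (fun g => \sum_j `|l j g|).
      by apply: rintegrable_sum => j; exact: rintegrable_norm (il j).
    have mu_ n : cmeas setT (fun g => (u n g)%:C).
      exact: (Cintegrable_cmeas (rintegrable_complex (iu n))).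
    have pt : {ae mu, forall g, setT g -> ccvg \oo (fun n => (u n g)%:C) ((0 : R)%:C)}.
      apply: aeW => g _; apply: cvg_realC; apply: cvg_near_cst.
      have : \forall n \near \oo, forall j, 0 <= n%:R + l j g.
        apply: filter_forall => j; have := nbhs_infty_ger (- l j g); apply: filterS => n.
        by rewrite addrC -lerBlDl sub0r.
      apply: filterS => n h; rewrite /u big1// => j _.
      by rewrite /m; apply/min_idPl.
    have bd n g : setT g -> normc ((u n g)%:C) <= \sum_j `|l j g|.
      by move=> _; rewrite normc_real; apply: le_trans (ler_norm_sum _ _ _) _; exact: ler_sum.
    have [_ lim] := Cint_cvg measurableT mu_ (cmeas_cst setT (0 : R)%:C) iS pt bd.
    rewrite Cint_circle_cst in lim; apply: eq_ccvg lim => n.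
    by rewrite herglotz0 /Cint /=; congr (_ +i* _); exact: circle_Rint_cst.
  have := cdiff_continuous (cdiff_cexp (0 : C)); rewrite /ccontinuous_at cexp0.
  move: c0; rewrite !ccvgE => c0 c; exact: (cvg_comp _ _ c0 c).
- exact: bBF.
(* The boundary value of the multiplier is almost everywhere nonzero, so the nontangential limit of
   [F j] exists and is recovered by division. *)
- move=> n j; have a1 := (HB n).2; have a2 := fatou_nt (HB n).1; have a3 := fatou_nt (bBF n j).
  apply: filterS3 a1 a2 a3 => g e1 e2 e3.
  have := nt_limitM e3 (nt_limitV e1 e2).
  have -> : (fun z => cexp (herglotz (u n) z) * F j z * (cexp (herglotz (u n) z))^-1) = F j.
    by apply/funext => z; rewrite mulrAC mulfV ?mul1r// cexp_neq0.
  by move=> /boundary_valueE ->; rewrite mulrC divfK.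
Qed.

End SmirnovQuotients.

(** * Convexity *)

Section Labels.
Variable R : realType.
Local Notation C := (R[i]).
Local Notation mu := (@circle_measure R).
Implicit Types (g : circle R).

Lemma measurable_fiber (T : finType) (K : Type) (lab : T -> circle R -> K) (a : T -> K) :
  (forall t, measurable (lab t @^-1` [set a t])) -> measurable [set g | forall t, lab t g = a t].
Proof.
move=> ml; have -> : [set g | forall t, lab t g = a t] = \bigcap_(t in [set: T]) (lab t @^-1` [set a t]).
  by apply/seteqP; split => g h t; [move=> _; exact: h|exact: (h t I)].
by apply: fin_bigcap_measurable => [|t _]; [exact: finite_finset|exact: ml].
Qed.

Lemma small_oscillation_labels (T : finType) (v : T -> circle R -> R) (M d : R) : 0 < d ->
  (forall t, measurable_fun setT (v t)) -> (forall t g, - M <= v t g) ->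
  exists lab : circle R -> {ffun T -> nat}, [/\ forall a, measurable (lab @^-1` [set a]),
    forall g g', lab g = lab g' -> forall t, `|v t g - v t g'| <= d &
    forall g t, ((lab g t)%:R : R) <= (v t g + M) / d].
Proof.
move=> d0 mv vM.
have p0 t g : 0 <= (v t g + M) / d.
  by rewrite divr_ge0// ?(ltW d0)//; have := vM t g; rewrite -subr_ge0 opprK.
exists (fun g => [ffun t => Num.truncn ((v t g + M) / d)]); split.
- move=> a; have -> : (fun g => [ffun t => Num.truncn ((v t g + M) / d)]) @^-1` [set a] =
     [set g | forall t, Num.truncn ((v t g + M) / d) = a t].
    apply/seteqP; split => g /=; first by move=> <- t; rewrite ffunE.
    by move=> h; apply/ffunP => t; rewrite ffunE h.
  apply: (@measurable_fiber T nat (fun t g => Num.truncn ((v t g + M) / d))) => t.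
  have -> : (fun g => Num.truncn ((v t g + M) / d)) @^-1` [set a t] =
      setT `&` (fun g => (v t g + M) * d^-1) @^-1` `[(a t)%:R, (a t).+1%:R[.
    apply/seteqP; split => g /=; rewrite in_itv /=.
      by move=> <-; split => //; exact: truncn_itv.
    by move=> [_ h]; exact: truncn_def.
  apply: (measurable_funM (measurable_funD (mv t) (measurable_cst M)) (measurable_cst d^-1) measurableT).
  exact: measurable_itv.
- move=> g g' /ffunP e t; have := e t; rewrite !ffunE => et.
  have := truncn_itv (p0 t g); have := truncn_itv (p0 t g'); rewrite et.
  move: (Num.truncn _) => n /andP[]; rewrite ler_pdivlMr// ltr_pdivrMr// => h1 h2.
  move=> /andP[]; rewrite ler_pdivlMr// ltr_pdivrMr// => h3 h4.
  move: h2 h4; rewrite -natr1 mulrDl mul1r => h2 h4.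
  by rewrite ler_norml; apply/andP; split; lra.
- by move=> g t; rewrite ffunE truncn_le.
Qed.

(** An upper bound as well leaves finitely many labels. This serves for the functions [U], whose
    cells supply the finitely many vectors whose norms are compared. *)
Lemma finitely_many_labels (T : finType) (v : T -> circle R -> R) (M d : R) : 0 < d ->
  (forall t, measurable_fun setT (v t)) -> (forall t g, `|v t g| <= M) ->
  exists (I : finType) (lab : circle R -> I), (forall a, measurable (lab @^-1` [set a])) /\
    forall g g', lab g = lab g' -> forall t, `|v t g - v t g'| <= d.
Proof.
move=> d0 mv vM.
have vM' t g : - M <= v t g by have := vM t g; rewrite ler_norml => /andP[].
have [lab [ml osc lb]] := small_oscillation_labels d0 mv vM'.
pose K := Num.truncn ((M + M) / d).
have lK g t : (lab g t <= K)%N.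
  have h : ((lab g t)%:R : R) <= (M + M) / d.
    apply: le_trans (lb g t) _; rewrite ler_pM2r ?invr_gt0// lerD2r.
    exact: le_trans (ler_norm _) (vM t g).
  by rewrite /K truncn_ge_nat// (le_trans _ h).
exists {ffun T -> 'I_K.+1}, (fun g => [ffun t => inord (lab g t)]); split.
  move=> a; have -> : (fun g => [ffun t => inord (lab g t)]) @^-1` [set a] =
     lab @^-1` [set [ffun t => nat_of_ord (a t)]].
    apply/seteqP; split => g /=.
      by move=> <-; apply/ffunP => t; rewrite !ffunE inordK// ltnS.
    by move=> h; apply/ffunP => t; rewrite ffunE h ffunE inord_val.
  exact: ml.
move=> g g' /ffunP e; apply: osc; apply/ffunP => t; have := e t; rewrite !ffunE => /(congr1 val).
by rewrite /= !inordK ?ltnS.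
Qed.

End Labels.

Section Norms.
Variables (R : realType) (N : nat).
Local Notation C := (R[i]).
Local Notation CN := 'rV[R[i]]_N.
Variable p : CN -> R.
Hypothesis hp : is_norm p.

Lemma is_normD x y : p (x + y) <= p x + p y. Proof. by have [] := hp. Qed.

Lemma is_normZ (a : C) x : p (a *: x) = normc a * p x.
Proof.
have [_ h _] := hp; have := congr1 (@complex.Re R) (h a x).
by rewrite normr_normc /= mul0r subr0.
Qed.

Lemma is_norm0 : p 0 = 0.
Proof. by rewrite -(scale0r (0 : CN)) is_normZ normc0 mul0r. Qed.

Lemma is_normN x : p (- x) = p x.
Proof.
rewrite -scaleN1r is_normZ normcN (_ : normc (1 : C) = 1) ?mul1r//.
by rewrite -[1 in LHS]/(1%:C) normc_real normr1.
Qed.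

Lemma is_norm_ge0 x : 0 <= p x.
Proof.
have := is_normD x (- x); rewrite subrr is_norm0 is_normN -mulr2n.
by rewrite pmulrn_lge0.
Qed.

Lemma is_norm_sum (I : Type) (s : seq I) (F : I -> CN) : p (\sum_(i <- s) F i) <= \sum_(i <- s) p (F i).
Proof.
elim: s => [|i s ih]; first by rewrite !big_nil is_norm0.
by rewrite !big_cons; apply: le_trans (is_normD _ _) _; rewrite lerD2l.
Qed.

Lemma is_norm_le (x : CN) (e : R) : (forall j, normc (x 0 j) <= e) ->
  p x <= e * \sum_j p (delta_mx 0 j).
Proof.
move=> xe; rewrite [in leLHS](row_sum_delta x) mulr_sumr; apply: le_trans (is_norm_sum _ _) _.
by apply: ler_sum => j _; rewrite is_normZ ler_wpM2r ?is_norm_ge0.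
Qed.

End Norms.

Section SimpleFunctions.
Variable R : realType.
Local Notation C := (R[i]).
Local Notation mu := (@circle_measure R).
Implicit Types (g : circle R).

Lemma cbm_sum (I : Type) (s : seq I) (h : I -> circle R -> C) : (forall i, cbm (h i)) ->
  cbm (fun g => \sum_(i <- s) h i g).
Proof.
move=> bh; elim: s => [|i s ih]; first by under eq_fun do rewrite big_nil; exact: cbm_cst.
by under eq_fun do rewrite big_cons; exact: cbmD (bh i) ih.
Qed.

Lemma Cint_indicM (c : C) A : measurable A ->
  Cint mu setT (fun g => c * (\1_A g)%:C) = c * (fine (mu A))%:C.
Proof.
move=> mA; rewrite (CintZl c measurableT (cbm_integrable (cbm_indic mA))) -(Cint_indic mA).
by congr (_ * _); apply: eq_Cint => g _; rewrite mul1r.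
Qed.

Lemma Cint_simple (I : Type) (s : seq I) (c : I -> C) (D : I -> set (circle R)) : (forall i, measurable (D i)) ->
  Cint mu setT (fun g => \sum_(i <- s) c i * (\1_(D i) g)%:C) = \sum_(i <- s) c i * (fine (mu (D i)))%:C.
Proof.
move=> mD; have bD i : cbm (fun g => c i * (\1_(D i) g)%:C) := cbmM (cbm_cst (c i)) (cbm_indic (mD i)).
elim: s => [|i s ih].
  by rewrite big_nil -[RHS]Cint_circle_cst; apply: eq_Cint => g _; rewrite big_nil.
rewrite big_cons -ih -(Cint_indicM (c i) (mD i)).
rewrite -(CintD measurableT (cbm_integrable (bD i)) (cbm_integrable (cbm_sum s bD))).
by apply: eq_Cint => g _; rewrite big_cons.
Qed.

Lemma normc_Cint_indic (h : circle R -> C) A (B : R) : cbm h -> measurable A -> 0 <= B ->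
  (forall g, A g -> normc (h g) <= B) ->
  normc (Cint mu setT (fun g => h g * (\1_A g)%:C)) <= B * fine (mu A).
Proof.
move=> bh mA B0 hB.
have iA : mu.-integrable setT (EFin \o (fun g => B * \1_A g)).
  have := (cbm_integrable (cbmM (cbm_cst B%:C) (cbm_indic mA))).1; congr (mu.-integrable setT (EFin \o _)).
  by apply/funext => g; rewrite cReM /= mul0r subr0.
have -> : B * fine (mu A) = \int[mu]_g (B * \1_A g).
  have rM (x y : R) : Re (x%:C * y%:C) = x * y by rewrite cReM /= mulr0 subr0.
  have := congr1 (@complex.Re R) (Cint_indicM B%:C mA); rewrite rM => <-.
  by rewrite /Cint [RHS]/=; apply: eq_Rintegral => g _ /=; rewrite !(mul0r, mulr0) subr0.
apply: (normc_Cint_le measurableT (cbm_integrable (cbmM bh (cbm_indic mA))) iA) => g _.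
rewrite normcM normc_real indicE; case: (boolP (g \in A)) => [/set_mem Ag|_].
  by rewrite normr1 !mulr1 hB.
by rewrite normr0 !mulr0.
Qed.

Lemma label_indicator (I : finType) (lab : circle R -> I) (c : I -> C) (B : set (circle R)) g :
  \sum_i c i * (\1_(B `&` lab @^-1` [set i]) g)%:C = c (lab g) * (\1_B g)%:C.
Proof.
rewrite (bigD1 (lab g))//= big1 ?addr0.
  by rewrite !indicE in_setI [X in _ && X]mem_set// andbT.
move=> i ni; rewrite indicE in_setI [X in _ && X]memNset ?andbF ?mulr0//=.
by move=> e; rewrite e eqxx in ni.
Qed.

Lemma fine_mu_neq0 A : measurable A -> fine (mu A) != 0 -> forall P : circle R -> Prop,
  {ae mu, forall g, P g} -> exists2 g, A g & P g.
Proof.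
move=> mA A0 P [Z [mZ Z0 PZ]]; apply: contrapT => h; move/eqP: A0; apply.
have [|_ ->//] := circle_complete mZ Z0 (_ : A `<=` Z).
move=> g Ag; apply: PZ => /= Pg; apply: h; exists g => //.
Qed.

End SimpleFunctions.

(** * Jensen's inequality for a measurable family of norms *)

Section Jensen.
Variables (R : realType) (N : nat).
Local Notation C := (R[i]).
Local Notation CN := 'rV[R[i]]_N.
Local Notation mu := (@circle_measure R).
Variables (psi : circle R -> circle R).
Hypothesis mpsi : cmeas setT (fun g => val (psi g)).
Hypothesis mom1 : same_moments psi (fun=> 1) (fun=> 1).
Variables U V : 'I_N -> circle R -> C.
Hypotheses (bU : forall j, cbm (U j)) (bV : forall j, cbm (V j)).
Hypothesis UV : forall j A, measurable A ->
  Cint mu setT (fun g => U j g * (\1_A (psi g))%:C) = Cint mu setT (fun g => V j g * (\1_A g)%:C).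
Variable E : circle R -> CN -> R.
Hypotheses (nE : forall g, is_norm (E g)) (mE : forall x, measurable_fun setT (fun g => E g x)).
Variable K : R.
Hypothesis UK : {ae mu, forall g, E (psi g) (\row_j U j g) <= K}.

Lemma convex_bound (m x k e b l : R) : 0 < m -> m * x <= e * m * b + m * k -> 0 <= e -> b <= l ->
  x <= k + e * l.
Proof.
move=> m0 h e0 bl; rewrite -(ler_pM2l m0); apply: (le_trans h).
by rewrite mulrDr addrC lerD2l mulrCA mulrA ler_wpM2l// mulr_ge0// ltW.
Qed.

(* The circle is cut into countably many cells on which [V] and the norms of the
   finitely many cell centres [q i] of [U] vary by at most [d]; on a cell [V] is,
   up to [d], a convex combination of these centres. *)
Lemma jensen_step (d L : R) : 0 < d ->
  {ae mu, forall g, \sum_j E g (delta_mx 0 j) <= L -> E g (\row_j V j g) <= K + d * (6 * L + 1)}.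
Proof.
move=> d0; have d2 : 0 <= 2 * d by rewrite mulr_ge0// ltW.
have diff (x y : C) : `|Re x - Re y| <= d -> `|Im x - Im y| <= d -> normc (x - y) <= 2 * d.
  move=> h1 h2; apply: le_trans (normc_le_ReIm _) _.
  by rewrite cReD cReN cImD cImN mulrDl mul1r lerD.
have bnd (W : 'I_N -> circle R -> C) : (forall j, cbm (W j)) -> exists M : R, 0 <= M /\ forall j g, normc (W j g) <= M.
  move=> bW; have /choice[MW hMW] : forall j, exists M : R, forall g, normc (W j g) <= M by move=> j; exact: (bW j).2.
  have M0 j : 0 <= MW j by apply: le_trans (hMW j (circle1 R)); exact: normc_ge0.
  exists (\sum_j MW j); split; first by apply: sumr_ge0.
  by move=> j g; apply: le_trans (hMW j g) _; rewrite (bigD1 j)//= lerDl sumr_ge0.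
have [MU [_ hMU]] := bnd U bU; have [MV [MV0 hMV]] := bnd V bV.
pose v1 (t : 'I_N + 'I_N) g := match t with inl j => Re (U j g) | inr j => Im (U j g) end.
have [I [kap [mk osc1]]] : exists (I : finType) (lab : circle R -> I), (forall a, measurable (lab @^-1` [set a])) /\
    forall g g', lab g = lab g' -> forall t, `|v1 t g - v1 t g'| <= d.
  apply: (@finitely_many_labels R _ v1 MU d d0).
    by move=> [j|j]; [exact: (bU j).1.1|exact: (bU j).1.2].
  by move=> [j|j] g; apply: le_trans (hMU j g); [exact: normc_Re|exact: normc_Im].
(* The centre of a cell is a value of [U] on it, and 0 for an empty cell. *)
have /choice[q hq] : forall i, exists q : CN, forall g, kap g = i -> forall j, normc (U j g - q 0 j) <= 2 * d.
  move=> i; have [[g0 <-]|h] := pselect (exists g0, kap g0 = i).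
    exists (\row_j U j g0) => g e j; rewrite mxE.
    by apply: diff; [exact: (osc1 _ _ e (inl j))|exact: (osc1 _ _ e (inr j))].
  by exists 0 => g e; exfalso; apply: h; exists g.
(* The norms of the centres join the coordinates of [V]: the centres being finite in number, these
   are finitely many functions to be labelled. *)
pose v2 (t : ('I_N + 'I_N) + I) g :=
  match t with inl (inl j) => Re (V j g) | inl (inr j) => Im (V j g) | inr i => E g (q i) end.
have [lab [ml osc2 _]] : exists lab : circle R -> {ffun ('I_N + 'I_N) + I -> nat},
   [/\ forall a, measurable (lab @^-1` [set a]),
    forall g g', lab g = lab g' -> forall t, `|v2 t g - v2 t g'| <= d &
    forall g t, ((lab g t)%:R : R) <= (v2 t g + MV) / d].
  apply: (small_oscillation_labels d0).
    by move=> [[j|j]|i]; [exact: (bV j).1.1|exact: (bV j).1.2|exact: mE].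
  move=> [[j|j]|i] g /=.
  - by have := le_trans (normc_Re _) (hMV j g); rewrite ler_norml => /andP[].
  - by have := le_trans (normc_Im _) (hMV j g); rewrite ler_norml => /andP[].
  - by apply: (@le_trans _ _ 0); [rewrite oppr_le0|exact: is_norm_ge0].
(* On [S] each norm is at most [L] times the largest modulus of the coordinates, uniformly in
   [gamma]. *)
pose S := [set g | \sum_j E g (delta_mx 0 j) <= L].
have mS : measurable S.
  have ms : measurable_fun setT (fun g => \sum_j E g (delta_mx 0 j)).
    by apply: measurable_sum => j; exact: mE.
  have -> : S = setT `&` (fun g => \sum_j E g (delta_mx 0 j)) @^-1` `]-oo, L].
    by apply/seteqP; split => g; rewrite /S /= in_itv /=; [|case].
  by apply: ms => //; exact: measurable_itv.
have cell a : {ae mu, forall g, lab g = a -> S g -> E g (\row_j V j g) <= K + d * (6 * L + 1)}.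
  pose A := lab @^-1` [set a] `&` S.
  have mA : measurable A by exact: measurableI.
  (* On a null cell there is nothing to average; the cells are countable, so these may be
     discarded. *)
  have [A0|A0] := eqVneq (fine (mu A)) 0.
    have A00 : mu A = 0%E by rewrite -(fineK (circle_fin_num mA)) A0.
    by apply: filterS (ae_notin mA A00) => g nA ga gS; exfalso; apply: nA.
  apply: aeW => g0 ga gS.
  pose m := fine (mu A).
  have m0 : 0 < m by rewrite lt_def A0 fine_ge0.
  pose pA := psi @^-1` A.
  have mpA : measurable pA := transport_measurable mpsi mom1 mA.
  have mupA : fine (mu pA) = m by rewrite /m -(transport_measure mpsi mom1 mA).
  pose D i := pA `&` kap @^-1` [set i].
  have mD i : measurable (D i) by exact: measurableI.
  pose w i := fine (mu (D i)).
  have w0 i : 0 <= w i by apply: fine_ge0; exact: measure_ge0.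
  have wE (c : I -> C) : Cint mu setT (fun g => c (kap g) * (\1_pA g)%:C) = \sum_i c i * (w i)%:C.
    rewrite -(Cint_simple (index_enum I) c mD); apply: eq_Cint => g _.
    by rewrite (label_indicator kap c pA g).
  have sw : \sum_i w i = m.
    have := wE (fun=> 1); rewrite (Cint_indicM 1 mpA) mul1r mupA => /(congr1 (@complex.Re R)) /= ->.
    rewrite raddf_sum; apply: eq_bigr => i _; by rewrite mul1r.
  have bq j : cbm (fun g => q (kap g) 0 j).
    have e : (fun g => q (kap g) 0 j) = (fun g => \sum_i q i 0 j * (\1_(setT `&` kap @^-1` [set i]) g)%:C).
      by apply/funext => g; rewrite (label_indicator kap (fun i => q i 0 j)) indicT mulr1.
    rewrite e; apply: cbm_sum => i; apply: cbmM; first exact: cbm_cst.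
    by apply: cbm_indic; exact: measurableI.
  pose x : CN := \row_j V j g0.
  (* The defect of [m * x] from the weighted sum of the centres. As [V] over [A] and [U] over [pA]
     have the same integral, only the oscillations remain, [2 * d * m] from each. *)
  pose y : CN := m%:C *: x - \sum_i (w i)%:C *: q i.
  have yj j : normc (y 0 j) <= 4 * d * m.
    have bA := cbm_indic mA; have bpA := cbm_indic mpA.
    have e1 : Cint mu setT (fun g => (x 0 j - V j g) * (\1_A g)%:C) = x 0 j * m%:C - Cint mu setT (fun g => V j g * (\1_A g)%:C).
      rewrite -(Cint_indicM (x 0 j) mA).
      rewrite -(CintB measurableT (cbm_integrable (cbmM (cbm_cst _) bA)) (cbm_integrable (cbmM (bV j) bA))).
      by apply: eq_Cint => g _; rewrite mulrBl.
    have e2 : Cint mu setT (fun g => (U j g - q (kap g) 0 j) * (\1_pA g)%:C) =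
        Cint mu setT (fun g => V j g * (\1_A g)%:C) - \sum_i q i 0 j * (w i)%:C.
      rewrite -(UV j mA) -(wE (fun i => q i 0 j)).
      have := CintB measurableT (cbm_integrable (cbmM (bU j) bpA)) (cbm_integrable (cbmM (bq j) bpA)) => <-.
      by apply: eq_Cint => g _; rewrite mulrBl.
    have -> : y 0 j = Cint mu setT (fun g => (x 0 j - V j g) * (\1_A g)%:C) +
       Cint mu setT (fun g => (U j g - q (kap g) 0 j) * (\1_pA g)%:C).
      rewrite e1 e2 addrA subrK /y !mxE summxE mulrC; congr (_ - _).
      by apply: eq_bigr => i _; rewrite mxE mulrC.
    apply: le_trans (ler_normcD _ _) _.
    have -> : 4 * d * m = 2 * d * m + 2 * d * m by ring.
    apply: lerD.
      apply: (normc_Cint_indic (cbmB (cbm_cst _) (bV j)) mA d2) => g [la _].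
      have e : lab g0 = lab g by rewrite ga la.
      by rewrite mxE; apply: diff; [exact: (osc2 _ _ e (inl (inl j)))|exact: (osc2 _ _ e (inl (inr j)))].
    rewrite -mupA; apply: (normc_Cint_indic (cbmB (bU j) (bq j)) mpA d2) => g _.
    exact: hq.
  have mx_ : m%:C *: x = y + \sum_i (w i)%:C *: q i by rewrite /y subrK.
  (* One [d] is the change of norm between two points with the same label; [2 * d * L] is the cost
     of replacing the centre by the value of [U] at a point of the cell where the bound [K]
     holds. *)
  have wq i : w i * E g0 (q i) <= w i * (K + d * (2 * L + 1)).
    have [->|wi] := eqVneq (w i) 0; first by rewrite !mul0r.
    rewrite ler_wpM2l//; have [g' [[la Sg'] kg'] Kg'] := fine_mu_neq0 (mD i) wi UK.
    have e : lab g0 = lab (psi g') by rewrite ga la.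
    have h1 : E g0 (q i) <= E (psi g') (q i) + d.
      have := osc2 _ _ e (inr i); rewrite /v2 ler_norml => /andP[_].
      by rewrite lerBlDr addrC.
    have h2 : E (psi g') (q i) <= K + 2 * d * L.
      have -> : q i = \row_j U j g' + (q i - \row_j U j g') by rewrite addrC subrK.
      apply: le_trans (is_normD (nE _) _ _) _; apply: lerD; first exact: Kg'.
      have hn j : normc ((q i - \row_j U j g') 0 j) <= 2 * d.
        by rewrite !mxE normcBC; exact: hq.
      apply: le_trans (is_norm_le (nE _) hn) _; rewrite ler_wpM2l//; exact: Sg'.
    apply: le_trans h1 _; apply: le_trans (lerD h2 (lexx d)) _.
    by rewrite le_eqVlt; apply/orP; left; apply/eqP; ring.
  have h3 : m * E g0 x <= 4 * d * m * \sum_j E g0 (delta_mx 0 j) + m * (K + d * (2 * L + 1)).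
    have -> : m * E g0 x = E g0 (m%:C *: x) by rewrite (is_normZ (nE g0)) normc_real gtr0_norm.
    rewrite mx_; apply: le_trans (is_normD (nE g0) _ _) _; apply: lerD.
      exact: (is_norm_le (nE g0) yj).
    rewrite -sw mulr_suml; apply: le_trans (is_norm_sum (nE g0) _ _) _; apply: ler_sum => i _.
    by rewrite (is_normZ (nE g0)) normc_real (ger0_norm (w0 i)).
  have d4 : 0 <= 4 * d by rewrite mulr_ge0// ltW.
  (* The constant [6 * L + 1] is [4 * L] from [y] plus [2 * L + 1] from the centres. *)
  apply: le_trans (convex_bound m0 h3 d4 gS) _.
  by rewrite le_eqVlt; apply/orP; left; apply/eqP; ring.
have all : {ae mu, forall g, forall n, if unpickle n is Some a then lab g = a -> S g -> E g (\row_j V j g) <= K + d * (6 * L + 1) else True}.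
  by apply: ae_foralln => n; case: (unpickle n) => [a|]; [exact: cell|exact: aeW].
apply: filterS all => g h gS; have := h (pickle (lab g)); rewrite pickleK; exact.
Qed.

(** Each [gamma] satisfies the condition of [jensen_step] for some integer [L]; with that [L] fixed,
    [d = 1 / (n + 1)] tends to 0. Taking [L] and [d] from countable sets keeps the exceptional set
    null. *)
Lemma jensen_family : {ae mu, forall g, E g (\row_j V j g) <= K}.
Proof.
have h L : {ae mu, forall g, forall n : nat, \sum_j E g (delta_mx 0 j) <= L%:R ->
    E g (\row_j V j g) <= K + n.+1%:R^-1 * (6 * L%:R + 1)}.
  by apply: ae_foralln => n; apply: jensen_step; rewrite invr_gt0.
apply: filterS (ae_foralln h) => g hg.
pose L := (Num.truncn (\sum_j E g (delta_mx 0 j))).+1.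
have hL : \sum_j E g (delta_mx 0 j) <= L%:R.
  apply: ltW; have s0 : 0 <= \sum_j E g (delta_mx 0 j).
    by apply: sumr_ge0 => j _; exact: (is_norm_ge0 (nE g)).
  by have /andP[] := truncn_itv s0.
have lim : (K + n.+1%:R^-1 * (6 * L%:R + 1)) @[n --> \oo] --> (K : R).
  have e : K = K + 0 * (6 * L%:R + 1) by rewrite mul0r addr0.
  rewrite [X in _ --> X]e.
  apply: cvgD; first exact: cvg_cst.
  by apply: cvgM; [exact: cvg_harmonic|exact: cvg_cst].
apply: (cvgr_to_ge lim); apply: nearW => n; exact: (hg L n hL).
Qed.

End Jensen.

(** * Interpolated norms *)

Section Interpolation.
Variables (R : realType) (N : nat).
Local Notation C := (R[i]).
Local Notation CN := 'rV[R[i]]_N.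
Local Notation mu := (@circle_measure R).
Implicit Types (E : circle R -> CN -> R) (x : CN).

(** The infimum need not be attained, so a competitor with constant [K] is at hand only for [K]
    strictly above it. *)
Lemma lee_real_above (a b : \bar R) : (forall K : R, (a < K%:E)%E -> (b <= K%:E)%E) -> (b <= a)%E.
Proof.
move=> h; rewrite leNgt; apply/negP; move: a b h => [r| |] [s| |] h //= ab.
- have := h ((r + s) / 2); rewrite !lte_fin in ab; rewrite lte_fin lee_fin => h'.
  have : s <= (r + s) / 2 by apply: h'; lra.
  lra.
- by have := h (r + 1); rewrite lte_fin ltrDl ltr01 => /(_ erefl).
- by have := h (s - 1) (ltNyr _); rewrite lee_fin; lra.
- by have := h 0 (ltNyr _).
Qed.

Lemma le_interpolated_norm E x (K : R) (F : 'I_N -> C -> C) : (forall j, bounded_disc (F j)) ->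
  (forall j, F j 0 = x 0 j) -> {ae mu, forall g, E g (\row_j boundary_value (F j) g) <= K} ->
  (interpolated_norm E x <= K%:E)%E.
Proof.
move=> bF F0 FK; pose f z : CN := \row_j F j z.
have fE j : (fun z => f z 0 j) = F j by apply/funext => z; rewrite mxE.
apply: (@le_trans _ _ (ess_sup mu (fun g => (E g (\row_j boundary_value (fun z => f z 0 j) g))%:E))).
  apply: ereal_inf_lbound; exists f; split => //.
    by move=> j; rewrite fE; exact: smirnov_bounded_disc.
  by apply/rowP => j; rewrite mxE F0.
apply/ess_supP; apply: filterS FK => g h; rewrite lee_fin.
by have -> : \row_j boundary_value (fun z => f z 0 j) g = \row_j boundary_value (F j) g;
  [apply/rowP => j; rewrite !mxE fE|].
Qed.

(** Multiplication by [B n / B n 0] keeps the value at 0 and enlarges the norms on the circle by at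
    most [1 / normc (B n 0)], which tends to 1; the strict inequality leaves room for this
    factor. *)
Lemma interpolated_norm_lt E x (K : R) : (forall g, is_norm (E g)) -> (interpolated_norm E x < K%:E)%E ->
  exists F : 'I_N -> C -> C, [/\ forall j, bounded_disc (F j), forall j, F j 0 = x 0 j &
    {ae mu, forall g, E g (\row_j boundary_value (F j) g) <= K}].
Proof.
move=> nE /ereal_inf_lt[r [f [sf f0 ->]] rK].
have [K1 K1K fK] : exists2 K1 : R, K1 < K &
    {ae mu, forall g, E g (\row_j boundary_value (fun z => f z 0 j) g) <= K1}.
  move: rK; have := ess_sup_ge mu (fun g => (E g (\row_j boundary_value (fun z => f z 0 j) g))%:E).
  case: (ess_sup _ _) => [s| |] // h; first by rewrite lte_fin => sK; exists s.
  (* The case of an essential supremum equal to [-oo], in which any constant below [K] serves. *)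
  by move=> _; exists (K - 1); [rewrite ltrBlDr ltrDl|apply: filterS h => g].
have [B [bB B1 B0 bBf bvBf]] := smirnov_bounded sf.
have n1 : normc (1 : C) = 1 by rewrite -[1 in LHS]/(1%:C) normc_real normr1.
have lim : normc (B n 0) @[n --> \oo] --> (1 : R) by rewrite -[X in _ --> X]n1; exact: (cvg_normc B0).
have limK : ((normc (B n 0))^-1 * K1) @[n --> \oo] --> K1.
  rewrite -[X in _ --> X]mul1r -[X in X * _]invr1.
  by apply: cvgM; [apply: cvgV lim; exact: oner_neq0|exact: cvg_cst].
have near1 : \forall n \near (\oo : set_system nat), 0 < normc (B n 0) by exact: (cvgr_gt 1 lim 0 ltr01).
have near2 : \forall n \near (\oo : set_system nat), (normc (B n 0))^-1 * K1 < K by exact: (cvgr_lt K1 limK K K1K).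
have [n _ /(_ n (leqnn n)) [/= Bn0 BnK]] := filterI near1 near2.
pose c := (B n 0)^-1; have B0' : B n 0 != 0 by rewrite -normc_gt0.
exists (fun j z => c * (B n z * f z 0 j)); split.
- by move=> j; exact: bounded_discM (bounded_disc_cst c) (bBf n j).
- by move=> j; rewrite f0 mulrA /c mulVf// mul1r.
have a1 : {ae mu, forall g, forall j, boundary_value (fun z => c * (B n z * f z 0 j)) g =
    c * boundary_value (B n) g * boundary_value (fun z => f z 0 j) g}.
  apply: filter_forall => j; apply: filterS2 (bvBf n j) (fatou_nt (bBf n j)) => g e h.
  by rewrite (boundary_valueE (nt_limitM (@nt_limit_cst R c g) h)) e mulrA.
apply: filterS2 a1 fK => g e h.
have -> : \row_j boundary_value (fun z => c * (B n z * f z 0 j)) g =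
    (c * boundary_value (B n) g) *: \row_j boundary_value (fun z => f z 0 j) g.
  by apply/rowP => j; rewrite !mxE e.
rewrite (is_normZ (nE g)) normcM /c normcV -mulrA.
apply: le_trans (ltW BnK); rewrite ler_wpM2l ?invr_ge0 ?normc_ge0//.
apply: le_trans h; rewrite -[leRHS]mul1r ler_wpM2r ?(is_norm_ge0 (nE g))//.
by apply: boundary_value_bound => z; exact: B1.
Qed.

Variable phi : C -> C.
Hypotheses (phi_inner : inner phi) (phi0 : phi 0 = 0).
Let mpsi := cmeas_boundary_map phi_inner.
Let mom := boundary_map_moments phi_inner phi0.
Variable E : circle R -> CN -> R.
Hypothesis E_family : interpolation_family E.
Let nE := E_family.1.

(** Composition with [psi] preserves measurability and, the measure being invariant, the integral of
    the positive part of the logarithm. *)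
Lemma interpolation_family_inner : interpolation_family (fun g => E (boundary_map phi g)).
Proof.
split; first by move=> g; exact: nE.
move=> x; have [mE iE] := E_family.2 x; split.
  exact: (measurableT_comp mE (transport_measurable_fun mpsi mom)).
pose h g := (Num.max 0 (ln (E g x)))%:E.
have mh : measurable_fun setT h.
  apply/measurable_EFinP; apply: measurable_maxr; first exact: measurable_cst.
  exact: (measurableT_comp (@measurable_ln R) mE).
have h0 g : (0 <= h g)%E by rewrite lee_fin le_max lexx.
have e := transport_integral mpsi mom mh h0.
exact: (eq_ind_r (fun y => (y < +oo)%E) iE e).
Qed.

Lemma interpolated_norm_inner_le x :
  (interpolated_norm (fun g => E (boundary_map phi g)) x <= interpolated_norm E x)%E.
Proof.
apply: lee_real_above => K /(interpolated_norm_lt nE)[F [bF F0 FK]].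
apply: (le_interpolated_norm (F := fun j z => F j (phi z))).
- by move=> j; exact: (bounded_disc_inner phi_inner phi0 (bF j)).
- by move=> j; rewrite phi0.
have a1 : {ae mu, forall g, forall j, boundary_value (fun z => F j (phi z)) g = boundary_value (F j) (boundary_map phi g)}.
  apply: filter_forall => j; apply: filterS (boundary_value_comp phi_inner phi0 (bF j)) => g h.
  by rewrite (boundary_valueE h).
apply: filterS2 a1 (transport_ae mpsi mom FK) => g e h.
have r : \row_j boundary_value (fun z => F j (phi z)) g = \row_j boundary_value (F j) (boundary_map phi g).
  exact: (congr1 (fun k : 'I_N -> C => \row_j k j) (funext e)).
exact: (eq_ind_r (fun y => E (boundary_map phi g) y <= K) h r).
Qed.

Lemma interpolated_norm_inner_ge x :
  (interpolated_norm E x <= interpolated_norm (fun g => E (boundary_map phi g)) x)%E.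
Proof.
apply: lee_real_above => K /(interpolated_norm_lt (fun g => nE (boundary_map phi g)))[G [bG G0 GK]].
have /choice[F hF] := fun j => inner_average phi_inner phi0 (bG j).
have bF j : bounded_disc (F j) by have [] := hF j.
apply: (le_interpolated_norm (F := F)) => //.
  by move=> j; have [_ -> _] := hF j.
apply: (jensen_family mpsi mom (fun j => cbm_boundary_value (bG j)) (fun j => cbm_boundary_value (bF j)) _ nE _ GK).
  by move=> j A mA; have [_ _ h] := hF j; exact: h.
by move=> y; have [] := E_family.2 y.
Qed.

End Interpolation.

Local Close Scope complex_scope.

Theorem proposition0p2 (R : realType) (phi : R[i] -> R[i])
    (phi_inner : inner phi) (phi0 : phi 0 = 0)
    (N : nat) (E : circle R -> 'rV[R[i]]_N -> R)
    (E_family : interpolation_family E) :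
  interpolation_family (fun gamma => E (boundary_map phi gamma)) /\
  forall x : 'rV[R[i]]_N,
    interpolated_norm (fun gamma => E (boundary_map phi gamma)) x =
    interpolated_norm E x.
Proof.
split; first exact: interpolation_family_inner.
move=> x; apply/eqP; rewrite eq_le.
by rewrite interpolated_norm_inner_le// interpolated_norm_inner_ge.
Qed.
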